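(* Let $\mathcal{C}\subset\mathbb{C}$ be a channel, let $\alpha_0$ be its central stream line, and let $\alpha$ be a stream line for the flow of an incompressible (ideal) fluid in $\mathcal{C}$. Then there is a quasiconformal homeomorphism $f:\mathbb{C}\to\mathbb{C}$ with $f(\alpha_0)=\alpha$, with $f|_{\mathbb{C}\setminus\mathcal{C}}$ equal to the identity, and such that $f$ is $K_f$-quasiconformal with $$K_f\le e^{d_{hyp}(\alpha_0,\alpha)},$$ where $d_{hyp}$ is the hyperbolic distance of $\mathcal{C}$.
   Context: Let $\mathcal{S}=\{z\in\mathbb{C}:|\operatorname{Im}z|<\pi/2\}$. A channel is a domain $\mathcal{C}=\varphi(\mathcal{S})$, where $\varphi:\mathcal{S}\to\mathbb{C}$ is conformal (holomorphic and injective) with $\varphi(x+iy)\to\pm\infty$ as $x\to\pm\infty$, meaning that for each fixed $y\in(-\pi/2,\pi/2)$, $\operatorname{Re}\varphi(x+iy)\to+\infty$ as $x\to+\infty$ and $\operatorname{Re}\varphi(x+iy)\to-\infty$ as $x\to-\infty$. The stream lines of the ideal fluid flow in $\mathcal{C}$ (source at $-\infty$, sink at $+\infty$) are the level curves $\{h=c\}$, $-1<c<1$, of the harmonic function $h:\mathcal{C}\to\mathbb{R}$ normalised to have boundary values $+1$ on $\varphi(\{\operatorname{Im}z=\pi/2\})$ and $-1$ on $\varphi(\{\operatorname{Im}z=-\pi/2\})$, namely $h(\varphi(x+iy))=2y/\pi$; that is, the stream lines are the curves $\varphi(\mathbb{R}+iy)$, $|y|<\pi/2$. The central stream line is $\alpha_0=\{h=0\}=\varphi(\mathbb{R})$.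 The hyperbolic distance $d_{hyp}$ of $\mathcal{C}$ is that of the complete conformal metric of curvature $-1$ (on $\mathcal{S}$ it is $|dz|/\cos(\operatorname{Im}z)$), and $d_{hyp}(\alpha_0,\alpha)=\inf\{d_{hyp}(z,w):z\in\alpha_0,\,w\in\alpha\}$. A homeomorphism $f:\Omega\to\Omega'$ between planar domains is $K$-quasiconformal, $1\le K<\infty$, if $f\in W^{1,2}_{loc}(\Omega,\mathbb{C})$ and $|Df(z)|^2\le K\,J(z,f)$ for almost every $z\in\Omega$, where $Df$ is the Jacobian matrix, $|\cdot|$ the operator norm, and $J(z,f)=\det Df(z)$. *)

(* Defs.v *)
From HB Require Import structures.
From mathcomp Require Export all_boot all_order all_algebra complex.
From mathcomp Require Export all_classical all_reals all_analysis.

Set Implicit Arguments.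
Unset Strict Implicit.
Unset Printing Implicit Defensive.

Import Order.TTheory GRing.Theory Num.Theory numFieldNormedType.Exports.

Local Open Scope classical_set_scope.
Local Open Scope ring_scope.
Local Open Scope complex_scope.

(* The type ascription gives R[i] the norm topology and the normed module
   structure over itself that the analysis library attaches to any numFieldType;
   differentiability of a map Cplx R -> Cplx R is then complex
   differentiability. *)
Definition Cplx (R : realType) : numFieldType := R[i].

Section Plane.
Context {R : realType}.
Implicit Types (x y : R) (z w : Cplx R).

Definition mkC x y : Cplx R := x +i* y.
Definition ReC z : R := complex.Re z.
Definition ImC z : R := complex.Im z.
Definition absC z : R := ComplexField.Normc.normc z.

End Plane.

Section Channels.
Context {R : realType}.
Implicit Types (phi : Cplx R -> Cplx R) (h : Cplx R -> R).

Definition strip : set (Cplx R) := [set z | `|ImC z| < pi / 2].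

Definition conformal_on (D : set (Cplx R)) phi :=
  (forall z, D z -> derivable phi z 1) /\ {in D &, injective phi}.

Definition channel_map phi :=
  conformal_on strip phi /\
  forall y, `|y| < pi / 2 ->
    (ReC (phi (mkC x y)) @[x --> +oo] --> +oo) /\
    (ReC (phi (mkC x y)) @[x --> -oo] --> -oo).

Definition channel phi : set (Cplx R) := phi @` strip.

(* The harmonic function on the channel with boundary values 1 and -1 on the
   images of the upper and lower sides of the strip. Its values off the channel
   are irrelevant. *)
Definition stream_function phi h :=
  forall x y, `|y| < pi / 2 -> h (phi (mkC x y)) = 2 * y / pi.

Definition stream_line (D : set (Cplx R)) h (c : R) : set (Cplx R) :=
  D `&` [set w | h w = c].

End Channels.

Section Hyperbolic.
Context {R : realType}.
Implicit Types (D : set (Cplx R)) (g : R -> Cplx R).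

(* On the strip the complete conformal metric of curvature -1 is
   |dz| / cos (Im z). Completeness and curvature are conformally invariant, so
   the metric rho |dw| of a domain D conformally equivalent to the strip is
   determined by rho (psi z) |psi' z| = 1 / cos (Im z) for psi conformal from
   the strip onto D; the value does not depend on psi. *)
Definition hyp_density D (w : Cplx R) : R :=
  get [set r : R | exists psi z, [/\ conformal_on strip psi,
    psi @` strip = D, strip z, psi z = w &
    r * absC (derive1 psi z) = (cos (ImC z))^-1]].

Definition C1 (u : R -> R) :=
  (forall t, derivable u t 1) /\ continuous (derive1 u).

(* C^1 on the whole line loses nothing for curves on [0, 1]. The velocity may
   vanish, so a piecewise C^1 curve can be reparametrised, stopping at its
   corners, to a C^1 one of the same length. *)
Definition C1_curve D (z w : Cplx R) g :=
  [/\ C1 (ReC \o g), C1 (ImC \o g), g 0 = z, g 1 = w &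
      forall t, 0 <= t <= 1 -> D (g t)].

Definition speed g (t : R) : R :=
  Num.sqrt (derive1 (ReC \o g) t ^+ 2 + derive1 (ImC \o g) t ^+ 2).

Definition hyp_length D g : \bar R :=
  (\int[@lebesgue_measure R]_(t in `[0%R, 1%R])
     (hyp_density D (g t) * speed g t)%:E)%E.

Definition hyp_dist D (z w : Cplx R) : \bar R :=
  ereal_inf [set hyp_length D g | g in [set g | C1_curve D z w g]].

Definition hyp_dist_sets D (A B : set (Cplx R)) : \bar R :=
  ereal_inf [set hyp_dist D z w | z in A & w in B].

End Hyperbolic.

Section Sobolev.
Context {R : realType}.
Implicit Types (O : set (R * R)) (u v psi : R * R -> R).

Definition mu2 := (@lebesgue_measure R \x @lebesgue_measure R)%E.

Definition axis (j : 'I_2) : R * R := if j == ord0 then (1, 0) else (0, 1).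

Definition partial (j : 'I_2) u : R * R -> R := fun p => 'D_(axis j) u p.

Fixpoint Ck (n : nat) u : Prop :=
  if n is m.+1 then
    continuous u /\
    forall j, (forall p, derivable u p (axis j)) /\ Ck m (partial j u)
  else continuous u.

Definition test_function O psi :=
  (forall n, Ck n psi) /\
  exists K, [/\ compact K, K `<=` O & forall p, ~ K p -> psi p = 0].

Definition L2loc O u :=
  measurable_fun O u /\
  forall K, compact K -> K `<=` O ->
    (\int[mu2]_(p in K) (u p ^+ 2)%:E < +oo)%E.

(* v is the distributional j-th partial derivative of u on O. *)
Definition weak_partial O (j : 'I_2) u v :=
  forall psi, test_function O psi ->
    (\int[mu2]_(p in O) (u p * partial j psi p)%:E =
     - \int[mu2]_(p in O) (v p * psi p)%:E)%E.

End Sobolev.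

Section Quasiconformal.
Context {R : realType}.
Implicit Types (D E : set (Cplx R)) (f : Cplx R -> Cplx R).

Definition coords D : set (R * R) := [set p | D (mkC p.1 p.2)].

Definition component f (i : 'I_2) (p : R * R) : R :=
  if i == ord0 then ReC (f (mkC p.1 p.2)) else ImC (f (mkC p.1 p.2)).

(* f is in W^{1,2}_loc(D, C) with weak Jacobian matrix Df. *)
Definition W12loc D f (Df : R * R -> 'M[R]_2) :=
  forall i, L2loc (coords D) (component f i) /\
    forall j, L2loc (coords D) (fun p => Df p i j) /\
      weak_partial (coords D) j (component f i) (fun p => Df p i j).

(* The norm of the library on matrices is the sup norm. *)
Definition eucl_norm (v : 'cV[R]_2) : R := Num.sqrt (\sum_i v i ord0 ^+ 2).

Definition op_norm (A : 'M[R]_2) : R :=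
  sup [set eucl_norm (A *m v) | v in [set v | eucl_norm v = 1]].

Definition homeomorphism D E f :=
  {within D, continuous f} /\
  exists g, [/\ {within E, continuous g},
    (forall z, D z -> E (f z) /\ g (f z) = z) &
    (forall w, E w -> D (g w) /\ f (g w) = w)].

Definition quasiconformal (K : R) D E f :=
  [/\ 1 <= K, homeomorphism D E f &
    exists2 Df, W12loc D f Df &
      {ae mu2, forall p, coords D p -> op_norm (Df p) ^+ 2 <= K * \det (Df p)}].

End Quasiconformal.

(* Main.v *)
From mathcomp Require Import ring lra.
Require Import Defs.
Import Order.TTheory GRing.Theory Num.Theory numFieldNormedType.Exports.
Local Open Scope classical_set_scope.
Local Open Scope ring_scope.

(** In the strip the stream line alpha is the line Im z = a, with a = c pi / 2,
    and the central stream line is the real axis. The map f is the conjugate by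
    phi of a vertical shear g(x + iy) = x + i u(y), extended by the identity. Here
    u is an increasing C^1 function with u(0) = a that is the identity near
    -pi / 2 and pi / 2. Conformal maps are infinitesimal similarities, so the
    distortion of f is that of g, namely max(u', 1 / u') ([distortion]).

    The hyperbolic distance between the two lines is ln M with
    M = (1 + sin |a|) / cos |a|, so what is needed is 1 / M <= u' <= M. A
    piecewise affine u that fixes -pi / 2 and pi / 2 has slopes 1 - 2 |a| / pi and
    1 + 2 |a| / pi, and 2 |a| / pi < 1 - 1 / M strictly, by concavity
    ([slope_slack]). The slack pays for rounding the corners and for the identity
    near the boundary ([profile_exists]).

    Nothing is known of phi at the boundary of the strip. But f moves only points
    of Z, the image under phi of a closed substrip |Im z| <= y0 with y0 < pi / 2,
    so all that matters is that Z is closed in the plane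
    ([closed_substrip_image]). The hypothesis on phi is a limit along each
    horizontal line separately, and uniformity in the height is recovered as
    follows. The channel omits a point p, and no branch of log(phi - p) takes two
    values that differ by 2 pi i. Bloch's theorem therefore bounds its derivative
    on the substrip ([log_derivative_bound]), and integration along vertical
    segments gives |phi(x) - p| <= A |phi(x + iy) - p| with A independent of x and
    y ([vertical_compare]). As phi(x) tends to infinity with x, so does
    phi(x + iy), uniformly. Hence f is a C^1 homeomorphism of the whole plane, and
    its classical derivatives are its weak ones by Fubini's theorem
    ([C1_weak_partial]).

    For the distance, the Schwarz-Pick lemma shows that the density of the
    channel at phi(z) is 1 / (|phi'(z)| cos (Im z)) whichever conformal map
    computes it ([hyp_density_channel]). The length of a curve from alpha_0 to
    alpha is then at least the integral of 1 / cos over the heights that it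
    crosses, which is ln M ([hyp_length_ge]).

    The function theory starts from Goursat's lemma. A primitive is of class C^1,
    and for C^1 holomorphic functions a formula of Cauchy type on circles follows
    by differentiating in the radius ([circle_formula]); it yields Cauchy's
    estimate and the holomorphy of derivatives. That an injective function has no
    critical point ([univalent_derive_neq0]) comes from a Harnack inequality for
    its difference quotients, which never vanish. *)

Set Implicit Arguments.
Unset Strict Implicit.
Unset Printing Implicit Defensive.

(** * Complex numbers and the topology of the plane *)

(** The form in which derivatives are estimated below: the error bound holds at
    the base point as well, so no punctured neighbourhood is needed. *)
Lemma is_derive1P (K : numFieldType) (V : normedModType K) (f : K -> V) (x : K) (d : V) :
  is_derive x (1 : K) f d <->
  forall e : K, 0 < e ->
    \forall y \near x, `|f y - f x - (y - x) *: d| <= e * `|y - x|.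
Proof.
split.
  move=> fd e e0; have dfx : derivable f x 1 by apply: ex_derive.
  have <- : 'D_1 f x = d by apply: derive_val.
  have /cvgrPdist_le /(_ e e0) := dfx.
  rewrite -/('D_1 f x) near_withinE => H0.
  have H : \forall h \near (0:K), h != 0 -> `|'D_1 f x - h^-1 *: ((f \o shift x) h%:A - f x)| <= e by exact: H0.
  rewrite (near_shift x) in H; near=> y.
  have [->|yx] := eqVneq y x; first by rewrite !subrr scale0r subr0 !normr0 mulr0.
  have yx0 : y - x != 0 by rewrite subr_eq0.
  have : ((fun h : K => h != 0 -> `|'D_1 f x - h^-1 *: ((f \o shift x) h%:A - f x)| <= e) \o shift (0 - x)) y.
    by near: y.
  rewrite /= /shift /= sub0r.
  move=> /(_ yx0); rewrite [_%:A]mulr1 subrK => h.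
  have -> : f y - f x - (y - x) *: 'D_1 f x =
     - ((y - x) *: ('D_1 f x - (y - x)^-1 *: (f y - f x))).
    by rewrite scalerBr scalerA divff// scale1r opprB.
  by rewrite normrN normrZ mulrC ler_pM2r// ?normr_gt0.
move=> h.
suff : (fun h => h^-1 *: ((f \o shift x) (h *: 1) - f x)) @ 0^' --> d.
  by move=> k; apply: DeriveDef; [apply/cvg_ex; exists d|exact: cvg_lim].
apply/cvgrPdist_le => e e0; have := h e e0.
move=> H; rewrite (near_shift (0:K) x) in H; rewrite near_withinE; near=> t => t0.
have : ((fun y : K => `|f y - f x - (y - x) *: d| <= e * `|y - x|) \o shift (x - 0)) t.
  by near: t.
rewrite /= /shift /= [_%:A]mulr1 subr0 addrK.
have -> : d - t^-1 *: (f (t + x) - f x) = - (t^-1 *: (f (t + x) - f x - t *: d)).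
  by rewrite [in RHS]scalerBr scalerA mulVf// scale1r opprB.
by rewrite normrN normrZ normfV ler_pdivrMl ?normr_gt0// mulrC.
Unshelve. all: by end_near. Qed.

Lemma linear1 (K : numFieldType) (L : {linear K -> K}) (v : K) : L v = L 1 * v.
Proof. by have := linearZ_LR L v 1; rewrite -[v *: 1]/(v * 1) mulr1 => ->; exact: mulrC. Qed.

Lemma is_derive_chain (K : numFieldType) (F G : K -> K) (z d d' : K) :
  is_derive (G z) (1 : K) F d -> is_derive z (1 : K) G d' ->
  is_derive z (1 : K) (F \o G) (d * d').
Proof.
move=> [/derivable1_diffP hF <-] [/derivable1_diffP hG <-].
have hFG := differentiable_comp hG hF.
apply: DeriveDef; first by apply/derivable1_diffP.
rewrite (deriveE _ hFG) (deriveE _ hF) (deriveE _ hG) (diff_comp hG hF) /comp.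
exact: (@linear1 K [the {linear K -> K} of 'd F (G z)] ('d G z 1)).
Qed.

Section CplxBasics.
Context {R : realType}.
Local Notation C := (Cplx R).
Implicit Types (z w : C) (x y : R).

Definition rC x : C := mkC x 0.
Definition iC : C := mkC 0 1.
Definition conjC z : C := mkC (ReC z) (- ImC z).

Lemma mkCE z : mkC (ReC z) (ImC z) = z. Proof. by case: z. Qed.
Lemma eq_ReIm z w : ReC z = ReC w -> ImC z = ImC w -> z = w.
Proof. by case: z w => a b [c d] /= -> ->. Qed.
Lemma ReCD z w : ReC (z + w) = ReC z + ReC w. Proof. by case: z w => ? ? []. Qed.
Lemma ImCD z w : ImC (z + w) = ImC z + ImC w. Proof. by case: z w => ? ? []. Qed.
Lemma ReCN z : ReC (- z) = - ReC z. Proof. by case: z. Qed.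
Lemma ImCN z : ImC (- z) = - ImC z. Proof. by case: z. Qed.
Lemma ReCM z w : ReC (z * w) = ReC z * ReC w - ImC z * ImC w.
Proof. by case: z w => ? ? []. Qed.
Lemma ImCM z w : ImC (z * w) = ReC z * ImC w + ImC z * ReC w.
Proof. by case: z w => ? ? []. Qed.
Lemma ReC0 : ReC (0 : C) = 0. Proof. by []. Qed.
Lemma ImC0 : ImC (0 : C) = 0. Proof. by []. Qed.
Lemma ReC1 : ReC (1 : C) = 1. Proof. by []. Qed.
Lemma ImC1 : ImC (1 : C) = 0. Proof. by []. Qed.
Definition ReImE := (ReCD, ImCD, ReCN, ImCN, ReCM, ImCM, ReC0, ImC0, ReC1, ImC1).
Lemma absC_sqr z : absC z ^+ 2 = ReC z ^+ 2 + ImC z ^+ 2.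
Proof. by case: z => a b; rewrite /absC /= sqr_sqrtr// addr_ge0// sqr_ge0. Qed.
Lemma absC_ge0 z : 0 <= absC z. Proof. by case: z => a b; apply: sqrtr_ge0. Qed.
Lemma absCM z w : absC (z * w) = absC z * absC w.
Proof. exact: ComplexField.Normc.normcM. Qed.
Lemma absCV z : absC z^-1 = (absC z)^-1.
Proof. exact: ComplexField.Normc.normcV. Qed.
Lemma absCD z w : absC (z + w) <= absC z + absC w.
Proof. exact: le_normcD. Qed.
Lemma absCN z : absC (- z) = absC z. Proof. exact: normcN. Qed.
Lemma absC0 : absC (0 : C) = 0. Proof. exact: ComplexField.Normc.normc0. Qed.
Lemma absC1 : absC (1 : C) = 1. Proof. exact: ComplexField.Normc.normc1. Qed.
Lemma absC_eq0 z : (absC z == 0) = (z == 0).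
Proof.
apply/eqP/eqP => [/ComplexField.Normc.eq0_normc//|->]; exact: absC0.
Qed.
Lemma absC_gt0 z : (0 < absC z) = (z != 0).
Proof. by rewrite lt0r absC_eq0 absC_ge0 andbT. Qed.
Lemma absC_dist z w : absC (z - w) = absC (w - z).
Proof. by rewrite -opprB absCN. Qed.
Lemma absCB z w : absC (z - w) <= absC z + absC w.
Proof. by rewrite -(absCN w) absCD. Qed.
Lemma absC_lb z w : absC z - absC w <= absC (z - w).
Proof. by rewrite lerBlDr; apply: le_trans (absCD _ _); rewrite subrK. Qed.
Lemma absC_tri z w v : absC (z - w) <= absC (z - v) + absC (v - w).
Proof.
have -> : z - w = (z - v) + (v - w) by ring.
exact: absCD.
Qed.
Lemma absC_rC x : absC (rC x) = `|x|.
Proof. by rewrite /absC /= expr0n /= addr0 sqrtr_sqr. Qed.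
Lemma absC_iC : absC iC = 1.
Proof. by rewrite /absC /= expr0n /= add0r expr1n sqrtr1. Qed.
Lemma Re_le_absC z : `|ReC z| <= absC z.
Proof. by rewrite -ler_sqr ?nnegrE ?absC_ge0// absC_sqr real_normK ?num_real// lerDl sqr_ge0. Qed.
Lemma Im_le_absC z : `|ImC z| <= absC z.
Proof. by rewrite -ler_sqr ?nnegrE ?absC_ge0// absC_sqr real_normK ?num_real// lerDr sqr_ge0. Qed.
Lemma absC_le_ReIm z : absC z <= `|ReC z| + `|ImC z|.
Proof.
rewrite -[leLHS]ger0_norm ?absC_ge0// -ler_sqr ?nnegrE ?addr_ge0//.
rewrite real_normK ?num_real// absC_sqr sqrrD !real_normK ?num_real//.
have h := normr_ge0 (ReC z * ImC z).
by rewrite -normrM; lra.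
Qed.
Lemma rCD x y : rC (x + y) = rC x + rC y. Proof. by apply: eq_ReIm; rewrite ?ReImE /= ?addr0. Qed.
Lemma rCM x y : rC (x * y) = rC x * rC y.
Proof. by apply: eq_ReIm; rewrite ?ReImE /= ?mul0r ?mulr0 ?subr0 ?addr0. Qed.
Lemma rCN x : rC (- x) = - rC x. Proof. by apply: eq_ReIm; rewrite ?ReImE /= ?oppr0. Qed.
Lemma rC0 : rC 0 = 0. Proof. by []. Qed.
Lemma rC1 : rC 1 = 1. Proof. by []. Qed.
Lemma mkC_split x y : mkC x y = rC x + iC * rC y.
Proof. by apply: eq_ReIm; rewrite !ReImE /= ?mul0r ?mul1r ?mulr0 ?subr0 ?addr0 ?add0r. Qed.
Lemma iC2 : iC * iC = -1.
Proof. by apply: eq_ReIm; rewrite !ReImE /=; ring. Qed.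
Lemma conjCM z : conjC z * z = rC (absC z ^+ 2).
Proof. by rewrite absC_sqr; apply: eq_ReIm; rewrite !ReImE /=; ring. Qed.
Lemma absC_conj z : absC (conjC z) = absC z.
Proof. by case: z => a b; rewrite /absC /= sqrrN. Qed.
Lemma normCE z : `|z| = rC (absC z).
Proof. by []. Qed.
Lemma rC_lt x y : (rC x < rC y) = (x < y).
Proof. exact: ltcR. Qed.
Lemma rC_le x y : (rC x <= rC y) = (x <= y).
Proof. exact: lecR. Qed.
Lemma gt0_rC (e : C) : 0 < e -> exists2 x, 0 < x & e = rC x.
Proof.
case: e => a b; rewrite ltcE /= => /andP[/eqP -> a0]; by exists a.
Qed.

Lemma nbhsCP z (P : set C) :
  nbhs z P <-> exists2 e, 0 < e & forall w, absC (w - z) < e -> P w.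
Proof.
split.
  move=> /nbhs_ballP[e /= e0 h]; have [x x0 ex] := gt0_rC e0; exists x => // w wz.
  by apply: h; rewrite /ball /= -/(`|z - w|) normCE ex rC_lt absC_dist.
move=> [e e0 h]; apply/nbhs_ballP; exists (rC e); first by rewrite /= rC_lt.
by move=> w; rewrite /ball /= -/(`|z - w|) normCE rC_lt absC_dist => /h.
Qed.

Lemma near_absC z (e : R) : 0 < e -> \forall w \near z, absC (w - z) < e.
Proof. by move=> e0; apply/nbhsCP; exists e. Qed.

End CplxBasics.

(** * Derivatives of maps of the plane and of plane curves *)

Section Derivatives.
Context {R : realType}.
Local Notation C := (Cplx R).
Implicit Types (z w : C) (x y : R) (F G : C -> C) (g : R -> C).

Lemma cvgCP (T : Type) (A : set_system T) (FA : Filter A) (f : T -> C) (l : C) :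
  f @ A --> l <-> forall e : R, 0 < e -> \forall x \near A, absC (f x - l) < e.
Proof.
split.
  move=> /cvgrPdist_lt h e e0; have := h (rC e).
  rewrite rC_lt => /(_ e0) H; near=> x.
  have : `|l - f x| < rC e by near: x.
  by rewrite normCE rC_lt absC_dist.
move=> h; apply/cvgrPdist_lt => e /gt0_rC[x x0 ->].
have H := h x x0; near=> t.
by rewrite normCE rC_lt absC_dist; near: t.
Unshelve. all: by end_near. Qed.

Lemma contRP g x : {for x, continuous g} <->
  forall e, 0 < e -> \forall y \near x, absC (g y - g x) < e.
Proof. exact: (cvgCP (nbhs_filter x)). Qed.

Lemma contCP F z : {for z, continuous F} <->
  forall e, 0 < e -> \forall w \near z, absC (F w - F z) < e.
Proof. exact: (cvgCP (nbhs_filter z)). Qed.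

Definition cderiv F z d := is_derive (z : C) (1 : C) F d.

Lemma cderivP F z d : cderiv F z d <->
  forall e, 0 < e ->
    \forall w \near z, absC (F w - F z - d * (w - z)) <= e * absC (w - z).
Proof.
split.
  move=> /is_derive1P h e e0; have := h (rC e).
  rewrite rC_lt => /(_ e0) H; near=> x.
  have : `|F x - F z - (x - z) *: d| <= rC e * `|x - z| by near: x.
  by rewrite !normCE -rCM rC_le [_ *: _]mulrC.
move=> h; apply/is_derive1P => e /gt0_rC[x x0 ->].
have H := h x x0; near=> t.
by rewrite !normCE -rCM rC_le [_ *: _]mulrC; near: t.
Unshelve. all: by end_near. Qed.

(** The velocity of a plane curve, defined by estimates because the plane is here
    a normed module over itself and not over the real line. *)
Definition rderiv g x (d : C) := forall e, 0 < e ->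
  \forall y \near x, absC (g y - g x - d * rC (y - x)) <= e * `|y - x|.

Lemma rderivP g x d : rderiv g x d <->
  is_derive x (1 : R) (ReC \o g) (ReC d) /\ is_derive x (1 : R) (ImC \o g) (ImC d).
Proof.
split.
  move=> h; split; apply/is_derive1P => e e0; have H := h e e0; near=> y.
    have : absC (g y - g x - d * rC (y - x)) <= e * `|y - x| by near: y.
    apply: le_trans; apply: le_trans (Re_le_absC _).
    by rewrite !ReImE /= mulr0 subr0 [_ *: _]mulrC.
  have : absC (g y - g x - d * rC (y - x)) <= e * `|y - x| by near: y.
  apply: le_trans; apply: le_trans (Im_le_absC _).
  by rewrite !ReImE /= mulr0 add0r [_ *: _]mulrC.
move=> [/is_derive1P hr /is_derive1P hi] e e0.
have e20 : 0 < e / 2 by rewrite divr_gt0.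
have Hr := hr _ e20; have Hi := hi _ e20; near=> y.
apply: le_trans (absC_le_ReIm _) _; rewrite [e]splitr mulrDl lerD//.
  by rewrite !ReImE /= mulr0 subr0 [_ * (y - x)]mulrC; near: y.
by rewrite !ReImE /= mulr0 add0r [_ * (y - x)]mulrC; near: y.
Unshelve. all: by end_near. Qed.

Lemma cderiv_cont F z d : cderiv F z d -> {for z, continuous F}.
Proof.
move=> h; apply: differentiable_continuous; apply/derivable1_diffP.
exact: (@ex_derive _ _ _ _ _ _ _ h).
Qed.

Lemma derivable_cderiv F z : derivable F z (1 : C) -> cderiv F z (derive1 F z).
Proof. by move=> h; rewrite derive1E; apply: DeriveDef. Qed.

Lemma cderiv_derive1 F z d : cderiv F z d -> derive1 F z = d.
Proof. by move=> h; rewrite derive1E; apply: (@derive_val _ _ _ _ _ _ _ h). Qed.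

Lemma rderiv_near g f x d : (\forall y \near x, g y = f y) -> rderiv g x d ->
  rderiv f x d.
Proof.
move=> FG h e e0; have H := h e e0; near=> w.
have <- : g w = f w by near: w.
have <- : g x = f x by apply: nbhs_singleton FG.
by near: w.
Unshelve. all: by end_near. Qed.

Lemma continuous_ReC : continuous (ReC : C -> R).
Proof.
move=> z; apply/(@cvgrPdist_lt _ R C (nbhs z) (nbhs_filter z)) => e e0; near=> w.
apply: le_lt_trans (_ : absC (w - z) < e); last by near: w; exact: near_absC.
by rewrite absC_dist -ReCN -ReCD Re_le_absC.
Unshelve. all: by end_near. Qed.

Lemma continuous_ImC : continuous (ImC : C -> R).
Proof.
move=> z; apply/(@cvgrPdist_lt _ R C (nbhs z) (nbhs_filter z)) => e e0; near=> w.
apply: le_lt_trans (_ : absC (w - z) < e); last by near: w; exact: near_absC.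
by rewrite absC_dist -ImCN -ImCD Im_le_absC.
Unshelve. all: by end_near. Qed.

Lemma continuous_absC : continuous (absC : C -> R).
Proof.
move=> z; apply/(@cvgrPdist_lt _ R C (nbhs z) (nbhs_filter z)) => e e0; near=> w.
apply: le_lt_trans (_ : absC (w - z) < e); last by near: w; exact: near_absC.
have := absC_lb z w; have := absC_lb w z; rewrite (absC_dist z w) ler_norml => ? ?.
by apply/andP; split; lra.
Unshelve. all: by end_near. Qed.

Lemma rderiv_cont g x d : rderiv g x d -> {for x, continuous g}.
Proof.
move=> /rderivP[hr hi]; apply/cvgCP => e e0.
have cr : {for x, continuous (ReC \o g)}.
  by apply: differentiable_continuous; apply/derivable1_diffP; apply: ex_derive.
have ci : {for x, continuous (ImC \o g)}.
  by apply: differentiable_continuous; apply/derivable1_diffP; apply: ex_derive.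
have e20 : 0 < e / 2 by rewrite divr_gt0.
have Hr := (@cvgrPdist_lt _ R R (nbhs x) (nbhs_filter x) _ _).1 cr _ e20.
have Hi := (@cvgrPdist_lt _ R R (nbhs x) (nbhs_filter x) _ _).1 ci _ e20.
near=> y; apply: le_lt_trans (absC_le_ReIm _) _; rewrite [e]splitr ltrD//.
  by rewrite ReCD ReCN distrC; near: y; exact: Hr.
by rewrite ImCD ImCN distrC; near: y; exact: Hi.
Unshelve. all: by end_near. Qed.

Lemma rderiv_lip g x d : rderiv g x d ->
  \forall y \near x, absC (g y - g x) <= (absC d + 1) * `|y - x|.
Proof.
move=> h; have H := h 1 ltr01; near=> w.
have : absC (g w - g x - d * rC (w - x)) <= 1 * `|w - x| by near: w.
move=> h1; have -> : g w - g x = (g w - g x - d * rC (w - x)) + d * rC (w - x) by ring.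
apply: le_trans (absCD _ _) _; rewrite absCM absC_rC; nra.
Unshelve. all: by end_near. Qed.

Lemma cderiv_eq F z d d' : cderiv F z d -> d = d' -> cderiv F z d'.
Proof. by move=> h <-. Qed.

Lemma cderiv_cst (c : C) z : cderiv (fun=> c) z 0.
Proof. exact: is_derive_cst. Qed.

Lemma cderiv_id z : cderiv (fun w => w) z 1.
Proof. exact: is_derive_id. Qed.

Lemma cderivD F G z d d' : cderiv F z d -> cderiv G z d' ->
  cderiv (fun w => F w + G w) z (d + d').
Proof. exact: is_deriveD. Qed.

Lemma cderivN F z d : cderiv F z d -> cderiv (fun w => - F w) z (- d).
Proof. exact: is_deriveN. Qed.

Lemma cderivB F G z d d' : cderiv F z d -> cderiv G z d' ->
  cderiv (fun w => F w - G w) z (d - d').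
Proof. exact: is_deriveB. Qed.

Lemma cderivM F G z d d' : cderiv F z d -> cderiv G z d' ->
  cderiv (fun w => F w * G w) z (d * G z + F z * d').
Proof.
move=> a b; rewrite addrC (mulrC d); exact: is_deriveM.
Qed.

Lemma cderivMl (c : C) F z d : cderiv F z d -> cderiv (fun w => c * F w) z (c * d).
Proof. by move=> h; have := cderivM (cderiv_cst c z) h; rewrite mul0r add0r. Qed.

Lemma cderivV F z d : F z != 0 -> cderiv F z d ->
  cderiv (fun w => (F w)^-1) z (- d / F z ^+ 2).
Proof.
move=> F0 h; apply: (@DeriveDef _ _ _ _ _ _ _).
  by apply: derivableV => //; exact: (@ex_derive _ _ _ _ _ _ _ h).
rewrite deriveV//; last exact: (@ex_derive _ _ _ _ _ _ _ h).
by rewrite (@derive_val _ _ _ _ _ _ _ h) /GRing.scale /=; field.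
Qed.

Lemma cderiv_comp F G z d d' : cderiv F (G z) d -> cderiv G z d' ->
  cderiv (F \o G) z (d * d').
Proof. exact: is_derive_chain. Qed.

Lemma rderiv_comp F g x d d' : cderiv F (g x) d -> rderiv g x d' ->
  rderiv (F \o g) x (d * d').
Proof.
move=> hF hG e e0.
have L := rderiv_lip hG; have cG := rderiv_cont hG.
pose e1 := e / 2 / (absC d' + 1); pose e2 := e / 2 / (absC d + 1).
have d1 : 0 < absC d + 1 by rewrite ltr_wpDl// absC_ge0.
have d'1 : 0 < absC d' + 1 by rewrite ltr_wpDl// absC_ge0.
have e10 : 0 < e1 by rewrite !divr_gt0.
have e20 : 0 < e2 by rewrite !divr_gt0.
have H1 := (cderivP _ _ _).1 hF e1 e10.
have H2 := hG e2 e20.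
have H1' := cG _ H1; near=> w.
have A : absC (F (g w) - F (g x) - d * (g w - g x)) <= e1 * absC (g w - g x).
  by near: w.
have B : absC (g w - g x - d' * rC (w - x)) <= e2 * `|w - x| by near: w.
have D : absC (g w - g x) <= (absC d' + 1) * `|w - x| by near: w.
have -> : (F \o g) w - (F \o g) x - d * d' * rC (w - x) =
  (F (g w) - F (g x) - d * (g w - g x)) + d * (g w - g x - d' * rC (w - x)).
  by rewrite /=; ring.
apply: le_trans (absCD _ _) _; rewrite [e]splitr mulrDl lerD//.
  apply: le_trans A _; apply: le_trans (ler_wpM2l (ltW e10) D) _.
  by rewrite /e1 mulrA divfK// gt_eqF.
rewrite absCM; apply: le_trans (ler_wpM2l (absC_ge0 _) B) _.
rewrite mulrA ler_wpM2r// /e2 mulrA ler_pdivrMr// mulrC ler_pM2l ?divr_gt0//.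
by rewrite lerDl.
Unshelve. all: by end_near. Qed.

Lemma rderivD g f x d d' : rderiv g x d -> rderiv f x d' ->
  rderiv (fun y => g y + f y) x (d + d').
Proof.
move=> /rderivP[a b] /rderivP[a' b']; apply/rderivP; rewrite !ReImE; split.
  have -> : ReC \o (fun y => g y + f y) = (ReC \o g) + (ReC \o f).
    by apply/funext => y /=; rewrite ReCD.
  exact: is_deriveD.
have -> : ImC \o (fun y => g y + f y) = (ImC \o g) + (ImC \o f).
  by apply/funext => y /=; rewrite ImCD.
exact: is_deriveD.
Qed.

Lemma rderivM g f x d d' : rderiv g x d -> rderiv f x d' ->
  rderiv (fun y => g y * f y) x (d * f x + g x * d').
Proof.
move=> /rderivP[a b] /rderivP[a' b']; apply/rderivP; split.
  have -> : ReC \o (fun y => g y * f y) =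
      (ReC \o g) * (ReC \o f) - (ImC \o g) * (ImC \o f).
    by apply/funext => y /=; rewrite ReCM.
  apply: (is_derive_eq (is_deriveB (is_deriveM a a') (is_deriveM b b'))).
  by rewrite !ReImE /= /GRing.scale /=; ring.
have -> : ImC \o (fun y => g y * f y) =
    (ReC \o g) * (ImC \o f) + (ImC \o g) * (ReC \o f).
  by apply/funext => y /=; rewrite ImCM.
apply: (is_derive_eq (is_deriveD (is_deriveM a b') (is_deriveM b a'))).
by rewrite !ReImE /= /GRing.scale /=; ring.
Qed.

Lemma rderiv_cst (c : C) x : rderiv (fun=> c) x 0.
Proof.
move=> e e0; near=> y.
by rewrite subrr mul0r subr0 absC0 mulr_ge0// ltW.
Unshelve. all: by end_near. Qed.

Lemma rderiv_rC (f : R -> R) x (d : R) : is_derive x (1 : R) f d ->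
  rderiv (fun y => rC (f y)) x (rC d).
Proof.
move=> h; apply/rderivP; split=> //=.
have -> : ImC \o (fun y => rC (f y)) = cst (0 : R) by apply/funext.
exact: is_derive_cst.
Qed.

Lemma rderivMl (c : C) g x d : rderiv g x d -> rderiv (fun y => c * g y) x (c * d).
Proof. by move=> h; have := rderivM (rderiv_cst c x) h; rewrite mul0r add0r. Qed.

Lemma rderivN g x d : rderiv g x d -> rderiv (fun y => - g y) x (- d).
Proof.
move=> /(rderivMl (- 1)); rewrite mulN1r; apply: rderiv_near.
by near=> y; rewrite mulN1r.
Unshelve. all: by end_near. Qed.

Lemma rderivB g f x d d' : rderiv g x d -> rderiv f x d' ->
  rderiv (fun y => g y - f y) x (d - d').
Proof. by move=> a /rderivN b; exact: rderivD. Qed.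

Lemma rderiv_line z (v : C) x : rderiv (fun t => z + rC t * v) x v.
Proof.
have := rderivD (rderiv_cst z x) (rderivMl v (rderiv_rC (is_derive_id x 1))).
rewrite add0r rC1 mulr1; apply: rderiv_near.
by near=> y; rewrite mulrC.
Unshelve. all: by end_near. Qed.

Lemma rderiv_repar g (f : R -> R) x d (d' : R) : rderiv g (f x) d ->
  is_derive x (1 : R) f d' -> rderiv (g \o f) x (d * rC d').
Proof.
move=> /rderivP[a b] h; apply/rderivP.
rewrite !ReImE /= !mulr0 subr0 add0r.
by split; [apply: (is_derive1_comp a h)|apply: (is_derive1_comp b h)].
Qed.

(** The real mean value theorem applied to the component of the curve in the
    direction g b - g a. *)
Lemma mean_value_le g (dg : R -> C) (a b M : R) : a <= b ->
  (forall t, a <= t <= b -> rderiv g t (dg t)) ->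
  (forall t, a <= t <= b -> absC (dg t) <= M) ->
  absC (g b - g a) <= M * (b - a).
Proof.
move=> ab dgt dgM.
have [->|gab] := eqVneq (g b - g a) 0.
  rewrite absC0 mulr_ge0 ?subr_ge0//.
  by apply: le_trans (dgM a _); rewrite ?absC_ge0 ?lexx.
pose v := conjC (g b - g a).
pose f t := ReC (v * g t).
have df t : a <= t <= b -> is_derive t (1 : R) f (ReC (v * dg t)).
  by move=> tab; have /rderivP[] := rderivMl v (dgt t tab).
have cf : {within `[a, b], continuous f}.
  apply: derivable_within_continuous => t; rewrite in_itv /= => tab.
  exact: (@ex_derive _ _ _ _ _ _ _ (df t tab)).
have [|c] := @MVT_segment R f (fun t => ReC (v * dg t)) a b ab _ cf.
  by move=> t; rewrite in_itv /= => /andP[at_ tb]; apply: df; rewrite !ltW.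
rewrite in_itv /= => cab E.
have absg : 0 < absC (g b - g a) by rewrite absC_gt0.
rewrite -(ler_pM2l absg).
have <- : f b - f a = absC (g b - g a) * absC (g b - g a).
  by rewrite /f -ReCN -ReCD -mulrBr conjCM /= expr2.
rewrite E mulrA ler_wpM2r ?subr_ge0//.
apply: le_trans (ler_norm _) _; apply: le_trans (Re_le_absC _) _.
by rewrite absCM absC_conj ler_wpM2l ?absC_ge0// dgM.
Qed.

End Derivatives.

(** * Integrals of continuous plane curves *)

Section Integrals.
Context {R : realType}.
Local Notation C := (Cplx R).
Implicit Types (z w : C) (x y a b c : R) (g h G : R -> C).

Lemma real_antiderivative (f : R -> R) a : continuous f ->
  exists F : R -> R, forall x, a < x -> is_derive x (1 : R) F (f x).
Proof.
move=> cf.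
exists (fun x => \int[@lebesgue_measure R]_(t in `[a, x]) f t) => x ax.
have xx1 : x < x + 1 by rewrite ltrDl.
have [|d e] := @continuous_FTC1_closed R f a x (x + 1) xx1 _ ax (cf x).
  apply: continuous_compact_integrable; first exact: segment_compact.
  by apply: continuous_subspaceT => y; exact: cf.
by apply: DeriveDef; [exact: d|rewrite -derive1E; exact: e].
Qed.

Lemma antiderivative g a : continuous g ->
  exists G : R -> C, forall x, a < x -> rderiv G x (g x).
Proof.
move=> cg.
have [|A hA] := @real_antiderivative (ReC \o g) a.
  by move=> x; apply: continuous_comp; [exact: cg|exact: continuous_ReC].
have [|B hB] := @real_antiderivative (ImC \o g) a.
  by move=> x; apply: continuous_comp; [exact: cg|exact: continuous_ImC].
exists (fun x => mkC (A x) (B x)) => x ax.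
by apply/rderivP; split; [exact: hA|exact: hB].
Qed.

(** The integral is an increment of a primitive, so that linearity, additivity
    and bounds come from the mean value inequality alone. Primitives are only
    needed to the right of a base point, taken one unit before the smaller
    bound. *)
Definition prim a g : R -> C :=
  get [set G | forall x, a < x -> rderiv G x (g x)].

Definition int a b g : C := let G := prim (Num.min a b - 1) g in G b - G a.

Definition between a b t := Num.min a b <= t <= Num.max a b.

Lemma primP a g : continuous g -> forall x, a < x -> rderiv (prim a g) x (g x).
Proof.
move=> cg; have [G hG] := antiderivative a cg.
by apply: (@getPex _ [set G | forall x, a < x -> rderiv G x (g x)]); exists G.
Qed.

Lemma mean_value_between g (dg : R -> C) a b (M : R) :
  (forall t, between a b t -> rderiv g t (dg t)) ->
  (forall t, between a b t -> absC (dg t) <= M) ->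
  absC (g b - g a) <= M * `|b - a|.
Proof.
rewrite /between => d1 d2; have [ab|/ltW ba] := leP a b.
  rewrite ger0_norm ?subr_ge0//; move: d1 d2; rewrite min_l// max_r// => d1 d2.
  exact: mean_value_le d1 d2.
rewrite distrC ger0_norm ?subr_ge0// absC_dist.
move: d1 d2; rewrite min_r// max_l// => d1 d2.
exact: mean_value_le d1 d2.
Qed.

Lemma betweenl a b : between a b a.
Proof. by rewrite /between ge_min le_max lexx. Qed.
Lemma betweenr a b : between a b b.
Proof. by rewrite /between ge_min le_max lexx !orbT. Qed.
Lemma intE g G a b : continuous g ->
  (forall t, between a b t -> rderiv G t (g t)) -> int a b g = G b - G a.
Proof.
move=> cg hG; rewrite /int; set P := prim _ g.
have hP t : between a b t -> rderiv P t (g t).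
  move=> /andP[t1 t2]; apply: primP => //.
  by apply: lt_le_trans t1; rewrite ltrBlDr ltrDl.
have := @mean_value_between (fun t => P t - G t) (fun t => g t - g t) a b 0.
rewrite mul0r => h; apply/eqP; rewrite -subr_eq0 -absC_eq0 eq_le absC_ge0 andbT.
have -> : P b - P a - (G b - G a) = P b - G b - (P a - G a) by ring.
apply: h => [t tab|t _]; last by rewrite subrr absC0.
exact: rderivB (hP t tab) (hG t tab).
Qed.

Lemma int_le g a b (M : R) : continuous g ->
  (forall t, between a b t -> absC (g t) <= M) ->
  absC (int a b g) <= M * `|b - a|.
Proof.
move=> cg gM; apply: mean_value_between gM => t /andP[t1 t2].
apply: primP => //.
by apply: lt_le_trans t1; rewrite ltrBlDr ltrDl.
Qed.

Lemma common_prim g a : continuous g ->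
  exists G, forall b c, a < b -> a < c -> int b c g = G c - G b.
Proof.
move=> cg; have [G hG] := antiderivative a cg; exists G => b c ab ac.
apply: intE => // t /andP[t1 _]; apply: hG.
by apply: lt_le_trans t1; rewrite lt_min ab.
Qed.

Lemma int_chasles g a b c : continuous g -> int a b g + int b c g = int a c g.
Proof.
move=> cg; have [G hG] := common_prim (Num.min a (Num.min b c) - 1) cg.
have [h1 [h2 h3]] : Num.min a (Num.min b c) - 1 < a /\
    Num.min a (Num.min b c) - 1 < b /\ Num.min a (Num.min b c) - 1 < c.
  set m := Num.min a _; have ma : m <= a by rewrite ge_min lexx.
  have mb : m <= b by rewrite !ge_min lexx !orbT.
  have mc : m <= c by rewrite !ge_min lexx !orbT.
  by split; [lra|split; lra].
rewrite !hG//; ring.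
Qed.

Lemma int_swap g a b : int a b g = - int b a g.
Proof. by rewrite /int minC opprB. Qed.

Lemma int_lin g h (c : C) a b : continuous g -> continuous h ->
  int a b (fun t => g t + c * h t) = int a b g + c * int a b h.
Proof.
move=> cg ch; have [G hG] := antiderivative (Num.min a b - 1) cg.
have [H hH] := antiderivative (Num.min a b - 1) ch.
have lt0 t : between a b t -> Num.min a b - 1 < t.
  by move=> /andP[t1 _]; apply: lt_le_trans t1; rewrite ltrBlDr ltrDl.
rewrite (@intE g G)// => [|t /lt0/hG//].
rewrite (@intE h H)// => [|t /lt0/hH//].
rewrite (@intE _ (fun t => G t + c * H t)) => [| |t /lt0 t0].
- ring.
- move=> t; apply: cvgD; first exact: cg.
  by apply: cvgM; [exact: cvg_cst|exact: ch].
- by apply: rderivD (hG _ t0) (rderivMl _ (hH _ t0)).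
Qed.

Lemma int_cst (c : C) a b : int a b (fun=> c) = c * rC (b - a).
Proof.
rewrite (@intE _ (fun t => 0 + rC t * c)) => [| |t _].
- by rewrite rCD rCN; ring.
- by move=> t; apply: cvg_cst.
- exact: rderiv_line.
Qed.

End Integrals.

(** * Local primitives of holomorphic functions *)

Section Goursat.
Context {R : realType}.
Local Notation C := (Cplx R).
Implicit Types (z w : C) (x y a b c d : R) (F : C -> C).

Definition closed_box a b c d z := a <= ReC z <= b /\ c <= ImC z <= d.
Definition open_box a b c d z := a < ReC z < b /\ c < ImC z < d.
Definition holo_at F z := exists v : C, cderiv F z v.

(** If a property of boxes passes from the four quarters of a box to the box,
    then a box without it contains arbitrarily small boxes without it, which
    shrink to a point. *)
Lemma nested_bisection (P : R -> R -> R -> R -> Prop) a b c d :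
  a <= b -> c <= d -> ~ P a b c d ->
  (forall a b c d, let m := (a + b) / 2 in let n := (c + d) / 2 in
     a <= b -> c <= d ->
     P a m c n -> P m b c n -> P a m n d -> P m b n d -> P a b c d) ->
  exists x y, forall e, 0 < e -> exists a' b' c' d',
    [/\ a <= a' /\ b' <= b, c <= c' /\ d' <= d, a' <= x <= b' /\ c' <= y <= d',
        b' - a' < e /\ d' - c' < e & ~ P a' b' c' d'].
Proof.
move=> ab cd nP split4.
pose T : Type := (R * R * (R * R))%type.
pose ok (q : T) := [/\ q.1.1 <= q.1.2, q.2.1 <= q.2.2 & ~ P q.1.1 q.1.2 q.2.1 q.2.2].
pose nxt (q r : T) := [/\ ok r,
  q.1.1 <= r.1.1 /\ r.1.2 <= q.1.2, q.2.1 <= r.2.1 /\ r.2.2 <= q.2.2,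
  r.1.2 - r.1.1 = (q.1.2 - q.1.1) / 2 & r.2.2 - r.2.1 = (q.2.2 - q.2.1) / 2].
have step q : ok q -> exists r, nxt q r.
  case: q => [[a1 b1] [c1 d1]] [/= ab1 cd1 nP1].
  set m := (a1 + b1) / 2; set n := (c1 + d1) / 2.
  have [m1 m2] : a1 <= m /\ m <= b1 by rewrite /m; split; lra.
  have [n1 n2] : c1 <= n /\ n <= d1 by rewrite /n; split; lra.
  have em : m - a1 = (b1 - a1) / 2 /\ b1 - m = (b1 - a1) / 2.
    by rewrite /m; split; field.
  have en : n - c1 = (d1 - c1) / 2 /\ d1 - n = (d1 - c1) / 2.
    by rewrite /n; split; field.
  case: em en => em1 em2 [en1 en2].
  apply: contrapT => no; apply: nP1; apply: split4 => //; rewrite -/m -/n;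
    apply: contrapT => nQ; apply: no.
  - by exists ((a1, m), (c1, n)).
  - by exists ((m, b1), (c1, n)).
  - by exists ((a1, m), (n, d1)).
  - by exists ((m, b1), (n, d1)).
pose s q : T := if pselect (ok q) is left h then sval (cid (step q h)) else q.
have sP q : ok q -> nxt q (s q).
  by move=> h; rewrite /s; case: pselect => // h'; case: cid.
pose Q n := iter n s ((a, b), (c, d)).
have Q0 : ok (Q 0%N) by split.
have QP n : ok (Q n) /\ nxt (Q n) (Q n.+1).
  by elim: n => [|n [_ [h _ _ _ _]]]; split => //; exact: sP.
have mono n k : (Q n).1.1 <= (Q (n + k)%N).1.1 /\ (Q (n + k)%N).1.2 <= (Q n).1.2
  /\ (Q n).2.1 <= (Q (n + k)%N).2.1 /\ (Q (n + k)%N).2.2 <= (Q n).2.2.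
  elim: k => [|k [h1 [h2 [h3 h4]]]]; first by rewrite addn0.
  rewrite addnS; have [_ [_ [k1 k2] [k3 k4] _ _]] := QP (n + k)%N.
  split; first exact: le_trans h1 k1.
  split; first exact: le_trans k2 h2.
  by split; [exact: le_trans h3 k3|exact: le_trans k4 h4].
have cross n m : (Q n).1.1 <= (Q m).1.2 /\ (Q n).2.1 <= (Q m).2.2.
  have [[h1 h2 _] _] := QP (n + m)%N.
  have [k1 [_ [k3 _]]] := mono n m; have := mono m n; rewrite addnC => -[_ [l2 [_ l4]]].
  by split; [exact: le_trans (le_trans k1 h1) l2|exact: le_trans (le_trans k3 h2) l4].
pose A := range (fun n => (Q n).1.1); pose B := range (fun n => (Q n).2.1).
have supA : has_sup A.
  by split; [exists (Q 0%N).1.1; exists 0%N|exists (Q 0%N).1.2 => _ [n _ <-]; have [] := cross n 0%N].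
have supB : has_sup B.
  by split; [exists (Q 0%N).2.1; exists 0%N|exists (Q 0%N).2.2 => _ [n _ <-]; have [] := cross n 0%N].
have inx n : (Q n).1.1 <= sup A <= (Q n).1.2.
  apply/andP; split; first by apply: sup_ubound; [case: supA|exists n].
  by apply: ge_sup; [case: supA|move=> _ [m _ <-]; have [] := cross m n].
have iny n : (Q n).2.1 <= sup B <= (Q n).2.2.
  apply/andP; split; first by apply: sup_ubound; [case: supB|exists n].
  by apply: ge_sup; [case: supB|move=> _ [m _ <-]; have [] := cross m n].
have len n : (Q n).1.2 - (Q n).1.1 = (b - a) / 2 ^+ n /\
             (Q n).2.2 - (Q n).2.1 = (d - c) / 2 ^+ n.
  elim: n => [|n [h1 h2]]; first by rewrite expr0 !divr1.
  have [_ [_ _ _ k1 k2]] := QP n; rewrite k1 k2 h1 h2 exprS.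
  by split; rewrite invfM mulrA mulrAC -!mulrA; congr (_ * _); rewrite mulrC.
exists (sup A), (sup B) => e e0.
pose n := Num.Def.archi_bound ((b - a + (d - c)) / e).
have hn : b - a + (d - c) < e * 2 ^+ n.
  by rewrite mulrC -ltr_pdivrMr//; apply: upper_nthrootP.
have p2 : 0 < 2 ^+ n :> R by rewrite exprn_gt0.
have [[_ _ nPn] _] := QP n; have [m1 [m2 [m3 m4]]] := mono 0%N n.
have [l1 l2] := len n.
exists (Q n).1.1, (Q n).1.2, (Q n).2.1, (Q n).2.2.
split=> //; split; rewrite ?l1 ?l2 ltr_pdivrMr//; apply: le_lt_trans hn; lra.
Qed.

(** The integral of h dz along the boundary of the rectangle, for a function h
    of the two coordinates. *)
Definition rect (h : R -> R -> C) a b c d : C :=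
  int a b (fun x => h x c) - int a b (fun x => h x d)
  + iC * (int c d (h b) - int c d (h a)).

(** Continuity on each line is all that the four integrals require. *)
Definition sepcont (h : R -> R -> C) :=
  (forall y, continuous (fun x => h x y)) /\ (forall x, continuous (h x)).

Lemma rect_lin h k (v : C) a b c d : sepcont h -> sepcont k ->
  rect (fun x y => h x y + v * k x y) a b c d = rect h a b c d + v * rect k a b c d.
Proof.
move=> [h1 h2] [k1 k2]; rewrite /rect.
rewrite (int_lin _ _ _ (h1 c) (k1 c)) (int_lin _ _ _ (h1 d) (k1 d)).
by rewrite (int_lin _ _ _ (h2 a) (k2 a)) (int_lin _ _ _ (h2 b) (k2 b)); ring.
Qed.

Lemma rect_split4 h a b c d m n : sepcont h ->
  rect h a b c d = rect h a m c n + rect h m b c n + rect h a m n d + rect h m b n d.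
Proof.
move=> [h1 h2]; rewrite /rect.
rewrite -(int_chasles a m b (h1 c)) -(int_chasles a m b (h1 d)).
by rewrite -(int_chasles c n d (h2 a)) -(int_chasles c n d (h2 b)); ring.
Qed.

Lemma rderiv_hor y x : rderiv (fun t => mkC t y : C) x 1.
Proof.
have := rderiv_line (mkC 0 y) 1 x; apply: rderiv_near; near=> t.
by rewrite (mkC_split t) (mkC_split 0) rC0; ring.
Unshelve. all: by end_near. Qed.

Lemma rderiv_ver x y : rderiv (fun t => mkC x t : C) y iC.
Proof.
have := rderiv_line (mkC x 0) iC y; apply: rderiv_near; near=> t.
by rewrite (mkC_split x t) (mkC_split x 0) rC0; ring.
Unshelve. all: by end_near. Qed.

Lemma rect_primitive F G a b c d : sepcont (fun x y => F (mkC x y)) ->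
  (forall z, cderiv G z (F z)) -> rect (fun x y => F (mkC x y)) a b c d = 0.
Proof.
move=> [h1 h2] FG.
have hor y : int a b (fun x => F (mkC x y)) = G (mkC b y) - G (mkC a y).
  apply: (@intE _ _ (fun t => G (mkC t y))) => [|t _]; first exact: h1.
  rewrite -[F _]mulr1.
  by apply: rderiv_comp; [exact: FG|exact: rderiv_hor].
have ver x : iC * int c d (fun y => F (mkC x y)) = G (mkC x d) - G (mkC x c).
  rewrite (@intE _ _ (fun t => - iC * G (mkC x t))) => [|//|t _].
    by rewrite -mulrBr mulrA mulrN iC2 opprK mul1r.
  have -> : F (mkC x t) = - iC * (F (mkC x t) * iC).
    by rewrite mulrCA mulNr iC2 opprK mulr1.
  by apply/rderivMl/rderiv_comp; [exact: FG|exact: rderiv_ver].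
by rewrite /rect !hor mulrBr !ver; ring.
Qed.

Lemma rect_le h a b c d (M : R) : a <= b -> c <= d -> sepcont h ->
  (forall x y, a <= x <= b -> c <= y <= d -> absC (h x y) <= M) ->
  absC (rect h a b c d) <= 2 * M * (b - a + (d - c)).
Proof.
move=> ab cd [h1 h2] hM; rewrite /rect.
have bab t : between a b t -> a <= t <= b by rewrite /between min_l// max_r.
have bcd t : between c d t -> c <= t <= d by rewrite /between min_l// max_r.
have nab : `|b - a| = b - a by rewrite ger0_norm ?subr_ge0.
have ncd : `|d - c| = d - c by rewrite ger0_norm ?subr_ge0.
have e1 : absC (int a b (h^~ c)) <= M * (b - a).
  rewrite -nab; apply: int_le => // t /bab tab.
  by apply: hM; rewrite ?lexx.
have e2 : absC (int a b (h^~ d)) <= M * (b - a).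
  rewrite -nab; apply: int_le => // t /bab tab.
  by apply: hM; rewrite ?lexx ?andbT.
have e3 : absC (int c d (h a)) <= M * (d - c).
  rewrite -ncd; apply: int_le => // t /bcd tab.
  by apply: hM; rewrite ?lexx.
have e4 : absC (int c d (h b)) <= M * (d - c).
  rewrite -ncd; apply: int_le => // t /bcd tab.
  by apply: hM; rewrite ?lexx ?andbT.
apply: le_trans (absCD _ _) _; rewrite absCM absC_iC mul1r.
apply: le_trans (lerD (absCB _ _) (absCB _ _)) _; lra.
Qed.

Lemma sepcont_cont F : continuous F -> sepcont (fun x y => F (mkC x y)).
Proof.
move=> cF; split=> [y x|x y].
  apply: (@continuous_comp _ _ _ (fun t => mkC t y) F); last exact: cF.
  exact: rderiv_cont (rderiv_hor y x).
apply: (@continuous_comp _ _ _ (fun t => mkC x t) F); last exact: cF.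
exact: rderiv_cont (rderiv_ver x y).
Qed.

(** Were the circulation nonzero, bisection would give rectangles shrinking to a
    point on which it is at least a fixed multiple of the square of the
    perimeter. Near that point F is affine up to a small error, and affine
    functions have primitives. *)
Lemma goursat h F a b c d : a <= b -> c <= d -> sepcont h ->
  (forall x y, a <= x <= b -> c <= y <= d -> h x y = F (mkC x y)) ->
  (forall z, closed_box a b c d z -> holo_at F z) ->
  rect h a b c d = 0.
Proof.
move=> ab cd hh hF holoF; apply/eqP; apply: contraT => n0.
pose w := b - a + (d - c); pose A := absC (rect h a b c d).
have A0 : 0 < A by rewrite absC_gt0.
have w0 : 0 <= w by rewrite /w; lra.
pose e := A / (2 * (w ^+ 2 + 1)).
have w1 : 0 < w ^+ 2 + 1 by rewrite ltr_wpDl// sqr_ge0.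
have e0 : 0 < e by rewrite divr_gt0// mulr_gt0.
pose P a b c d : Prop := absC (rect h a b c d) <= e * (b - a + (d - c)) ^+ 2.
have nP : ~ P a b c d.
  rewrite /P -/w -/A /e; apply/negP; rewrite -ltNge mulrAC ltr_pdivrMr ?mulr_gt0//.
  by rewrite ltr_pM2l//; nra.
have [|x [y xy]] := nested_bisection ab cd nP.
  move=> a1 b1 c1 d1 m n ab1 cd1 h1 h2 h3 h4; rewrite /P (rect_split4 _ _ _ _ m n hh).
  apply: le_trans (absCD _ _) _; apply: le_trans (lerD (absCD _ _) (lexx _)) _.
  apply: le_trans (lerD (lerD (absCD _ _) (lexx _)) (lexx _)) _.
  apply: le_trans (lerD (lerD (lerD h1 h2) h3) h4) _.
  by rewrite le_eqVlt; apply/orP; left; apply/eqP; rewrite /m /n; field.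
have [a1 [b1 [c1 [d1 [[k1 k2] [k3 k4] [k5 k6] _ _]]]]] := xy 1 ltr01.
have {holoF} [|D hD] := holoF (mkC x y).
  split => /=; apply/andP; split; lra.
pose z0 : C := mkC x y; pose F0 := F z0.
have e40 : 0 < e / 4 by rewrite divr_gt0.
have /nbhsCP[dl dl0 hdl] := (cderivP _ _ _).1 hD _ e40.
have dl20 : 0 < dl / 2 by rewrite divr_gt0.
have [a2 [b2 [c2 [d2 [[h1 h2] [h3 h4] [h5 h6] [h7 h8] nQ]]]]] := xy _ dl20.
exfalso; apply: nQ; rewrite /P.
pose aff (w : C) := F0 + D * (w - z0).
have caff : continuous aff.
  move=> u; apply: cderiv_cont.
  exact: cderivD (cderiv_cst F0 u)
    (cderivMl D (cderivB (cderiv_id u) (cderiv_cst z0 u))).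
have saff := sepcont_cont caff.
have raff : rect (fun x y => aff (mkC x y)) a2 b2 c2 d2 = 0.
  apply: (@rect_primitive aff (fun u => F0 * u + D / 2 * ((u - z0) * (u - z0)))); first exact: saff.
  move=> u; rewrite /aff.
  apply: cderiv_eq (cderivD (cderivMl F0 (cderiv_id u)) (cderivMl (D / 2)
    (cderivM (cderivB (cderiv_id u) (cderiv_cst z0 u))
             (cderivB (cderiv_id u) (cderiv_cst z0 u))))) _.
  by field.
pose g x y := h x y + (-1) * aff (mkC x y).
have sg : sepcont g.
  split=> [y' x'|x' y'].
    by apply: cvgD; [exact: hh.1|apply: cvgM; [exact: cvg_cst|exact: saff.1]].
  by apply: cvgD; [exact: hh.2|apply: cvgM; [exact: cvg_cst|exact: saff.2]].
have rg : rect g a2 b2 c2 d2 = rect h a2 b2 c2 d2.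
  by rewrite /g rect_lin// raff mulr0 addr0.
rewrite -rg; set w2 := _ + _.
have h5' := h5; have h6' := h6.
move: h5' h6' => /andP[q1 q2] /andP[q3 q4].
have := @rect_le g a2 b2 c2 d2 (e / 4 * w2) _ _ sg.
have -> : 2 * (e / 4 * w2) * w2 = e * w2 ^+ 2 / 2 by field.
move=> hr; apply: le_trans (hr _ _ _) _; [lra|lra| |].
  move=> x1 y1 hx hy; rewrite /g hF; [|lra|lra].
  have E : F (mkC x1 y1) + -1 * aff (mkC x1 y1) =
     F (mkC x1 y1) - F z0 - D * (mkC x1 y1 - z0) by rewrite /aff /F0; ring.
  have dist : absC (mkC x1 y1 - z0) <= w2.
    apply: le_trans (absC_le_ReIm _) _; rewrite !ReImE /= /w2 lerD// ler_norml;
    apply/andP; split; lra.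
  rewrite E; apply: le_trans (hdl _ _) _; last by rewrite ler_pM2l.
  apply: le_lt_trans dist _; rewrite /w2; lra.
have : 0 <= e * w2 ^+ 2 by rewrite mulr_ge0 ?sqr_ge0// ltW.
lra.
Qed.

Lemma rect_swapx h a b c d : rect h b a c d = - rect h a b c d.
Proof. by rewrite /rect (int_swap _ b a) (int_swap (h^~ d) b a); ring. Qed.

Lemma rect_swapy h a b c d : rect h a b d c = - rect h a b c d.
Proof. by rewrite /rect (int_swap _ d c) (int_swap (h a) d c); ring. Qed.

(** F is only controlled on a closed box. Composing it with the projections of
    the coordinates onto the sides gives a function that is continuous along
    every line and that agrees with F on the box. *)
Definition clamp a b x := Num.max a (Num.min b x).

Lemma clamp_id a b x : a <= x <= b -> clamp a b x = x.
Proof. by move=> /andP[ax xb]; rewrite /clamp min_r// max_r. Qed.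

Lemma clamp_bound a b x : a <= b -> a <= clamp a b x <= b.
Proof. by move=> ab; rewrite /clamp le_max lexx ge_max ab ge_min lexx. Qed.

Lemma clamp_lip a b x y : `|clamp a b x - clamp a b y| <= `|x - y|.
Proof.
rewrite /clamp; case: (leP b x) => ?; case: (leP b y) => ?;
  case: (leP a b) => ?; case: (leP a x) => ?; case: (leP a y) => ?;
  have [n1 n2] := ler_normlP _ _ (lexx `|x - y|);
  rewrite ler_norml; apply/andP; split; lra.
Qed.

Lemma clamp_box a b c d x y : a <= b -> c <= d ->
  closed_box a b c d (mkC (clamp a b x) (clamp c d y)).
Proof. by move=> ab cd; split; exact: clamp_bound. Qed.

Lemma holo_continuous F z : holo_at F z -> {for z, continuous F}.
Proof. by move=> [v /cderiv_cont]. Qed.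

Lemma near_distR x (e : R) : 0 < e -> \forall y \near x, `|y - x| < e.
Proof. by move=> e0; exists e => //= y; rewrite /ball_ /= distrC. Qed.

Lemma sepcont_clamp F a b c d : a <= b -> c <= d ->
  (forall z, closed_box a b c d z -> holo_at F z) ->
  sepcont (fun x y => F (mkC (clamp a b x) (clamp c d y))).
Proof.
move=> ab cd hF; split=> [y x|x y].
  apply: (@continuous_comp _ _ _ (fun t => mkC (clamp a b t) (clamp c d y)) F).
    apply/contRP => e e0; near=> t.
    apply: le_lt_trans (absC_le_ReIm _) _; rewrite !ReImE /= subrr normr0 addr0.
    apply: le_lt_trans (clamp_lip _ _ _ _) _; near: t.
    exact: near_distR.
  by apply: holo_continuous; apply: hF; exact: clamp_box.
apply: (@continuous_comp _ _ _ (fun t => mkC (clamp a b x) (clamp c d t)) F).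
  apply/contRP => e e0; near=> t.
  apply: le_lt_trans (absC_le_ReIm _) _; rewrite !ReImE /= subrr normr0 add0r.
  apply: le_lt_trans (clamp_lip _ _ _ _) _; near: t.
  exact: near_distR.
by apply: holo_continuous; apply: hF; exact: clamp_box.
Unshelve. all: by end_near. Qed.

Lemma goursat_signed h F a b c d x1 x2 y1 y2 : sepcont h ->
  (forall x y, a <= x <= b -> c <= y <= d -> h x y = F (mkC x y)) ->
  (forall z, closed_box a b c d z -> holo_at F z) ->
  a <= x1 <= b -> a <= x2 <= b -> c <= y1 <= d -> c <= y2 <= d ->
  rect h x1 x2 y1 y2 = 0.
Proof.
move=> sh hF holoF.
have base u1 u2 v1 v2 : a <= u1 <= b -> a <= u2 <= b -> c <= v1 <= d ->
    c <= v2 <= d -> u1 <= u2 -> v1 <= v2 -> rect h u1 u2 v1 v2 = 0.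
  move=> /andP[? ?] /andP[? ?] /andP[? ?] /andP[? ?] u12 v12.
  apply: (@goursat h F) => // [x y /andP[? ?] /andP[? ?]|z [/andP[? ?] /andP[? ?]]].
    by apply: hF; apply/andP; split; lra.
  by apply: holoF; split; apply/andP; split; lra.
move=> hx1 hx2 hy1 hy2.
have [x12|/ltW x21] := leP x1 x2; have [y12|/ltW y21] := leP y1 y2.
- exact: base.
- by rewrite rect_swapy base ?oppr0.
- by rewrite rect_swapx base ?oppr0.
- by rewrite rect_swapx rect_swapy base ?oppr0.
Qed.

Lemma between_dist x y t : between x y t -> `|t - x| <= `|y - x|.
Proof.
rewrite /between !(ge_min, le_max) => /andP[/orP q1 /orP q2].
have [y1 y2] := ler_normlP _ _ (lexx `|y - x|).
by rewrite ler_norml; apply/andP; split; case: q1 => ?; case: q2 => ?; lra.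
Qed.

(** The primitive is the integral from the corner (a, c) along a horizontal and
    then a vertical segment. By Goursat's lemma its increment between two points
    is the integral along such segments joining them, which yields the
    derivative. *)
Lemma box_primitive F a b c d : a <= b -> c <= d ->
  (forall z, closed_box a b c d z -> holo_at F z) ->
  exists G : C -> C, forall z, open_box a b c d z -> cderiv G z (F z).
Proof.
move=> ab cd holoF.
pose h x y := F (mkC (clamp a b x) (clamp c d y)).
have sh : sepcont h by exact: sepcont_clamp.
have hF x y : a <= x <= b -> c <= y <= d -> h x y = F (mkC x y).
  by move=> xab ycd; rewrite /h !clamp_id.
pose G (z : C) := int a (ReC z) (h^~ c) + iC * int c (ImC z) (h (ReC z)).
have GB z w : closed_box a b c d z -> closed_box a b c d w ->
    G w - G z = int (ReC z) (ReC w) (h^~ (ImC z)) + iC * int (ImC z) (ImC w) (h (ReC w)).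
  move=> [zx zy] [wx wy].
  have lc : c <= c <= d by rewrite lexx.
  have := goursat_signed sh hF holoF zx wx lc zy; rewrite /rect => E.
  rewrite /G -(int_chasles a (ReC z) (ReC w) (sh.1 c)).
  rewrite -(int_chasles c (ImC z) (ImC w) (sh.2 (ReC w))).
  by apply/eqP; rewrite -subr_eq0 -E; apply/eqP; ring.
exists G => z [/andP[az zb] /andP[cz zd]]; apply/cderivP => e e0.
have e20 : 0 < e / 2 by rewrite divr_gt0.
have zbox : closed_box a b c d z by split; rewrite !ltW.
have := holo_continuous (holoF z zbox) => /contCP /(_ _ e20) /nbhsCP[dl dl0 hdl].
pose r := Num.min (Num.min dl (ReC z - a)) (Num.min (b - ReC z) (Num.min (ImC z - c) (d - ImC z))).
have r0 : 0 < r by rewrite !lt_min dl0 !subr_gt0 az zb cz zd.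
apply/nbhsCP; exists r => // w; rewrite !lt_min => /andP[/andP[w1 w2] /and3P[w3 w4 w5]].
have wr : `|ReC w - ReC z| <= absC (w - z) by have := Re_le_absC (w - z); rewrite ReCD ReCN.
have wi : `|ImC w - ImC z| <= absC (w - z) by have := Im_le_absC (w - z); rewrite ImCD ImCN.
have [r1 r2] := (ler_normlP _ _ wr); have [i1 i2] := ler_normlP _ _ wi.
have wbox : closed_box a b c d w by split; apply/andP; split; lra.
have E : G w - G z - F z * (w - z) =
    int (ReC z) (ReC w) (fun x => h x (ImC z) + (-1) * F z)
    + iC * int (ImC z) (ImC w) (fun y => h (ReC w) y + (-1) * F z).
  rewrite GB// (int_lin _ _ _ (sh.1 _) (fun t => cvg_cst _)).
  rewrite (int_lin _ _ _ (sh.2 _) (fun t => cvg_cst _)) !int_cst.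
  have -> : w - z = rC (ReC w - ReC z) + iC * rC (ImC w - ImC z).
    by rewrite -mkC_split -[LHS]mkCE !ReImE.
  by ring.
have hle x y : between (ReC z) (ReC w) x -> between (ImC z) (ImC w) y ->
    absC (h x y + (-1) * F z) <= e / 2.
  move=> /between_dist x1 /between_dist y1.
  have [x2 x3] := ler_normlP _ _ x1; have [y2 y3] := ler_normlP _ _ y1.
  rewrite hF; [|by apply/andP; split; lra|by apply/andP; split; lra].
  rewrite mulN1r; apply: ltW; apply: hdl; apply: le_lt_trans w1.
  rewrite -ler_sqr ?nnegrE ?absC_ge0// !absC_sqr !ReImE /=.
  by rewrite lerD// -[leLHS]real_normK ?num_real// -[leRHS]real_normK ?num_real//
    ler_sqr ?nnegrE.
rewrite E; apply: le_trans (absCD _ _) _; rewrite absCM absC_iC mul1r.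
have ch1 : continuous (fun x => h x (ImC z) + (-1) * F z).
  by move=> t; apply: cvgD; [exact: sh.1|exact: cvg_cst].
have ch2 : continuous (fun y => h (ReC w) y + (-1) * F z).
  by move=> t; apply: cvgD; [exact: sh.2|exact: cvg_cst].
have := int_le ch1 (fun x hx => hle x _ hx (betweenl _ _)).
have := int_le ch2 (fun y hy => hle _ y (betweenr _ _) hy).
move=> I1 I2; apply: le_trans (lerD I2 I1) _.
rewrite -mulrDr [leLHS]mulrC mulrA ler_pdivrMr//; nra.
Qed.

End Goursat.

(** * Cauchy's estimate and the regularity of holomorphic functions *)

Section Cauchy.
Context {R : realType}.
Local Notation C := (Cplx R).
Implicit Types (z w : C) (x y b c d : R) (F G : C -> C).

Lemma compact_uniform (K : set C) (P : R -> C -> Prop) : compact K ->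
  (forall z, K z -> exists2 e, 0 < e &
     forall w d, absC (w - z) < e -> 0 < d < e -> P d w) ->
  exists2 d, 0 < d & forall z, K z -> P d z.
Proof.
move=> /compact_near_coveringP cK hP.
have := cK R (0^'+) P _ _; case.
  move=> z /hP[e e0 h]; exists ([set w | absC (w - z) < e], [set d | 0 < d < e]).
    split => /=; first exact: near_absC.
    by near=> d; apply/andP; split; near: d; [exact: nbhs_right_gt|exact: nbhs_right_lt].
  by move=> [w d] /= [h1 h2]; exact: h.
move=> e /= e0 h; exists (e / 2); first by rewrite divr_gt0.
move=> z Kz; apply: h => //=; rewrite ?divr_gt0//.
by rewrite sub0r normrN gtr0_norm ?divr_gt0//; rewrite /= in e0; lra.
Unshelve. all: by end_near. Qed.

Definition disc z x : set C := [set w | absC (w - z) < x].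

Lemma rderiv_segment F z w dF t : cderiv F (z + rC t * (w - z)) dF ->
  rderiv (fun t => F (z + rC t * (w - z))) t (dF * (w - z)).
Proof. by move=> h; apply: (rderiv_comp h); exact: rderiv_line. Qed.

(** The linear part l is subtracted first, so that closeness of the derivative
    to a constant yields closeness of F to an affine map. *)
Lemma segment_mean_value F (dF : C -> C) z w (l : C) (M : R) :
  (forall t, 0 <= t <= 1 -> cderiv F (z + rC t * (w - z)) (dF (z + rC t * (w - z)))) ->
  (forall t, 0 <= t <= 1 -> absC (dF (z + rC t * (w - z)) - l) <= M) ->
  absC (F w - F z - l * (w - z)) <= M * absC (w - z).
Proof.
move=> h1 h2.
pose g t := F (z + rC t * (w - z)) - l * (rC t * (w - z)).
have := @mean_value_le R g (fun t => dF (z + rC t * (w - z)) * (w - z) - l * (w - z)) 0 1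
  (M * absC (w - z)) ler01.
rewrite subr0 mulr1 /g rC0 rC1 !mul0r mul1r !addr0 mulr0 subr0.
have -> : z + (w - z) = w by rewrite addrC subrK.
have -> : F w - l * (w - z) - F z = F w - F z - l * (w - z) by ring.
apply=> t t01.
  apply: rderivB; first exact: rderiv_segment (h1 t t01).
  apply: rderivMl; have := rderiv_line 0 (w - z) t.
  by apply: rderiv_near; near=> s; rewrite add0r.
by rewrite -mulrBl absCM ler_wpM2r ?absC_ge0// h2.
Unshelve. all: by end_near. Qed.

Lemma disc_segment z u v x t : absC (u - z) < x -> absC (v - z) < x -> 0 <= t <= 1 ->
  absC (u + rC t * (v - u) - z) < x.
Proof.
move=> hu hv /andP[t0 t1].
have -> : u + rC t * (v - u) - z = rC (1 - t) * (u - z) + rC t * (v - z).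
  by rewrite rCD rCN rC1; ring.
apply: le_lt_trans (absCD _ _) _; rewrite !absCM !absC_rC !ger0_norm ?subr_ge0//.
have [t2|t2] := lerP t (1 / 2); nra.
Qed.

(** Compactness makes the first order estimate uniform, which is what
    differentiation under an integral over a circle needs. *)
Lemma uniform_first_order F (dF : C -> C) (K : set C) : compact K ->
  (forall z, K z -> \forall w \near z, cderiv F w (dF w)) ->
  (forall z, K z -> {for z, continuous dF}) ->
  forall e, 0 < e -> exists2 d, 0 < d &
    forall z, K z -> forall w, absC (w - z) < d ->
      absC (F w - F z - dF z * (w - z)) <= e * absC (w - z).
Proof.
move=> cK hF hdF e e0.
apply: (@compact_uniform K (fun d z => forall w, absC (w - z) < d ->
      absC (F w - F z - dF z * (w - z)) <= e * absC (w - z))) => // z Kz.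
have /nbhsCP[r1 r10 h1] := hF z Kz.
have e20 : 0 < e / 2 by rewrite divr_gt0.
have /contCP/(_ _ e20)/nbhsCP[r2 r20 h2] := hdF z Kz.
pose r := Num.min r1 r2.
have r0 : 0 < r by rewrite lt_min r10.
exists (r / 2); first by rewrite divr_gt0.
move=> u d uz /andP[d0 dr] w wu.
have wz : absC (w - z) < r by have := absC_tri w z u; lra.
have uz' : absC (u - z) < r by lra.
have seg t : 0 <= t <= 1 -> absC (u + rC t * (w - u) - z) < r.
  exact: disc_segment.
apply: (@segment_mean_value F dF) => t t01.
  by apply: h1; have := seg t t01; rewrite lt_min => /andP[].
have := seg t t01; rewrite lt_min => /andP[_ /h2 k1].
have := uz'; rewrite lt_min => /andP[_ /h2 k2].
by have := absC_tri (dF (u + rC t * (w - u))) (dF u) (dF z); rewrite (absC_dist (dF z)); lra.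
Qed.

Lemma uniform_continuity F (K : set C) : compact K ->
  (forall z, K z -> {for z, continuous F}) -> forall e, 0 < e ->
  exists2 d, 0 < d & forall z, K z -> forall w, absC (w - z) < d ->
    absC (F w - F z) <= e.
Proof.
move=> cK hF e e0.
apply: (@compact_uniform K (fun d z => forall w, absC (w - z) < d ->
  absC (F w - F z) <= e)) => // z /hF.
have e20 : 0 < e / 2 by rewrite divr_gt0.
move=> /contCP/(_ _ e20)/nbhsCP[r r0 h].
exists (r / 2); first by rewrite divr_gt0.
move=> u d uz /andP[d0 dr] w wu.
have wz : absC (w - z) < r by have := absC_tri w z u; lra.
have uz' : absC (u - z) < r by lra.
have := h _ wz; have := h _ uz'.
by have := absC_tri (F w) (F u) (F z); rewrite (absC_dist (F z)); lra.
Qed.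

Definition expi x : C := mkC (cos x) (sin x).

Lemma rderiv_expi x : rderiv expi x (iC * expi x).
Proof.
apply/rderivP; rewrite !ReImE /= !mul0r !mul1r !add0r.
by split; [exact: is_derive_cos|exact: is_derive_sin].
Qed.

Lemma absC_expi x : absC (expi x) = 1.
Proof.
apply/eqP; rewrite -(@eqrXn2 _ 2%N) ?absC_ge0//.
by rewrite absC_sqr /= cos2Dsin2 expr1n.
Qed.

Lemma expiN x : expi (- x) * expi x = 1.
Proof.
apply: eq_ReIm; rewrite !ReImE /= cosN sinN; last by ring.
by rewrite mulNr opprK -!expr2 cos2Dsin2.
Qed.

Lemma sin_2pi : sin (2 * pi) = 0 :> R.
Proof. by rewrite mulr_natl sin_mulr2n sinpi mulr0 mul0rn. Qed.

Lemma expi2pi : expi (2 * pi) = expi 0.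
Proof. by rewrite /expi sin_2pi mulr_natl cos2pi cos0 sin0. Qed.

Lemma rderiv_expiN x : rderiv (fun t => expi (- t)) x (- iC * expi (- x)).
Proof.
have h := @rderiv_repar R expi (fun t => - t) x _ (-1) (rderiv_expi (- x)) _.
have -> : - iC * expi (- x) = iC * expi (- x) * rC (-1) by rewrite rCN rC1; ring.
by apply: h; exact: is_deriveNid.
Qed.

Definition circ (a : C) x t : C := a + rC x * expi t.

Lemma rderiv_circ a x t : rderiv (circ a x) t (rC x * (iC * expi t)).
Proof.
rewrite -[X in rderiv _ _ X]add0r.
by apply: rderivD (rderiv_cst _ _) (rderivMl _ (rderiv_expi _)).
Qed.

Lemma absC_circ a x t : 0 <= x -> absC (circ a x t - a) = x.
Proof.
by move=> x0; rewrite /circ addrAC subrr add0r absCM absC_expi absC_rC mulr1 ger0_norm.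
Qed.

Definition circle a x : set C := circ a x @` `[0, 2 * pi].

Lemma compact_circle a x : compact (circle a x).
Proof.
apply: continuous_compact; last exact: segment_compact.
by apply: continuous_subspaceT => t; exact: rderiv_cont (rderiv_circ a x t).
Qed.

Lemma pi2_ge0 : 0 <= 2 * pi :> R.
Proof. by rewrite mulr_ge0// pi_ge0. Qed.

Lemma between_circle a x t : between 0 (2 * pi) t -> circle a x (circ a x t).
Proof.
rewrite /between min_l ?pi2_ge0// max_r ?pi2_ge0// => tt.
by exists t => //=; rewrite in_itv.
Qed.

Lemma int_bound g b (M : R) : continuous g -> 0 <= b ->
  (forall t, between 0 b t -> absC (g t) <= M) -> absC (int 0 b g : C) <= M * b.
Proof.
move=> cg b0 gM; have := int_le cg gM; by rewrite subr0 ger0_norm.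
Qed.

Lemma int_diff_bound (g1 g0 dg : R -> C) (h : C) b (M : R) : 0 <= b ->
  continuous g1 -> continuous g0 -> continuous dg ->
  (forall t, between 0 b t -> absC (g1 t - g0 t - dg t * h) <= M) ->
  absC (int 0 b g1 - int 0 b g0 - int 0 b dg * h) <= M * b.
Proof.
move=> b0 c1 c0 cd hM.
have c10 : continuous (fun t => g1 t + (-1) * g0 t).
  by move=> t; apply: cvgD; [exact: c1|apply: cvgM; [exact: cvg_cst|exact: c0]].
have c2 : continuous (fun t => g1 t + (-1) * g0 t + (- h) * dg t).
  by move=> t; apply: cvgD; [exact: c10|apply: cvgM; [exact: cvg_cst|exact: cd]].
have -> : int 0 b g1 - int 0 b g0 - int 0 b dg * h =
    int 0 b (fun t => g1 t + (-1) * g0 t + (- h) * dg t).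
  by rewrite (int_lin _ _ _ c10 cd) (int_lin _ _ _ c1 c0); ring.
apply: int_bound => // t tb.
have -> : g1 t + (-1) * g0 t + (- h) * dg t = g1 t - g0 t - dg t * h by ring.
exact: hM.
Qed.

Definition C1_on (D : set C) F (dF : C -> C) := forall z, D z ->
  cderiv F z (dF z) /\ {for z, continuous dF}.

Lemma disc_near a x z : disc a x z -> \forall w \near z, disc a x w.
Proof.
rewrite /disc /= => h; apply/nbhsCP; exists (x - absC (z - a)); first by rewrite subr_gt0.
move=> w wz /=; have := absC_tri w a z; lra.
Qed.

Lemma continuous_circ (F : C -> C) a r s : 0 <= s < r ->
  (forall z, disc a r z -> {for z, continuous F}) ->
  continuous (fun t => F (circ a s t)).
Proof.
move=> /andP[s0 sr] cF t.
apply: (@continuous_comp _ _ _ (circ a s) F); first exact: rderiv_cont (rderiv_circ a s t).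
by apply: cF; rewrite /disc /= absC_circ.
Qed.

Lemma continuous_expiN : continuous (fun t => expi (- t)).
Proof. by move=> t; exact: rderiv_cont (rderiv_expiN t). Qed.

Lemma circle_disc a s r : 0 <= s < r -> circle a s `<=` disc a r.
Proof. by move=> /andP[s0 sr] _ [t _ <-]; rewrite /disc /= absC_circ. Qed.

Lemma int_expiN : int 0 (2 * pi) (fun t => expi (- t)) = 0.
Proof.
rewrite (@intE _ _ (fun t => iC * expi (- t)) 0 (2 * pi)).
- have -> : expi (- (2 * pi)) = expi (- 0 : R).
    by rewrite /expi oppr0 cosN sinN sin_2pi mulr_natl cos2pi cos0 sin0 oppr0.
  by rewrite subrr.
- exact: continuous_expiN.
move=> t _; have -> : expi (- t) = iC * (- iC * expi (- t)).
  by rewrite mulNr mulrN mulrA iC2 mulN1r opprK.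
exact: rderivMl (rderiv_expiN t).
Qed.

Lemma cst_contR (c : C) : continuous (fun _ : R => c).
Proof. exact: cst_continuous. Qed.

Lemma int_sub_bound (g1 g0 : R -> C) b (M : R) : 0 <= b ->
  continuous g1 -> continuous g0 ->
  (forall t, between 0 b t -> absC (g1 t - g0 t) <= M) ->
  absC (int 0 b g1 - int 0 b g0) <= M * b.
Proof.
move=> b0 c1 c0 hM.
have := int_diff_bound b0 c1 c0 (@cst_contR 0) (h := 0) (M := M).
rewrite [int 0 b (fun=> 0) * 0]mulr0 subr0; apply => t tb.
by rewrite mulr0 subr0; exact: hM.
Qed.

Section CircleFormula.
Variables (F dF : C -> C) (a : C) (r : R).
Hypothesis hF : C1_on (disc a r) F dF.

Let cF z : disc a r z -> {for z, continuous F}.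
Proof. by move=> /hF[/cderiv_cont]. Qed.
Let cdF z : disc a r z -> {for z, continuous dF}.
Proof. by move=> /hF[]. Qed.

Let N s := int 0 (2 * pi) (fun t => F (circ a s t) * expi (- t)).
Let D s := int 0 (2 * pi) (fun t => dF (circ a s t)).

Let contN s : 0 <= s < r -> continuous (fun t => F (circ a s t) * expi (- t)).
Proof.
move=> sr t; apply: cvgM; first exact: (continuous_circ sr cF).
exact: continuous_expiN.
Qed.
Let contD s : 0 <= s < r -> continuous (fun t => dF (circ a s t)).
Proof. by move=> sr; exact: (continuous_circ sr cdF). Qed.

Let derN s : 0 < s < r -> rderiv N s (D s).
Proof.
move=> /andP[s0 sr] e e0.
have sr' : 0 <= s < r by rewrite ltW.
pose e1 := e / (2 * pi).
have p0 : 0 < 2 * pi :> R by rewrite mulr_gt0// pi_gt0.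
have e10 : 0 < e1 by rewrite divr_gt0.
have [|z Kz|z Kz|d d0 hd] := @uniform_first_order F dF (circle a s) _ _ _ e1 e10.
- exact: compact_circle.
- by apply: filterS (disc_near (circle_disc sr' Kz)) => w /hF[].
- by apply: cdF; exact: (circle_disc sr').
have m0 : 0 < Num.min d (Num.min s (r - s)) by rewrite !lt_min d0 s0 subr_gt0.
near=> y.
have : `|y - s| < Num.min d (Num.min s (r - s)) by near: y; exact: near_distR.
rewrite !lt_min => /and3P[y1 y2 y3].
have [l1 l2] := ler_normlP _ _ (lexx `|y - s|).
have yr : 0 <= y < r by apply/andP; split; lra.
apply: le_trans (@int_diff_bound _ _ _ _ _ (e1 * `|y - s|) (ltW p0) (contN yr)
  (contN sr') (contD sr') _) _; last first.
  by rewrite mulrAC /e1 divfK// gt_eqF.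
move=> t tb.
have dz : circ a y t - circ a s t = rC (y - s) * expi t.
  by rewrite /circ rCD rCN; ring.
have := hd _ (between_circle a s tb) (circ a y t).
rewrite dz absCM absC_expi absC_rC mulr1 => /(_ y1).
have -> : F (circ a y t) * expi (- t) - F (circ a s t) * expi (- t)
    - dF (circ a s t) * rC (y - s) =
  (F (circ a y t) - F (circ a s t) - dF (circ a s t) * (rC (y - s) * expi t)) * expi (- t).
  rewrite !mulrBl; congr (_ - _ ).
  by rewrite -!mulrA (mulrC (expi t)) expiN mulr1.
by rewrite absCM absC_expi mulr1.
Unshelve. all: by end_near. Qed.

Let parts s : 0 < s < r -> rC s * D s = N s.
Proof.
move=> /andP[s0 sr]; have sr' : 0 <= s < r by rewrite ltW.
pose g t := (iC * rC s) * dF (circ a s t) + (- iC) * (F (circ a s t) * expi (- t)).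
have cg1 : continuous (fun t => (iC * rC s) * dF (circ a s t)).
  by move=> t; apply: cvgM; [exact: cvg_cst|exact: (contD sr')].
have cg : continuous g.
  by move=> t; apply: cvgD; [exact: cg1|apply: cvgM; [exact: cvg_cst|exact: (contN sr')]].
have : int 0 (2 * pi) g = 0.
  rewrite (@intE _ _ (fun t => F (circ a s t) * expi (- t)) _ _ cg).
    have -> : expi (- (2 * pi)) = expi (- 0 : R).
      by rewrite /expi oppr0 cosN sinN sin_2pi mulr_natl cos2pi cos0 sin0 oppr0.
    have -> : circ a s (2 * pi) = circ a s 0 by rewrite /circ expi2pi.
    by rewrite subrr.
  move=> t _.
  have ct : disc a r (circ a s t) by rewrite /disc /= absC_circ// ltW.
  have := rderivM (rderiv_comp (hF ct).1 (rderiv_circ a s t)) (rderiv_expiN t).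
  rewrite /g /=; congr rderiv.
  rewrite -!mulrA (mulrC (expi t)) expiN mulr1; ring.
rewrite /g (int_lin _ _ _ cg1 (contN sr')) -/(N s).
have -> : int 0 (2 * pi) (fun t => (iC * rC s) * dF (circ a s t)) = iC * rC s * D s.
  have := @int_lin R (fun=> 0) _ (iC * rC s) 0 (2 * pi) (fun t => cvg_cst _) (contD sr').
  rewrite int_cst mul0r add0r => <-.
  by congr int; apply/funext => t; rewrite add0r.
move=> E; have : iC * (rC s * D s - N s) = 0 by rewrite -E; ring.
move/eqP; rewrite mulf_eq0 -absC_eq0 absC_iC oner_eq0 /= subr_eq0 => /eqP; exact.
Qed.

Let scaleN s t : 0 < s -> s <= t -> t < r -> rC t^-1 * N t = rC s^-1 * N s.
Proof.
move=> s0 st tr; apply/eqP; rewrite -subr_eq0 -absC_eq0 eq_le absC_ge0 andbT.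
rewrite -[leRHS](mul0r (t - s)).
apply: (@mean_value_le R (fun y => rC y^-1 * N y)
  (fun y => rC (- y ^- 2) * N y + rC y^-1 * D y)) => // y /andP[sy yt].
  have y0 : 0 < y by lra.
  apply: rderivM; last by apply: derN; apply/andP; split; lra.
  apply: (@rderiv_rC R (fun y : R => y^-1)).
  have := is_deriveV (lt0r_neq0 y0) (is_derive_id y (1 : R)).
  by rewrite /GRing.scale /= mulr1.
have y0 : y != 0 by rewrite gt_eqF//; lra.
rewrite -(@parts y); last by apply/andP; split; lra.
rewrite mulrA -rCM -mulrDl -rCD.
have -> : - y ^- 2 * y + y^-1 = 0 by field.
by rewrite rC0 mul0r absC0.
Qed.

(** Let N(s) be the left side. Differentiating in s gives the integral D(s) of
    the derivative over the circle, and integrating by parts in t gives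
    s D(s) = N(s). Hence N(s) / s is constant, with limit 2 pi dF(a) at 0. *)
Lemma circle_formula s : 0 < s < r ->
  int 0 (2 * pi) (fun t => F (circ a s t) * expi (- t)) = rC (2 * pi * s) * dF a.
Proof.
move=> /andP[s0 sr]; rewrite -/(N s).
have p0 : 0 < 2 * pi :> R by rewrite mulr_gt0// pi_gt0.
have aD : disc a r a by rewrite /disc /= subrr absC0; lra.
suff : rC s^-1 * N s = rC (2 * pi) * dF a.
  have sn0 : s != 0 by rewrite gt_eqF.
  move=> E; rewrite [2 * pi * s]mulrC rCM -mulrA -E mulrA -rCM divff//.
  by rewrite rC1 mul1r.
apply/eqP; rewrite -subr_eq0 -absC_eq0; apply: contraT => n0.
have := absC_ge0 (rC s^-1 * N s - rC (2 * pi) * dF a).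
rewrite le_eqVlt eq_sym (negbTE n0) /=; set E := absC _ => E0.
pose e := E / (2 * (2 * pi)).
have e0 : 0 < e by rewrite divr_gt0// mulr_gt0.
have /cderivP/(_ _ e0)/nbhsCP[d d0 hd] := (hF aD).1.
pose u := Num.min s (d / 2).
have u0 : 0 < u by rewrite lt_min s0 divr_gt0.
have us : u <= s by rewrite ge_min lexx.
have ud : u < d by apply: (@le_lt_trans _ _ (d / 2)); [rewrite ge_min lexx orbT|lra].
have ur : 0 <= u < r by rewrite ltW//=; lra.
have B : absC (N u - rC (2 * pi) * (rC u * dF a)) <= e * u * (2 * pi).
  have <- : int 0 (2 * pi) (fun t => rC u * dF a + F a * expi (- t)) =
      rC (2 * pi) * (rC u * dF a).
    rewrite (int_lin _ _ _ (@cst_contR _) continuous_expiN) int_expiN.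
    by rewrite mulr0 addr0 int_cst subr0 mulrC.
  apply: int_sub_bound; [exact: ltW|exact: contN| |].
    by move=> t; apply: cvgD; [exact: cvg_cst|apply: cvgM; [exact: cvg_cst|exact: continuous_expiN]].
  move=> t _.
  have -> : F (circ a u t) * expi (- t) - (rC u * dF a + F a * expi (- t)) =
     (F (circ a u t) - F a - dF a * (circ a u t - a)) * expi (- t).
    have -> : circ a u t - a = rC u * expi t by rewrite /circ addrAC subrr add0r.
    rewrite !mulrBl -!mulrA (mulrC (expi t)) expiN mulr1; ring.
  have cu := absC_circ a t (ltW u0).
  by have := hd (circ a u t); rewrite cu absCM absC_expi mulr1; exact.
have un0 : u != 0 by rewrite gt_eqF.
have : E <= e * (2 * pi).
  rewrite /E (scaleN u0 us sr).
  have -> : rC u^-1 * N u - rC (2 * pi) * dF a =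
     rC u^-1 * (N u - rC (2 * pi) * (rC u * dF a)).
    have uu : rC u^-1 * rC u = 1 :> C by rewrite -rCM mulVf.
    have -> : rC (2 * pi) * dF a = (rC u^-1 * rC u) * (rC (2 * pi) * dF a).
      by rewrite uu mul1r.
    ring.
  have ui : `|u^-1| = u^-1 by rewrite ger0_norm// invr_ge0 ltW.
  rewrite absCM absC_rC ui ler_pdivrMl//.
  apply: le_trans B _; rewrite le_eqVlt; apply/orP; left; apply/eqP; ring.
have : e * (2 * pi) = E / 2 by rewrite /e; set P := 2 * pi; rewrite invfM (mulrA E) divfK// gt_eqF.
by move=> ->; lra.
Qed.

End CircleFormula.

Lemma cauchy_estimate_C1 F dF a r s (M : R) : C1_on (disc a r) F dF -> 0 < s < r ->
  (forall z, absC (z - a) = s -> absC (F z) <= M) -> absC (dF a) <= M / s.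
Proof.
move=> hF sr hM; have /andP[s0 sr1] := sr.
have p0 : 0 < 2 * pi * s by rewrite !mulr_gt0// pi_gt0.
rewrite -(ler_pM2l p0).
have -> : 2 * pi * s * absC (dF a) = absC (rC (2 * pi * s) * dF a).
  by rewrite absCM absC_rC ger0_norm// ltW.
rewrite -(circle_formula hF sr).
have -> : 2 * pi * s * (M / s) = M * (2 * pi) by field; rewrite gt_eqF.
apply: int_bound; [|exact: pi2_ge0|].
- move=> t; apply: cvgM; last exact: continuous_expiN.
  apply: (@continuous_circ F a r); first by rewrite ltW.
  by move=> z /hF[/cderiv_cont].
- by move=> t _; rewrite absCM absC_expi mulr1; apply: hM; rewrite absC_circ// ltW.
Qed.

(** [circle_formula] at every centre near a writes dF as an integral of F over a
    translated circle, in which the centre can be differentiated under the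
    integral. *)
Lemma circle_deriv F dF a r : 0 < r -> C1_on (disc a r) F dF ->
  let s := r / 3 in forall z, disc a s z ->
    cderiv dF z (rC (2 * pi * s)^-1 *
      int 0 (2 * pi) (fun t => dF (circ z s t) * expi (- t))).
Proof.
move=> r0 hF s.
have s0 : 0 < s by rewrite divr_gt0.
have p0 : 0 < 2 * pi :> R by rewrite mulr_gt0// pi_gt0.
have ps0 : 0 < 2 * pi * s by rewrite mulr_gt0.
move=> z0 z0a.
have sub z : disc a s z -> forall w, disc z (2 * s) w -> disc a r w.
  rewrite /disc /= => hz w hw; have := absC_tri w a z; rewrite /s in hz hw *; lra.
have hFz z : disc a s z -> C1_on (disc z (2 * s)) F dF.
  by move=> hz w hw; apply: hF; exact: sub hw.
have s2 : 0 < s < 2 * s by apply/andP; split; lra.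
have s2' : 0 <= s < 2 * s by apply/andP; split; lra.
have contF z : disc a s z -> continuous (fun t => F (circ z s t) * expi (- t)).
  move=> hz t; apply: cvgM; last exact: continuous_expiN.
  by apply: (@continuous_circ F z (2 * s)) => // w /(hFz z hz)[/cderiv_cont].
have contdF z : disc a s z -> continuous (fun t => dF (circ z s t) * expi (- t)).
  move=> hz t; apply: cvgM; last exact: continuous_expiN.
  by apply: (@continuous_circ dF z (2 * s)) => // w /(hFz z hz)[].
have formula z : disc a s z -> dF z = rC (2 * pi * s)^-1 *
    int 0 (2 * pi) (fun t => F (circ z s t) * expi (- t)).
  move=> hz; rewrite (circle_formula (hFz z hz) s2) mulrA -rCM mulVf ?gt_eqF//.
  by rewrite rC1 mul1r.
apply/cderivP => e e0; pose e1 := e * s.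
have e10 : 0 < e1 by rewrite mulr_gt0.
have [|z Kz|z Kz|d d0 hd] := @uniform_first_order F dF (circle z0 s) _ _ _ e1 e10.
- exact: compact_circle.
- have zd := sub _ z0a _ (circle_disc s2' Kz).
  by apply: filterS (disc_near zd) => w /hF[].
- by apply: (hF _ _).2; exact: sub z0a _ (circle_disc s2' Kz).
have nz := disc_near z0a; have nd := near_absC z0 d0.
near=> z.
have hz : disc a s z by near: z.
have zd : absC (z - z0) < d by near: z.
rewrite !formula//.
set I1 := int _ _ _; set I0 := int _ _ _; set I2 := int _ _ _.
have -> : rC (2 * pi * s)^-1 * I1 - rC (2 * pi * s)^-1 * I0 -
   rC (2 * pi * s)^-1 * I2 * (z - z0) = rC (2 * pi * s)^-1 * (I1 - I0 - I2 * (z - z0)).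
  by ring.
have ui : `|(2 * pi * s)^-1| = (2 * pi * s)^-1 by rewrite ger0_norm// invr_ge0 ltW.
rewrite absCM absC_rC ui ler_pdivrMl//.
have -> : 2 * pi * s * (e * absC (z - z0)) = (e1 * absC (z - z0)) * (2 * pi).
  by rewrite /e1; ring.
apply: int_diff_bound; [exact: ltW|exact: contF|exact: contF|exact: contdF|].
move=> t tb.
have cz : circ z s t - circ z0 s t = z - z0 by rewrite /circ; ring.
have := hd _ (between_circle z0 s tb) (circ z s t); rewrite cz => /(_ zd).
have -> : F (circ z s t) * expi (- t) - F (circ z0 s t) * expi (- t) -
   dF (circ z0 s t) * expi (- t) * (z - z0) =
   (F (circ z s t) - F (circ z0 s t) - dF (circ z0 s t) * (z - z0)) * expi (- t).
  by ring.
by rewrite absCM absC_expi mulr1.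
Unshelve. all: by end_near. Qed.

(** Locally F = G' with G of class C^1, by Goursat's lemma; then [circle_deriv]
    makes F itself of class C^1, and applied to F it makes F' holomorphic. *)
Lemma holo_derive1 F a r : 0 < r -> (forall z, disc a r z -> holo_at F z) ->
  C1_on (disc a r) F (derive1 F) /\ forall z, disc a r z -> holo_at (derive1 F) z.
Proof.
move=> r0 hF.
have dF z : disc a r z -> cderiv F z (derive1 F z).
  by move=> /hF[v hv]; rewrite (cderiv_derive1 hv).
have sub z0 x z : disc a x z0 -> disc z0 (x - absC (z0 - a)) z -> disc a x z.
  by rewrite /disc /= => h1 h2; have := absC_tri z a z0; lra.
have cont z0 : disc a r z0 -> {for z0, continuous (derive1 F)}.
  move=> hz0; pose d := r - absC (z0 - a).
  have d0 : 0 < d by rewrite subr_gt0.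
  pose u := d / 4; have u0 : 0 < u by rewrite divr_gt0.
  have [||z [zx zy]|G hG] := @box_primitive R F (ReC z0 - u) (ReC z0 + u)
     (ImC z0 - u) (ImC z0 + u); [lra|lra| |].
    apply: hF; apply: (sub z0 _ _ hz0); apply: le_lt_trans (absC_le_ReIm _) _.
    have /andP[? ?] := zx; have /andP[? ?] := zy.
    rewrite !ReImE; apply: (@le_lt_trans _ _ (u + u)); last by rewrite -/d /u; lra.
    by apply: lerD; rewrite ler_norml; apply/andP; split; lra.
  have box z : disc z0 u z -> open_box (ReC z0 - u) (ReC z0 + u)
     (ImC z0 - u) (ImC z0 + u) z.
    rewrite /disc /= => zz.
    have := Re_le_absC (z - z0); have := Im_le_absC (z - z0); rewrite !ReImE.
    by move=> /ler_normlP[? ?] /ler_normlP[? ?]; split; apply/andP; split; lra.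
  have discr z : disc z0 u z -> disc a r z.
    by rewrite /disc /= => zz; apply: (sub z0) => //; rewrite /disc /= -/d; rewrite /u in zz; lra.
  have C1G : C1_on (disc z0 u) G F.
    move=> z hz; split; first exact/hG/box.
    by apply: cderiv_cont; exact/dF/discr.
  have /= := circle_deriv u0 C1G; set s := u / 3 => hs.
  have s0 : 0 < s by rewrite divr_gt0.
  have su : s < u by rewrite /s; lra.
  have p0 : 0 < 2 * pi :> R by rewrite mulr_gt0// pi_gt0.
  have ps0 : 0 < 2 * pi * s by rewrite mulr_gt0.
  have z0s : disc z0 s z0 by rewrite /disc /= subrr absC0.
  have su' : 0 <= s < u by rewrite ltW.
  apply/contCP => e e0.
  have es0 : 0 < e * s / 2 by rewrite divr_gt0// mulr_gt0.
  have [|w Kw|dl dl0 hdl] := @uniform_continuity F (circle z0 s) _ _ _ es0.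
  - exact: compact_circle.
  - exact/cderiv_cont/dF/discr/(circle_disc su').
  have nz := disc_near z0s; have nd := near_absC z0 dl0.
  have nu := near_absC z0 s0.
  near=> z.
  have hz : disc z0 s z by near: z.
  have zd : absC (z - z0) < dl by near: z.
  rewrite (cderiv_derive1 (hs _ hz)) (cderiv_derive1 (hs _ z0s)) -mulrBr.
  have ui : `|(2 * pi * s)^-1| = (2 * pi * s)^-1 by rewrite ger0_norm// invr_ge0 ltW.
  rewrite absCM absC_rC ui ltr_pdivrMl//.
  have contF w : disc z0 s w -> continuous (fun t => F (circ w s t) * expi (- t)).
    move=> hw t; apply: cvgM; last exact: continuous_expiN.
    apply: (@continuous_circ F w (2 * s)); first by apply/andP; split; lra.
    move=> v vw; apply/cderiv_cont/dF/discr; rewrite /disc /= in hw vw *.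
    by have := absC_tri v z0 w; rewrite /s in hw vw *; lra.
  apply: (@le_lt_trans _ _ (e * s / 2 * (2 * pi))).
    apply: int_sub_bound; [exact: ltW|exact: contF|exact: contF|].
    move=> t tb; rewrite -mulrBl absCM absC_expi mulr1.
    by apply: hdl (between_circle z0 s tb) _ _; rewrite /circ; have -> : z + rC s * expi t - (z0 + rC s * expi t) = z - z0 by ring.
  have : 0 < 2 * pi * s * e by rewrite mulr_gt0.
  by lra.
split; first by move=> z hz; split; [exact: dF|exact: cont].
move=> z hz; have d0 : 0 < r - absC (z - a) by rewrite subr_gt0.
have C1z : C1_on (disc z (r - absC (z - a))) F (derive1 F).
  by move=> w /(sub _ _ _ hz) hw; split; [exact: dF|exact: cont].
have /= := circle_deriv d0 C1z; set s := _ / 3 => hs.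
exists (rC (2 * pi * s)^-1 * int 0 (2 * pi) (fun t => derive1 F (circ z s t) * expi (- t))).
by apply: hs; rewrite /disc /= subrr absC0 divr_gt0.
Unshelve. all: by end_near. Qed.

Lemma cauchy_estimate F a r (M : R) : 0 < r ->
  (forall z, disc a r z -> holo_at F z) ->
  (forall z, disc a r z -> absC (F z) <= M) -> absC (derive1 F a) <= M / r.
Proof.
move=> r0 hF hM; have [C1F _] := holo_derive1 r0 hF.
have M0 : 0 <= M by apply: le_trans (absC_ge0 _) (hM a _); rewrite /disc /= subrr absC0.
rewrite leNgt; apply/negP => lt; set D := absC _ in lt.
have D0 : 0 < D by apply: le_lt_trans lt; rewrite divr_ge0// ltW.
have Mr : M / D < r by rewrite ltr_pdivrMr// mulrC -ltr_pdivrMr.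
pose s := (M / D + r) / 2.
have s1 : M / D < s by rewrite /s; lra.
have s2 : s < r by rewrite /s; lra.
have s0 : 0 < s by apply: le_lt_trans s1; rewrite divr_ge0// ltW.
have := @cauchy_estimate_C1 F _ a r s M C1F; rewrite s0 s2 => /(_ isT) H.
have : D <= M / s by apply: H => z zs; apply: hM; rewrite /disc /= zs.
by rewrite ler_pdivlMr// leNgt mulrC -ltr_pdivrMr// s1.
Qed.

End Cauchy.

(** * Logarithms of nonvanishing functions, and critical points *)

Section Logarithms.
Context {R : realType}.
Local Notation C := (Cplx R).
Implicit Types (z w a : C) (x y b c d r : R) (F G : C -> C).

(** Continuity of f turns the two partial derivatives into a complex derivative,
    by the mean value inequality along a horizontal and a vertical segment. *)
Lemma cauchy_riemann F (f : C -> C) z : {for z, continuous f} ->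
  (forall w, rderiv (fun t => F (mkC t (ImC w))) (ReC w) (f w)) ->
  (forall w, rderiv (fun t => F (mkC (ReC w) t)) (ImC w) (f w * iC)) ->
  cderiv F z (f z).
Proof.
move=> cf hx hy; apply/cderivP => e e0.
have e20 : 0 < e / 2 by rewrite divr_gt0.
have /nbhsCP[d d0 hd] := (contCP _ _).1 cf _ e20.
apply/nbhsCP; exists d => // w wz.
have wr : `|ReC w - ReC z| <= absC (w - z) by have := Re_le_absC (w - z); rewrite ReCD ReCN.
have wi : `|ImC w - ImC z| <= absC (w - z) by have := Im_le_absC (w - z); rewrite ImCD ImCN.
have small x y : `|x - ReC z| <= `|ReC w - ReC z| -> `|y - ImC z| <= `|ImC w - ImC z| ->
    absC (f (mkC x y) - f z) <= e / 2.
  move=> hx1 hy1; apply/ltW/hd; apply: le_lt_trans wz.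
  rewrite -ler_sqr ?nnegrE ?absC_ge0// !absC_sqr !ReImE /=.
  by rewrite lerD// -[leLHS]real_normK ?num_real// -[leRHS]real_normK ?num_real//
    ler_sqr ?nnegrE.
have I1 : absC (F (mkC (ReC w) (ImC w)) - F (mkC (ReC z) (ImC w)) -
    f z * rC (ReC w - ReC z)) <= e / 2 * `|ReC w - ReC z|.
  have := @mean_value_between R (fun t => F (mkC t (ImC w)) - f z * rC t)
    (fun t => f (mkC t (ImC w)) - f z * rC 1) (ReC z) (ReC w) (e / 2).
  have -> : F (mkC (ReC w) (ImC w)) - f z * rC (ReC w) -
    (F (mkC (ReC z) (ImC w)) - f z * rC (ReC z)) =
    F (mkC (ReC w) (ImC w)) - F (mkC (ReC z) (ImC w)) - f z * rC (ReC w - ReC z).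
    by rewrite rCD rCN; ring.
  apply=> t /between_dist tb.
    apply: rderivB; first exact: (hx (mkC t (ImC w))).
    exact: rderivMl _ (rderiv_rC (is_derive_id t (1 : R))).
  by rewrite rC1 mulr1; apply: small.
have I2 : absC (F (mkC (ReC z) (ImC w)) - F (mkC (ReC z) (ImC z)) -
    f z * iC * rC (ImC w - ImC z)) <= e / 2 * `|ImC w - ImC z|.
  have := @mean_value_between R (fun t => F (mkC (ReC z) t) - f z * iC * rC t)
    (fun t => f (mkC (ReC z) t) * iC - f z * iC * rC 1) (ImC z) (ImC w) (e / 2).
  have -> : F (mkC (ReC z) (ImC w)) - f z * iC * rC (ImC w) -
    (F (mkC (ReC z) (ImC z)) - f z * iC * rC (ImC z)) =
    F (mkC (ReC z) (ImC w)) - F (mkC (ReC z) (ImC z)) - f z * iC * rC (ImC w - ImC z).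
    by rewrite rCD rCN; ring.
  apply=> t /between_dist tb.
    apply: rderivB; first exact: (hy (mkC (ReC z) t)).
    exact: rderivMl _ (rderiv_rC (is_derive_id t (1 : R))).
  by rewrite rC1 mulr1 -mulrBl absCM absC_iC mulr1; apply: small; rewrite // subrr normr0.
have -> : F w - F z - f z * (w - z) =
  (F (mkC (ReC w) (ImC w)) - F (mkC (ReC z) (ImC w)) - f z * rC (ReC w - ReC z)) +
  (F (mkC (ReC z) (ImC w)) - F (mkC (ReC z) (ImC z)) - f z * iC * rC (ImC w - ImC z)).
  have -> : w - z = rC (ReC w - ReC z) + iC * rC (ImC w - ImC z).
    by rewrite -mkC_split -[LHS]mkCE !ReImE.
  by rewrite !mkCE; ring.
apply: le_trans (absCD _ _) _; apply: le_trans (lerD I1 I2) _.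
by rewrite -mulrDr [leLHS]mulrC mulrA ler_pdivrMr//; nra.
Qed.

Definition cexp z : C := rC (expR (ReC z)) * expi (ImC z).

Lemma cexpD z w : cexp (z + w) = cexp z * cexp w.
Proof.
rewrite /cexp ReCD ImCD expRD rCM /expi.
by apply: eq_ReIm; rewrite !ReImE /= cosD sinD; ring.
Qed.

Lemma absC_cexp z : absC (cexp z) = expR (ReC z).
Proof. by rewrite absCM absC_rC absC_expi mulr1 ger0_norm// expR_ge0. Qed.

Lemma cexp_neq0 z : cexp z != 0.
Proof. by rewrite -absC_gt0 absC_cexp expR_gt0. Qed.

Lemma cexp0 : cexp 0 = 1.
Proof. by rewrite /cexp /expi expR0 cos0 sin0 rC1 mul1r. Qed.

Lemma cexpN z : cexp (- z) = (cexp z)^-1.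
Proof.
apply: (mulfI (cexp_neq0 z)); rewrite -cexpD subrr cexp0 divff//.
exact: cexp_neq0.
Qed.

Lemma continuous_cexp : continuous cexp.
Proof.
move=> z; apply: cvgM; first exact: (nbhs_filter z).
  apply: (@continuous_comp _ _ _ (@ReC R) (fun t => rC (expR t))).
    exact: continuous_ReC.
  exact: rderiv_cont (rderiv_rC (is_derive_expR _)).
apply: (@continuous_comp _ _ _ (@ImC R) (@expi R)); first exact: continuous_ImC.
exact: rderiv_cont (rderiv_expi _).
Qed.

Lemma cderiv_cexp z : cderiv cexp z (cexp z).
Proof.
apply: cauchy_riemann; first exact: continuous_cexp.
  move=> w; have := rderivM (rderiv_rC (is_derive_expR (ReC w))) (rderiv_cst (expi (ImC w)) (ReC w)).
  by rewrite mulr0 addr0.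
move=> w; have := rderivMl (rC (expR (ReC w))) (rderiv_expi (ImC w)).
by rewrite mulrA (mulrAC _ iC).
Qed.

Lemma zero_derivative_segment F z w : (forall t, 0 <= t <= 1 -> cderiv F (z + rC t * (w - z)) 0) ->
  F w = F z.
Proof.
move=> h; apply/eqP; rewrite -subr_eq0 -absC_eq0 eq_le absC_ge0 andbT.
have := @segment_mean_value R F (fun=> 0) z w 0 0 h.
by rewrite mul0r !subr0 mul0r; apply=> t _; rewrite absC0.
Qed.

Lemma disc_center a r : 0 < r -> disc a r a.
Proof. by rewrite /disc /= subrr absC0. Qed.

Lemma holo_primitive F a r : 0 < r -> (forall z, disc a r z -> holo_at F z) ->
  exists G : C -> C, forall z, disc a (r / 3) z -> cderiv G z (F z).
Proof.
move=> r0 hF; pose u := r / 3; have u0 : 0 < u by rewrite divr_gt0.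
have [||z [zx zy]|G hG] := @box_primitive R F (ReC a - u) (ReC a + u)
     (ImC a - u) (ImC a + u); [lra|lra| |].
  apply: hF; apply: le_lt_trans (absC_le_ReIm _) _.
  have /andP[? ?] := zx; have /andP[? ?] := zy.
  rewrite !ReImE; apply: (@le_lt_trans _ _ (u + u)); last by rewrite /u; lra.
  by apply: lerD; rewrite ler_norml; apply/andP; split; lra.
exists G => z; rewrite /disc /= => za; apply: hG.
have := Re_le_absC (z - a); have := Im_le_absC (z - a); rewrite !ReImE.
by rewrite /u => /ler_normlP[? ?] /ler_normlP[? ?]; split; apply/andP; split; lra.
Qed.

Lemma disc_sub a r s z : s <= r -> disc a s z -> disc a r z.
Proof. by rewrite /disc /=; lra. Qed.

Lemma holo_cderiv F z : holo_at F z -> cderiv F z (derive1 F z).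
Proof. by move=> [v hv]; rewrite (cderiv_derive1 hv). Qed.

(** L is a primitive of F' / F, so F exp(-L) has derivative zero. The radius
    drops to r / 3 so that a box fits between the two discs. *)
Lemma local_log F a r : 0 < r ->
  (forall z, disc a r z -> holo_at F z) -> (forall z, disc a r z -> F z != 0) ->
  exists L : C -> C, forall z, disc a (r / 3) z ->
    cderiv L z (derive1 F z / F z) /\ F z = F a * cexp (L z - L a).
Proof.
move=> r0 hF F0; have [_ hdF] := holo_derive1 r0 hF.
have [|L hL] := @holo_primitive (fun z => derive1 F z * (F z)^-1) a r r0.
  move=> z hz; have [v hv] := hdF z hz; have [v' hv'] := hF z hz.
  by eexists; apply: cderivM hv (cderivV (F0 z hz) hv').
exists L => z hz; split; first exact: hL.
have sub w : disc a (r / 3) w -> disc a r w by apply: disc_sub; lra.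
pose Q w := F w * cexp (- L w).
have QE : Q z = Q a.
  apply: zero_derivative_segment => t t01; set w := (X in cderiv _ X _).
  have hw : disc a (r / 3) w.
    by apply: disc_segment => //; rewrite subrr absC0 divr_gt0.
  have h1 := holo_cderiv (hF w (sub w hw)).
  have h2 := @cderiv_comp R cexp (fun v => - L v) w _ _ (cderiv_cexp _) (cderivN (hL w hw)).
  apply: cderiv_eq (cderivM h1 h2) _ => /=.
  have := F0 w (sub w hw); move: (derive1 F w) (F w) (cexp _) => D f e f0.
  by field.
rewrite cexpD cexpN; have := QE; rewrite /Q !cexpN => E.
have La := cexp_neq0 (L a); have Lz := cexp_neq0 (L z).
have -> : F z = F z / cexp (L z) * cexp (L z) by rewrite divfK.
rewrite E; ring.
Qed.

(** The map sending L to (L - L(a)) / (L + conj L(a)) takes the right half plane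
    to the unit disc, so Cauchy's estimate applies to its composite with L. *)
Lemma half_plane_estimate L a r : 0 < r ->
  (forall z, disc a r z -> holo_at L z) -> (forall z, disc a r z -> 0 < ReC (L z)) ->
  absC (derive1 L a) <= 2 * ReC (L a) / r.
Proof.
move=> r0 hL Lpos; have aa := disc_center a r0.
pose l := L a; pose G z := (L z - l) * (L z + conjC l)^-1.
have l0 : 0 < ReC l := Lpos a aa.
have n0 z : disc a r z -> L z + conjC l != 0.
  move=> hz; apply/eqP => /(congr1 (@ReC R)); rewrite !ReImE /= => E.
  by have := Lpos z hz; lra.
have dG z : disc a r z -> cderiv G z (derive1 L z * (L z + conjC l)^-1 +
    (L z - l) * (- derive1 L z / (L z + conjC l) ^+ 2)).
  move=> hz; have h := holo_cderiv (hL z hz).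
  have h1 := cderivB h (cderiv_cst l z); rewrite subr0 in h1.
  have h2 := cderivD h (cderiv_cst (conjC l) z); rewrite addr0 in h2.
  exact: cderivM h1 (@cderivV R (fun w => L w + conjC l) z _ (n0 z hz) h2).
have := @cauchy_estimate R G a r 1 r0.
rewrite (cderiv_derive1 (dG a aa)) -/l subrr mul0r addr0.
have -> : l + conjC l = rC (2 * ReC l) by apply: eq_ReIm; rewrite !ReImE /=; ring.
have l2 : `|2 * ReC l| = 2 * ReC l by rewrite ger0_norm// mulr_ge0// ltW.
rewrite absCM absCV absC_rC l2 => H.
have {H} : absC (derive1 L a) / (2 * ReC l) <= 1 / r.
  apply: H => z hz; first by eexists; exact: dG.
  rewrite /G absCM absCV ler_pdivrMr ?absC_gt0 ?n0// mul1r.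
  rewrite -ler_sqr ?nnegrE ?absC_ge0// !absC_sqr !ReImE /=.
  have := Lpos z hz; nra.
by rewrite ler_pdivrMr ?mulr_gt0// mul1r mulrC.
Qed.

(** An infinitesimal Harnack inequality: log M - log F maps to the right half
    plane, where [half_plane_estimate] bounds its derivative. *)
Lemma nonvanishing_derive_le F a r (M : R) : 0 < r ->
  (forall z, disc a r z -> holo_at F z) ->
  (forall z, disc a r z -> F z != 0 /\ absC (F z) < M) ->
  absC (derive1 F a / F a) <= 6 / r * ln (M / absC (F a)).
Proof.
move=> r0 hF hM; have aa := disc_center a r0.
have [z /hM[]//|L hL] := @local_log F a r r0 hF.
have r30 : 0 < r / 3 by rewrite divr_gt0.
have sub w : disc a (r / 3) w -> disc a r w by apply: disc_sub; lra.
have [Fa0 FaM] := hM a aa.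
have Fa : 0 < absC (F a) by rewrite absC_gt0.
have M0 : 0 < M by lra.
pose P w := rC (ln (M / absC (F a))) + (L a - L w).
have dP z : disc a (r / 3) z -> cderiv P z (- (derive1 F z / F z)).
  move=> /hL[h _]; have := cderivD (cderiv_cst (rC (ln (M / absC (F a)))) z)
    (cderivB (cderiv_cst (L a) z) h).
  by rewrite add0r sub0r.
have := @half_plane_estimate P a (r / 3) r30.
rewrite (cderiv_derive1 (dP a (disc_center a r30))) absCN.
have -> : ReC (P a) = ln (M / absC (F a)) by rewrite /P subrr addr0.
have -> : 2 * ln (M / absC (F a)) / (r / 3) = 6 / r * ln (M / absC (F a)).
  by field; rewrite gt_eqF.
apply=> z hz; first by eexists; exact: dP.
have [_ E] := hL z hz; have [Fz0 FzM] := hM z (sub z hz).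
have Fz : 0 < absC (F z) by rewrite absC_gt0.
rewrite /P !ReImE /= -ltr_expR expR0 expRD lnK ?posrE ?divr_gt0// expRD expRN.
have eE : absC (F z) * expR (ReC (L a)) = absC (F a) * expR (ReC (L z)).
  rewrite E absCM absC_cexp !ReImE expRD expRN -mulrA; congr (_ * _).
  by rewrite divfK// gt_eqF// expR_gt0.
rewrite mulrA ltr_pdivlMr ?expR_gt0// mul1r mulrAC ltr_pdivlMr// mulrC -eE.
by rewrite ltr_pM2r// expR_gt0.
Qed.

Lemma gronwall (l dl : R -> R) (K : R) :
  (forall t : R, 0 <= t <= 1 -> is_derive t (1 : R) l (dl t)) ->
  (forall t : R, 0 <= t <= 1 -> dl t <= K * l t) -> l 1 <= expR K * l 0.
Proof.
move=> hl hdl.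
pose g t := l t * expR (- K * t).
pose dg t := (dl t - K * l t) * expR (- K * t).
have hg (t : R) : 0 <= t <= 1 -> is_derive t (1 : R) g (dg t).
  move=> t01; have h1 := hl t t01.
  have h2 : is_derive t (1 : R) (fun t : R => - K * t) (- K).
    by have := is_deriveZ (- K) (is_derive_id t (1 : R)); rewrite /GRing.scale /= mulr1.
  have h3 := is_derive1_comp (is_derive_expR (- K * t)) h2.
  have := is_deriveM h1 h3.
  rewrite /GRing.scale /= => h; apply: (is_derive_eq h).
  by rewrite /dg; ring.
have cg : {within `[0, 1], continuous g}.
  apply: derivable_within_continuous => t; rewrite in_itv /= => t01.
  exact: (@ex_derive _ _ _ _ _ _ _ (hg t t01)).
have [|c] := @MVT_segment R g dg 0 1 ler01 _ cg.
  by move=> t; rewrite in_itv /= => /andP[a b]; apply: hg; rewrite !ltW.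
rewrite in_itv /= => c01 E.
have : g 1 - g 0 <= 0.
  rewrite E subr0 mulr1 /dg; have := hdl c c01; have := expR_gt0 (- K * c); nra.
rewrite /g mulr0 expR0 !mulr1 expRN subr_le0 ler_pdivrMr ?expR_gt0//.
by rewrite mulrC.
Qed.

Lemma rderiv_ln_abs (g : R -> C) t (d : C) : g t != 0 -> rderiv g t d ->
  is_derive t (1 : R) (fun s => ln (absC (g s))) (ReC (d / g t)).
Proof.
move=> g0 /rderivP[h1 h2].
have n2 : 0 < absC (g t) ^+ 2 by rewrite exprn_gt0// absC_gt0.
pose q (s : R) : R := ReC (g s) * ReC (g s) + ImC (g s) * ImC (g s).
have h : is_derive t (1 : R) q _ := is_deriveD (is_deriveM h1 h1) (is_deriveM h2 h2).
have n2' : 0 < q t by rewrite /q -!expr2 -absC_sqr.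
have h3 := is_deriveZ (2^-1 : R) (is_derive1_comp (is_derive1_ln n2') h).
have -> : (fun s => ln (absC (g s))) = 2^-1 *: (@ln R \o q).
  apply/funext => s; rewrite /= -[RHS]/(2^-1 * ln (q s)) /q -!expr2 -absC_sqr.
  have := absC_ge0 (g s); rewrite le_eqVlt => /predU1P[<-|gs0].
    by rewrite expr0n /= ln0// mulr0.
  by rewrite expr2 lnM ?posrE//; lra.
apply: (is_derive_eq h3).
rewrite /GRing.scale /=.
have q0 : ReC (g t) * ReC (g t) + ImC (g t) * ImC (g t) != 0.
  by rewrite -!expr2 -absC_sqr gt_eqF.
have -> : d / g t = d * conjC (g t) * rC (absC (g t) ^+ 2)^-1.
  apply: (mulIf g0); rewrite divfK// mulrAC -!mulrA (mulrA (conjC _)) conjCM -rCM.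
  by rewrite divff ?gt_eqF// rC1 mulr1.
rewrite absC_sqr !expr2 !ReImE /=.
rewrite /q.
by field.
Qed.

(** The difference quotients k_h(z) = (F(z + h) - F(z)) / h vanish nowhere,
    because F is injective, and they tend to F'. The Harnack estimate of
    [nonvanishing_derive_le], integrated along a segment, compares |k_h(a)| with
    |k_h(p)| by a bound that does not depend on h; in the limit F'(a) = 0 would
    force F'(p) = 0 at all nearby p, and F would be constant. *)
Lemma univalent_derive_neq0 F a r : 0 < r ->
  (forall z, disc a r z -> holo_at F z) ->
  (forall z w, disc a r z -> disc a r w -> F z = F w -> z = w) ->
  derive1 F a != 0.
Proof.
move=> r0 hF injF; apply/eqP => dFa0.
have [C1F _] := holo_derive1 r0 hF.
have aa := disc_center a r0.
have h20 : 0 < 2^-1 :> R by rewrite invr_gt0.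
have /nbhsCP[d0 d00 hd0] := (contCP _ _).1 (C1F a aa).2 _ h20.
pose m := Num.min d0 r; have m0 : 0 < m by rewrite lt_min d00.
pose rho := m / 2; have rho0 : 0 < rho by rewrite divr_gt0.
have sub z : disc a m z -> disc a r z by apply: disc_sub; rewrite ge_min lexx orbT.
have small z : disc a m z -> absC (derive1 F z) <= 2^-1.
  rewrite /disc /= lt_min => /andP[/hd0 + _].
  by rewrite dFa0 subr0 => /ltW.
(* If F' vanished near a then F would be constant there. *)
have [p pa dFp] : exists2 p, disc a (rho / 2) p & derive1 F p != 0.
  apply: contrapT => no.
  have zero z : disc a (rho / 2) z -> derive1 F z = 0.
    by move=> hz; apply/eqP; apply: contraT => nz; case: no; exists z.
  pose q : C := a + rC (rho / 4).
  have qa : absC (q - a) = rho / 4.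
    by rewrite /q addrAC subrr add0r absC_rC ger0_norm// ltW// divr_gt0.
  have qd : disc a (rho / 2) q by rewrite /disc /= qa; lra.
  have mr : rho / 2 <= m by rewrite /rho; lra.
  have /(injF q a) : F q = F a.
    apply: zero_derivative_segment => t t01; set w := (X in cderiv _ X _).
    have hw : disc a (rho / 2) w.
      by apply: disc_segment => //; rewrite subrr absC0 divr_gt0.
    by rewrite -(zero w hw); apply/holo_cderiv/hF/sub/(disc_sub mr).
  have qr : disc a r q by apply/sub/(disc_sub mr).
  move=> /(_ qr aa) E; move: qa; rewrite E subrr absC0; lra.
pose k (h z : C) := (F (z + h) - F z) * h^-1.
have addd h z : absC h < rho -> disc a rho z -> disc a m (z + h).
  rewrite /disc /= => h1 h2; have -> : z + h - a = (z - a) + h by ring.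
  by apply: le_lt_trans (absCD _ _) _; rewrite /rho in h1 h2; lra.
have rm : rho <= m by rewrite /rho; lra.
have dk h z : h != 0 -> absC h < rho -> disc a rho z ->
    cderiv (k h) z ((derive1 F (z + h) - derive1 F z) * h^-1).
  move=> h0 hr hz.
  have c1 : cderiv (fun w => F (w + h)) z (derive1 F (z + h)).
    have := @cderiv_comp R F (fun w => w + h) z _ _
      (holo_cderiv (hF _ (sub _ (addd h z hr hz)))) (cderivD (cderiv_id z) (cderiv_cst h z)).
    by rewrite addr0 mulr1.
  have c2 := holo_cderiv (hF _ (sub _ (disc_sub rm hz))).
  have := cderivM (cderivB c1 c2) (cderiv_cst h^-1 z).
  by rewrite mulr0 addr0.
have k0 h z : h != 0 -> absC h < rho -> disc a rho z -> k h z != 0 /\ absC (k h z) < 1.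
  move=> h0 hr hz; split.
    rewrite mulf_eq0 invr_eq0 (negbTE h0) orbF subr_eq0; apply/eqP => E.
    have := injF _ _ (sub _ (addd h z hr hz)) (sub _ (disc_sub rm hz)) E.
    by move=> /eqP; rewrite -subr_eq0 addrAC subrr add0r (negbTE h0).
  rewrite /k absCM absCV ltr_pdivrMr ?absC_gt0// mul1r.
  have := @segment_mean_value R F (derive1 F) z (z + h) 0 2^-1.
  rewrite mul0r subr0 addrAC subrr add0r => H.
  have : absC (F (z + h) - F z) <= 2^-1 * absC h.
    have seg t : 0 <= t <= 1 -> disc a m (z + rC t * h).
      move=> t01; have zh : z + h - z = h by ring.
      have := @disc_segment R a z (z + h) m t (disc_sub rm hz) (addd h z hr hz) t01.
      by rewrite zh.
    apply: H => t t01; first by apply/holo_cderiv/hF/sub/seg.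
    by rewrite subr0; apply/small/seg.
  have : 0 < absC h by rewrite absC_gt0.
  by lra.
have rho20 : 0 < rho / 2 by rewrite divr_gt0.
(* The bound 6 / (rho / 2) on the logarithmic derivative, over a segment of
   length at most rho / 2, makes Gronwall's factor exp 6. *)
have harnack h : h != 0 -> absC h < rho ->
    expR 6 * ln (absC (k h p)) <= ln (absC (k h a)).
  move=> h0 hr; pose g t := k h (p + rC t * (a - p)).
  pose dkh z := (derive1 F (z + h) - derive1 F z) * h^-1.
  have seg t : 0 <= t <= 1 -> disc a (rho / 2) (p + rC t * (a - p)).
    by move=> t01; apply: disc_segment => //; rewrite subrr absC0.
  have r2r : rho / 2 <= rho by lra.
  have hg t : 0 <= t <= 1 -> rderiv g t (dkh (p + rC t * (a - p)) * (a - p)).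
    move=> t01; apply: rderiv_segment; apply: dk => //.
    exact/(disc_sub r2r)/seg.
  have gn0 t : 0 <= t <= 1 -> g t != 0.
    by move=> t01; case: (k0 h _ h0 hr (disc_sub r2r (seg t t01))).
  have := @gronwall (fun t => - ln (absC (g t)))
    (fun t => - ReC (dkh (p + rC t * (a - p)) * (a - p) / g t)) 6.
  rewrite /g rC1 rC0 mul1r mul0r addr0.
  have -> : p + (a - p) = a by ring.
  rewrite mulrN lerN2; apply=> t t01.
    exact: is_deriveN (rderiv_ln_abs (gn0 t t01) (hg t t01)).
  set z := p + _; have hz : disc a (rho / 2) z := seg t t01.
  have near_z w : disc z (rho / 2) w -> disc a rho w.
    move: hz; rewrite /disc /= => h1 h2; have := absC_tri w a z; lra.
  have := @nonvanishing_derive_le (k h) z (rho / 2) 1 rho20.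
  rewrite (cderiv_derive1 (dk h z h0 hr (disc_sub r2r hz))).
  move=> /(_ (fun w hw => ex_intro _ _ (dk h w h0 hr (near_z w hw)))).
  move=> /(_ (fun w hw => k0 h w h0 hr (near_z w hw))) H.
  rewrite -/(dkh z) in H.
  have kz : 0 < absC (k h z) by rewrite absC_gt0; exact: gn0.
  rewrite div1r lnV ?posrE// in H.
  apply: le_trans (ler_norm _) _; rewrite normrN.
  apply: le_trans (Re_le_absC _) _.
  rewrite mulrAC absCM.
  have ap : absC (a - p) <= rho / 2 by rewrite absC_dist; exact: ltW.
  apply: le_trans (ler_pM (absC_ge0 _) (absC_ge0 _) H ap) _.
  rewrite le_eqVlt; apply/orP; left; apply/eqP; field; rewrite gt_eqF//.
(* A single small h contradicts the comparison: |k_h(p)| >= D / 2 forces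
   |k_h(a)| >= c, while F'(a) = 0 makes it at most c / 2. *)
pose D := absC (derive1 F p); have D0 : 0 < D by rewrite absC_gt0.
have pr : disc a r p by apply/sub; move: pa; apply: disc_sub; lra.
have D20 : 0 < D / 2 by rewrite divr_gt0.
have /nbhsCP[d1 d10 hd1] := (cderivP _ _ _).1 (holo_cderiv (hF p pr)) _ D20.
pose c := expR (expR 6 * ln (D / 2)); have c0 : 0 < c by exact: expR_gt0.
have c20 : 0 < c / 2 by rewrite divr_gt0.
have /nbhsCP[d2 d20 hd2] := (cderivP _ _ _).1 (holo_cderiv (hF a aa)) _ c20.
pose t := Num.min rho (Num.min d1 d2) / 2.
have t0 : 0 < t by rewrite divr_gt0// !lt_min rho0 d10 d20.
have [t1 [t2 t3]] : t < rho /\ t < d1 /\ t < d2.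
  have : t < Num.min rho (Num.min d1 d2) by rewrite /t; have := t0; rewrite /t; lra.
  by rewrite !lt_min => /and3P[].
pose h : C := rC t; have ht : absC h = t by rewrite absC_rC gtr0_norm.
have h0 : h != 0 by rewrite -absC_gt0 ht.
have := harnack h h0; rewrite ht => /(_ t1).
have kp : D / 2 <= absC (k h p).
  have := hd1 (p + h); rewrite addrAC subrr add0r ht => /(_ t2).
  have -> : F (p + h) - F p = k h p * h by rewrite /k divfK.
  rewrite -mulrBl absCM ht ler_pM2r// => H.
  by have := absC_lb (derive1 F p) (k h p); rewrite absC_dist -/D; lra.
have ka : absC (k h a) <= c / 2.
  have := hd2 (a + h); rewrite addrAC subrr add0r ht => /(_ t3).
  have -> : F (a + h) - F a = k h a * h by rewrite /k divfK.
  by rewrite -mulrBl dFa0 subr0 absCM ht ler_pM2r.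
have hr : absC h < rho by rewrite ht.
have [ka0 _] := k0 h a h0 hr (disc_center a rho0).
have kap : 0 < absC (k h a) by rewrite absC_gt0.
have kpp : 0 < absC (k h p) by lra.
move=> H.
have : expR (expR 6 * ln (absC (k h p))) <= absC (k h a).
  by rewrite -ler_ln ?posrE ?expR_gt0// expRK.
have : c <= expR (expR 6 * ln (absC (k h p))).
  by rewrite ler_expR ler_pM2l ?expR_gt0// ler_ln ?posrE.
by lra.
Qed.

End Logarithms.

(** * Bloch's theorem and inverses of univalent functions *)

Section Covering.
Context {R : realType}.
Local Notation C := (Cplx R).
Implicit Types (z w a : C) (x y b c d r s : R) (F G : C -> C).

Lemma continuous_mkC : continuous (fun p : R * R => mkC p.1 p.2 : C).
Proof.
move=> p; apply/(cvgCP (nbhs_filter p)) => e e0.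
have e20 : 0 < e / 2 by rewrite divr_gt0.
exists ([set x | `|x - p.1| < e / 2], [set y | `|y - p.2| < e / 2]).
  by split; exact: near_distR.
move=> [x y] [/= h1 h2] /=.
have H := absC_le_ReIm (mkC x y - mkC p.1 p.2); apply: (le_lt_trans H).
by rewrite !ReImE /= [e]splitr ltrD.
Qed.

Lemma compact_closed_box (a' b c d : R) : compact (closed_box a' b c d : set C).
Proof.
have -> : (closed_box a' b c d : set C) =
    (fun p : R * R => mkC p.1 p.2) @` (`[a', b] `*` `[c, d]).
  apply/seteqP; split=> [z [h1 h2]|_ [[x y] /= [h1 h2] <-]].
    by exists (ReC z, ImC z); rewrite /= ?mkCE//; split; rewrite /= in_itv.
  by rewrite !in_itv /= in h1 h2; split.
apply: continuous_compact; last by apply: compact_setX; exact: segment_compact.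
by apply: continuous_subspaceT; exact: continuous_mkC.
Qed.

Local Opaque derive1.

Definition cdisc a r : set C := [set z | absC (z - a) <= r].

Lemma continuous_dist a : continuous (fun z => absC (z - a)).
Proof.
move=> z; apply: (@continuous_comp _ _ _ (fun z => z - a) (@absC R)); last exact: continuous_absC.
exact: cderiv_cont (cderivB (cderiv_id z) (cderiv_cst a z)).
Qed.

Lemma compact_cdisc a r : compact (cdisc a r).
Proof.
apply: (@subclosed_compact _ _ (closed_box (ReC a - r) (ReC a + r) (ImC a - r) (ImC a + r))).
- rewrite /cdisc -[X in closed X]/((fun z => absC (z - a)) @^-1` [set x | x <= r]).
  by apply: preimage_closed; [move=> z _; exact: continuous_dist|exact: closed_le].
- exact: compact_closed_box.
- move=> z; rewrite /cdisc /= => zr.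
  have := Re_le_absC (z - a); have := Im_le_absC (z - a); rewrite !ReImE.
  by move=> /ler_normlP[? ?] /ler_normlP[? ?]; split; apply/andP; split; lra.
Qed.

(** |F - w| attains its minimum over the closed disc, and not on the circle,
    where F is far from F(a). At an interior point where F differs from w, a
    small step in the direction -(F - w) / F' would lower it. *)
Lemma covering F a s : 0 < s -> derive1 F a != 0 ->
  (forall z, cdisc a s z -> holo_at F z) ->
  (forall z, cdisc a s z -> absC (derive1 F z - derive1 F a) <= absC (derive1 F a) / 2) ->
  forall w, absC (w - F a) < s * absC (derive1 F a) / 4 ->
  exists2 z, absC (z - a) < s & F z = w.
Proof.
move=> s0 Fa0 hF hdF w hw; set D := absC (derive1 F a) in hdF hw.
have D0 : 0 < D by rewrite absC_gt0.
have aK : cdisc a s a by rewrite /cdisc /= subrr absC0 ltW.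
have [|||z0 /set_mem Kz0 min0] := @compact_EVT_min C R (fun z => absC (F z - w)) (cdisc a s).
- by exists a.
- exact: compact_cdisc.
- apply: continuous_in_subspaceT => z /set_mem Kz.
  apply: (@continuous_comp _ _ _ (fun z => F z - w) (@absC R)); last exact: continuous_absC.
  exact: cderiv_cont (cderivB (holo_cderiv (hF z Kz)) (cderiv_cst w z)).
have segK z t : cdisc a s z -> 0 <= t <= 1 -> cdisc a s (a + rC t * (z - a)).
  rewrite /cdisc /= => zs /andP[t0 t1].
  rewrite addrAC subrr add0r absCM absC_rC ger0_norm//.
  have := absC_ge0 (z - a); nra.
have circle_far z : absC (z - a) = s -> s * D / 2 <= absC (F z - F a).
  move=> zs; have Kz : cdisc a s z by rewrite /cdisc /= zs.
  have := @segment_mean_value R F (derive1 F) a z (derive1 F a) (D / 2).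
  rewrite zs => H.
  have {}H : absC (F z - F a - derive1 F a * (z - a)) <= D / 2 * s.
    apply: H => t t01; first exact/holo_cderiv/hF/segK.
    exact/hdF/segK.
  have := absC_lb (derive1 F a * (z - a)) (F z - F a).
  by rewrite (absC_dist (_ * _)) absCM zs -/D; lra.
have m0 : absC (F z0 - w) < s * D / 4.
  by apply: le_lt_trans (min0 a (mem_set aK)) _; rewrite absC_dist.
have z0s : absC (z0 - a) < s.
  rewrite lt_neqAle Kz0 andbT; apply/eqP => /circle_far.
  by have := absC_tri (F z0) (F a) w; lra.
exists z0 => //; apply/eqP; rewrite -subr_eq0; apply: contraT => v0.
pose v := F z0 - w; pose d := derive1 F z0.
have d0 : d != 0.
  have gen (p q : C) : absC (p - q) <= absC q / 2 -> 0 < absC q -> 0 < absC p.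
    by have := absC_lb q p; rewrite (absC_dist q p); lra.
  by rewrite -absC_gt0; exact: gen (hdF z0 Kz0) D0.
have av : 0 < absC v by rewrite absC_gt0.
have ad : 0 < absC d by rewrite absC_gt0.
have d20 : 0 < absC d / 2 by rewrite divr_gt0.
have /nbhsCP[e e0 he] := (cderivP _ _ _).1 (holo_cderiv (hF z0 Kz0)) _ d20.
pose u := absC v / absC d.
have u0 : 0 < u by rewrite divr_gt0.
pose t := Num.min 1 (Num.min (e / u) ((s - absC (z0 - a)) / u)) / 2.
have su : 0 < s - absC (z0 - a) by rewrite subr_gt0.
have t0 : 0 < t by rewrite divr_gt0// !lt_min ltr01 !divr_gt0.
have : t < Num.min 1 (Num.min (e / u) ((s - absC (z0 - a)) / u)).
  by rewrite /t; have := t0; rewrite /t; lra.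
rewrite !lt_min !(ltr_pdivlMr _ _ u0) => /and3P[t1 t2 t3].
pose z1 := z0 - rC t * (v / d).
have z10 : z1 - z0 = - (rC t * (v / d)) by rewrite /z1; ring.
have a10 : absC (z1 - z0) = t * u.
  by rewrite z10 absCN !absCM absCV absC_rC gtr0_norm.
have K1 : cdisc a s z1.
  rewrite /cdisc /=; have := absC_tri z1 a z0; rewrite a10; lra.
have := min0 z1 (mem_set K1).
have := he z1; rewrite a10 => /(_ t2) H.
have E : F z1 - w = (F z1 - F z0 - d * (z1 - z0)) + rC (1 - t) * v.
  rewrite z10 /v rCD rCN rC1; field.
  exact: d0.
have : absC (F z1 - w) <= absC d / 2 * (t * u) + (1 - t) * absC v.
  rewrite E; apply: le_trans (absCD _ _) _; rewrite lerD// absCM absC_rC ger0_norm//.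
  by rewrite subr_ge0 ltW.
have -> : absC d / 2 * (t * u) = t * absC v / 2.
  by rewrite /u; field; rewrite gt_eqF.
rewrite -/v => h1 h2.
have : 0 < t * absC v by rewrite mulr_gt0.
by lra.
Qed.

(** Maximising (rho - |z - a|) |q'(z)| produces a point z1 near which |q'| is at
    most twice its value there. Cauchy's estimate for q' then makes q' nearly
    constant on a smaller disc, to which [covering] applies. *)
Lemma bloch q a r : 0 < r -> (forall z, disc a r z -> holo_at q z) ->
  exists b : C, forall w, absC (w - b) < r * absC (derive1 q a) / 128 ->
    exists2 z, disc a r z & q z = w.
Proof.
move=> r0 hq.
have [q0|q0] := eqVneq (derive1 q a) 0.
  by exists a => w; rewrite q0 absC0 mulr0 mul0r ltNge absC_ge0.
have [C1q hdq] := holo_derive1 r0 hq.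
pose rho := r / 2; have rho0 : 0 < rho by rewrite divr_gt0.
have sub z : cdisc a rho z -> disc a r z by rewrite /cdisc /disc /= /rho; lra.
have [|||z1 /set_mem Kz1 max1] := @compact_EVT_max C R
    (fun z => (rho - absC (z - a)) * absC (derive1 q z)) (cdisc a rho).
- by exists a; rewrite /cdisc /= subrr absC0 ltW.
- exact: compact_cdisc.
- apply: continuous_in_subspaceT => z /set_mem Kz.
  apply: (@cvgM _ _ (nbhs z) (nbhs_filter z)).
    apply: (@cvgB _ _ _ (nbhs z) (nbhs_filter z)); first exact: cvg_cst.
    exact: continuous_dist.
  apply: (@continuous_comp _ _ _ (derive1 q) (@absC R)); last exact: continuous_absC.
  exact: (C1q z (sub z Kz)).2.
have aK : a \in cdisc a rho by apply: mem_set; rewrite /cdisc /= subrr absC0 ltW.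
pose D := absC (derive1 q z1).
have m1 : rho * absC (derive1 q a) <= (rho - absC (z1 - a)) * D.
  by have := max1 a aK; rewrite subrr absC0 subr0.
have qa : 0 < absC (derive1 q a) by rewrite absC_gt0.
have m0 : 0 < (rho - absC (z1 - a)) * D by apply: lt_le_trans m1; rewrite mulr_gt0.
have D0 : 0 < D.
  rewrite lt_neqAle absC_ge0 andbT; apply/eqP => D0.
  by move: m0; rewrite -D0 mulr0 ltxx.
have t20 : 0 < rho - absC (z1 - a) by rewrite -(pmulr_lgt0 _ D0).
pose t := (rho - absC (z1 - a)) / 2; have t0 : 0 < t by rewrite divr_gt0.
have inner z : disc z1 t z -> absC (z - a) < rho - t.
  by rewrite /disc /= => zt; have := absC_tri z a z1; rewrite /t in zt *; lra.
have innerK z : disc z1 t z -> cdisc a rho z.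
  by move=> /inner; rewrite /cdisc /=; lra.
have dq2 z : disc z1 t z -> absC (derive1 q z) <= 2 * D.
  move=> hz; have := inner z hz => h1.
  have h2 : (rho - absC (z - a)) * absC (derive1 q z) <= (rho - absC (z1 - a)) * D.
    exact: max1 z (mem_set (innerK z hz)).
  have : t * absC (derive1 q z) <= t * (2 * D).
    have -> : t * (2 * D) = (rho - absC (z1 - a)) * D by rewrite /t; field.
    apply: le_trans h2; rewrite ler_wpM2r ?absC_ge0//; lra.
  by rewrite ler_pM2l.
have t20' : 0 < t / 2 by rewrite divr_gt0.
have ddq z : disc z1 (t / 2) z -> absC (derive1 (derive1 q) z) <= 4 * D / t.
  move=> hz; have -> : 4 * D / t = (2 * D) / (t / 2) by field; rewrite gt_eqF.
  have inn w : disc z (t / 2) w -> disc z1 t w.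
    by move: hz; rewrite /disc /= => h1 h2; have := absC_tri w z1 z; lra.
  apply: cauchy_estimate => // w hw; first exact/hdq/sub/innerK/inn.
  exact/dq2/inn.
have dlip z : disc z1 (t / 2) z ->
    absC (derive1 q z - derive1 q z1) <= 4 * D / t * absC (z - z1).
  move=> hz; have := @segment_mean_value R (derive1 q) (derive1 (derive1 q)) z1 z 0 (4 * D / t).
  have seg u : 0 <= u <= 1 -> disc z1 (t / 2) (z1 + rC u * (z - z1)).
    by move=> u01; apply: disc_segment => //; rewrite subrr absC0.
  have t2t : t / 2 <= t by lra.
  rewrite mul0r subr0; apply=> u u01.
    exact/holo_cderiv/hdq/sub/innerK/(disc_sub t2t)/seg.
  by rewrite subr0; exact/ddq/seg.
have t80 : 0 < t / 8 by rewrite divr_gt0.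
exists (q z1) => w hw.
have cd z : cdisc z1 (t / 8) z -> disc z1 (t / 2) z by rewrite /cdisc /disc /=; lra.
have t2t : t / 2 <= t by lra.
have Dt : 0 <= 4 * D / t by exact: divr_ge0 (mulr_ge0 (ler0n _ 4) (ltW D0)) (ltW t0).
have ED : 4 * D / t * (t / 8) = D / 2 by field; rewrite gt_eqF.
have ED2 : t / 8 * D / 4 = (rho - absC (z1 - a)) * D / 64 by rewrite /t; field.
have ED3 : r * absC (derive1 q a) / 128 = rho * absC (derive1 q a) / 64.
  by rewrite /rho; field.
have num (X A M Y A' : R) : X < A -> A' <= M -> Y = M / 64 -> A = A' / 64 -> X < Y.
  lra.
have [||||z zz E] := @covering q z1 (t / 8) t80 _ _ _ w.
- by rewrite -absC_gt0; exact: D0.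
- by move=> z /cd hz; exact/hq/sub/innerK/(disc_sub t2t).
- move=> z hz; have k : absC (derive1 q z - derive1 q z1) <= D / 2.
    rewrite -ED; exact: le_trans (dlip z (cd z hz)) (ler_wpM2l Dt hz).
  exact: k.
- have k : absC (w - q z1) < t / 8 * D / 4.
    exact: num hw m1 ED2 ED3.
  exact: k.
exists z => //; apply/sub/innerK.
by rewrite /disc /=; lra.
Qed.

(** The preimage u is also close to z: this is at once openness of F and
    continuity of its inverse. *)
Lemma univalent_open F (D : set C) : (forall z, D z -> \forall w \near z, D w) ->
  conformal_on D F -> forall z, D z -> forall e, 0 < e -> exists2 d, 0 < d &
    forall w, absC (w - F z) < d -> exists u, [/\ D u, absC (u - z) < e & F u = w].
Proof.
move=> oD [dF injF] z Dz e e0.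
have /nbhsCP[r r0 hr] := oD z Dz.
have hF w : disc z r w -> holo_at F w.
  by move=> hw; exists (derive1 F w); apply/derivable_cderiv/dF/hr.
have F0 : derive1 F z != 0.
  apply: (@univalent_derive_neq0 R F z r r0) => // u v hu hv E.
  by apply: injF => //; apply/mem_set/hr.
have [C1F _] := holo_derive1 r0 hF.
have a0 : 0 < absC (derive1 F z) / 2 by rewrite divr_gt0// absC_gt0.
have /nbhsCP[d0 d00 hd0] := (contCP _ _).1 (C1F z (disc_center z r0)).2 _ a0.
pose m := Num.min e (Num.min d0 r) / 2.
have m0 : 0 < m by rewrite divr_gt0// !lt_min e0 d00.
have : m < Num.min e (Num.min d0 r) by rewrite /m; have := m0; rewrite /m; lra.
rewrite !lt_min => /and3P[m1 m2 m3].
exists (m * absC (derive1 F z) / 4).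
  by rewrite divr_gt0// mulr_gt0// absC_gt0.
move=> w hw; have [||u uz E] := @covering F z m m0 F0 _ _ w hw.
- by move=> u; rewrite /cdisc /= => hu; apply: hF; rewrite /disc /=; lra.
- by move=> u; rewrite /cdisc /= => hu; apply/ltW/hd0; lra.
by exists u; split=> //; [apply: hr; lra|lra].
Qed.

Lemma inverse_cderiv F G (D : set C) : (forall z, D z -> \forall w \near z, D w) ->
  conformal_on D F -> (forall z, D z -> G (F z) = z) ->
  forall z, D z -> derive1 F z != 0 /\ cderiv G (F z) (derive1 F z)^-1.
Proof.
move=> oD cF GF z Dz; have [dF injF] := cF.
have F0 : derive1 F z != 0.
  have /nbhsCP[r r0 hr] := oD z Dz.
  apply: (@univalent_derive_neq0 R F z r r0).
    by move=> w hw; exists (derive1 F w); apply/derivable_cderiv/dF/hr.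
  by move=> u v hu hv E; apply: injF => //; apply/mem_set/hr.
split=> //; apply/cderivP => e e0; set d := derive1 F z.
have ad : 0 < absC d by rewrite absC_gt0.
pose e1 := Num.min (absC d / 2) (e * absC d ^+ 2 / 2).
have e10 : 0 < e1 by rewrite lt_min !divr_gt0// mulr_gt0// exprn_gt0.
have /nbhsCP[r1 r10 hr1] := (cderivP _ _ _).1 (derivable_cderiv (dF z Dz)) _ e10.
have [dl dl0 hdl] := univalent_open oD cF Dz r10.
apply/nbhsCP; exists dl => // w /hdl[u [Du uz <-]]; rewrite !GF//.
have H := hr1 u uz; rewrite -/d in H.
have H1 : absC (F u - F z - d * (u - z)) <= absC d / 2 * absC (u - z).
  by apply: le_trans H _; rewrite ler_wpM2r ?absC_ge0// ge_min lexx.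
have low : absC d / 2 * absC (u - z) <= absC (F u - F z).
  have := absC_lb (d * (u - z)) (F u - F z); rewrite (absC_dist (_ * _)) absCM; lra.
have gen (p q v a b : C) : p != 0 ->
    a - b - p^-1 * (q - v) = - (p^-1 * (q - v - p * (a - b))).
  by move=> p0; field.
rewrite (gen d (F u) (F z) u z F0).
rewrite absCN absCM absCV ler_pdivrMl//; apply: le_trans H _.
apply: (@le_trans _ _ (e * absC d ^+ 2 / 2 * absC (u - z))).
  by rewrite ler_wpM2r ?absC_ge0// ge_min lexx orbT.
have -> : e * absC d ^+ 2 / 2 * absC (u - z) = absC d * (e * (absC d / 2 * absC (u - z))).
  by ring.
by rewrite ler_pM2l// ler_pM2l.
Qed.

End Covering.

(** * The hyperbolic metric of a channel *)

Section Hyperbolic.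
Context {R : realType}.
Local Notation C := (Cplx R).
Implicit Types (z w a : C) (x y b c d r s : R) (F G : C -> C).

Local Opaque derive1.

Lemma strip_open z : strip z -> \forall w \near z, strip w.
Proof.
rewrite /strip /= => hz; apply/nbhsCP; exists (pi / 2 - `|ImC z|); first by rewrite subr_gt0.
move=> w wz; have := Im_le_absC (w - z); rewrite ImCD ImCN => H.
have := ler_normD (ImC w - ImC z) (ImC z); rewrite subrK => K /=; lra.
Qed.

Lemma strip_cos z : strip z -> 0 < cos (ImC z).
Proof. by rewrite /strip /= ltr_norml => h; exact: cos_gt0_pihalf. Qed.

Lemma ReC_cexp z : ReC (cexp z) = expR (ReC z) * cos (ImC z).
Proof. by rewrite /cexp !ReImE /= mul0r subr0. Qed.

Lemma ImC_cexp z : ImC (cexp z) = expR (ReC z) * sin (ImC z).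
Proof. by rewrite /cexp !ReImE /= mul0r addr0. Qed.

Lemma conformal_cexp : conformal_on (@strip R) cexp.
Proof.
split=> [z _|z w /set_mem hz /set_mem hw E].
  exact: (@ex_derive _ _ _ _ _ _ _ (cderiv_cexp z)).
have Er : ReC z = ReC w.
  by apply: expR_inj; rewrite -!absC_cexp E.
apply: eq_ReIm => //; apply: sin_inj.
- by move: hz; rewrite /strip /= ltr_norml in_itv /= => /andP[? ?]; rewrite !ltW.
- by move: hw; rewrite /strip /= ltr_norml in_itv /= => /andP[? ?]; rewrite !ltW.
have := congr1 (@ImC R) E; rewrite !ImC_cexp Er => /mulfI; apply.
by rewrite gt_eqF// expR_gt0.
Qed.

(** The inverse of the exponential from the right half plane to the strip. *)
Definition Log w : C := mkC (ln (absC w)) (asin (ImC w / absC w)).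

Lemma ratio_bound w : 0 < ReC w -> -1 < ImC w / absC w < 1.
Proof.
move=> w0; have aw : 0 < absC w.
  by apply: lt_le_trans w0 _; apply: le_trans (ler_norm _) (Re_le_absC w).
rewrite -ltr_norml normrM normfV (gtr0_norm aw) ltr_pdivrMr// mul1r.
rewrite -ltr_sqr ?nnegrE ?absC_ge0// real_normK ?num_real// absC_sqr ltrDr.
by rewrite exprn_gt0.
Qed.

Lemma Log_strip w : 0 < ReC w -> strip (Log w).
Proof.
move=> /ratio_bound/andP[h1 h2]; rewrite /strip /= ltr_norml.
by rewrite asin_gtNpi2 ?asin_ltpi2// ?h1 ?h2 ?(ltW h1) ?(ltW h2).
Qed.

Lemma LogK w : 0 < ReC w -> cexp (Log w) = w.
Proof.
move=> w0; have /andP[h1 h2] := ratio_bound w0.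
have aw : 0 < absC w.
  by apply: lt_le_trans w0 _; apply: le_trans (ler_norm _) (Re_le_absC w).
have an : absC w != 0 by rewrite gt_eqF.
apply: eq_ReIm.
  rewrite ReC_cexp /= lnK// cos_asin ?(ltW h1) ?(ltW h2)//.
  have -> : 1 - (ImC w / absC w) ^+ 2 = (ReC w / absC w) ^+ 2.
    rewrite !exprMn !exprVn absC_sqr; field.
    by rewrite -absC_sqr sqrf_eq0.
  by rewrite sqrtr_sqr ger0_norm ?divr_ge0 ?(ltW w0) ?(ltW aw)//; field.
rewrite ImC_cexp /= lnK// asinK; first by field.
by rewrite in_itv /= (ltW h1) (ltW h2).
Qed.

Lemma cderiv_Log z : strip z -> cderiv Log (cexp z) (cexp z)^-1.
Proof.
move=> hz.
have := @inverse_cderiv R cexp Log strip strip_open conformal_cexp _ z hz.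
rewrite (cderiv_derive1 (cderiv_cexp z)) => H.
have [|_ //] := H.
move=> w hw; apply: conformal_cexp.2.
- by apply: mem_set; apply: Log_strip; rewrite ReC_cexp mulr_gt0 ?expR_gt0 ?strip_cos.
- exact: mem_set.
by apply: LogK; rewrite ReC_cexp mulr_gt0 ?expR_gt0 ?strip_cos.
Qed.

(** Through the exponential onto the right half plane and Moebius maps, chosen
    separately on the two sides, g becomes a self-map of the unit disc fixing 0.
    Cauchy's estimate bounds its derivative at 0 by 1, which the chain rule turns
    into the stated inequality. *)
Lemma schwarz_pick_strip (g dg : C -> C) z0 :
  (forall z, strip z -> cderiv g z (dg z) /\ strip (g z)) -> strip z0 ->
  absC (dg z0) * cos (ImC z0) <= cos (ImC (g z0)).
Proof.
move=> hg hz0.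
pose E := cexp z0; pose P := cexp (g z0).
have E0 : 0 < ReC E by rewrite ReC_cexp mulr_gt0 ?expR_gt0 ?strip_cos.
have hgz0 : strip (g z0) := (hg z0 hz0).2.
have P0 : 0 < ReC P by rewrite ReC_cexp mulr_gt0 ?expR_gt0 ?strip_cos.
(* M maps the unit disc to the right half plane with M 0 = exp z0, and B below
   maps the strip to the unit disc with B (g z0) = 0. *)
pose M w : C := (E + conjC E * w) * (1 - w)^-1.
have w1 w : disc 0 1 w -> 1 - w != 0.
  rewrite /disc /= subr0 => h; rewrite subr_eq0; apply/eqP => e.
  by move: h; rewrite -e absC1 ltxx.
have ReM w : disc 0 1 w -> 0 < ReC (M w).
  move=> hw; have := w1 w hw; rewrite -absC_gt0 => n0.
  have -> : M w = (E + conjC E * w) * conjC (1 - w) * rC (absC (1 - w) ^+ 2)^-1.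
    rewrite /M -mulrA; congr (_ * _); apply: (mulIf (w1 w hw)).
    rewrite mulVf ?w1// mulrAC conjCM -rCM divff ?rC1//.
    by rewrite sqrf_eq0 gt_eqF.
  rewrite ReCM /= mulr0 subr0; apply: mulr_gt0; last by rewrite invr_gt0 exprn_gt0.
  have : absC w ^+ 2 < 1 by move: hw; rewrite /disc /= subr0 => h; rewrite expr_lt1// absC_ge0.
  rewrite absC_sqr => h.
  have -> : ReC ((E + conjC E * w) * conjC (1 - w)) = ReC E * (1 - (ReC w ^+ 2 + ImC w ^+ 2)).
    by move: (E) => v; rewrite !ReImE /= !ReImE /=; ring.
  by rewrite mulr_gt0// subr_gt0.
pose dM w := conjC E * (1 - w)^-1 + (E + conjC E * w) * (- (-1) / (1 - w) ^+ 2).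
have hM w : disc 0 1 w -> cderiv M w (dM w).
  move=> hw.
  have h1 := cderivD (cderiv_cst E w) (cderivMl (conjC E) (cderiv_id w)).
  have h2 := cderivB (cderiv_cst 1 w) (cderiv_id w).
  have h3 := @cderivV R (fun w => 1 - w) w _ (w1 w hw) h2.
  apply: cderiv_eq (cderivM h1 h3) _.
  by rewrite /dM add0r sub0r mulr1.
pose T w := Log (M w).
have T_strip w : disc 0 1 w -> strip (T w) by move=> /ReM/Log_strip.
have hT w : disc 0 1 w -> cderiv T w ((M w)^-1 * dM w).
  move=> hw; apply: (@cderiv_comp R Log M w); last exact: hM.
  by have := cderiv_Log (T_strip w hw); rewrite (LogK (ReM w hw)).
pose B z : C := (cexp z - P) * (cexp z + conjC P)^-1.
have nB z : strip z -> cexp z + conjC P != 0.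
  move=> hz; apply/eqP => /(congr1 (@ReC R)); rewrite ReCD ReC_cexp => e0.
  have e : expR (ReC z) * cos (ImC z) + ReC P = 0 := e0.
  have : 0 < expR (ReC z) * cos (ImC z) by rewrite mulr_gt0 ?expR_gt0 ?strip_cos.
  by lra.
pose dB z := cexp z * (cexp z + conjC P)^-1 +
  (cexp z - P) * (- cexp z / (cexp z + conjC P) ^+ 2).
have hB z : strip z -> cderiv B z (dB z).
  move=> hz.
  have h1 := cderivB (cderiv_cexp z) (cderiv_cst P z).
  have h2 := cderivD (cderiv_cexp z) (cderiv_cst (conjC P) z).
  have h3 := @cderivV R (fun z => cexp z + conjC P) z _ (nB z hz) h2.
  apply: cderiv_eq (cderivM h1 h3) _.
  by rewrite /dB subr0 addr0.
have B1 z : strip z -> absC (B z) <= 1.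
  move=> hz; rewrite /B absCM absCV ler_pdivrMr ?absC_gt0 ?nB// mul1r.
  have gen (u v : C) : 0 < ReC u -> 0 < ReC v -> absC (u - v) <= absC (u + conjC v).
    move=> u0 v0; rewrite -ler_sqr ?nnegrE ?absC_ge0// !absC_sqr !ReImE /=.
    have : 0 < ReC u * ReC v by rewrite mulr_gt0.
    lra.
  by apply: gen => //; rewrite ReC_cexp mulr_gt0 ?expR_gt0 ?strip_cos.
pose H w := B (g (T w)).
have hH w : disc 0 1 w -> cderiv H w (dB (g (T w)) * (dg (T w) * ((M w)^-1 * dM w))).
  move=> hw; have [h1 h2] := hg _ (T_strip w hw).
  apply: (@cderiv_comp R B (fun w => g (T w)) w); first exact: hB.
  by apply: (@cderiv_comp R g T w) => //; exact: hT.
have d0 : disc 0 1 (0 : C) by exact: disc_center ltr01.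
have M0 : M 0 = E by rewrite /M mulr0 addr0 subr0 invr1 mulr1.
have T0 : T 0 = z0.
  apply: conformal_cexp.2; [exact/mem_set/T_strip|exact: mem_set|].
  by rewrite /T M0 LogK.
have := @cauchy_estimate R H 0 1 1 ltr01.
rewrite (cderiv_derive1 (hH 0 d0)) T0 M0 divr1 => K.
have {K} : absC (dB (g z0) * (dg z0 * (E^-1 * dM 0))) <= 1.
  apply: K => w hw; first by eexists; exact: hH.
  by apply: B1; exact: (hg _ (T_strip w hw)).2.
have En : E != 0 by exact: cexp_neq0.
have Pn : P != 0 by exact: cexp_neq0.
have -> : dM 0 = rC (2 * ReC E).
  rewrite /dM subr0 mulr0 addr0 expr1n invr1 opprK !mulr1.
  by move: (E) => v; apply: eq_ReIm; rewrite !ReImE /=; ring.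
have -> : dB (g z0) = P * (rC (2 * ReC P))^-1.
  rewrite /dB -/P subrr mul0r addr0; congr (_ * _^-1).
  by move: (P) => v; apply: eq_ReIm; rewrite !ReImE /=; ring.
rewrite absCM (absCM P) (absCM (dg z0)) (absCM E^-1) !absCV !absC_rC.
have q1 : `|2 * ReC P| = 2 * (absC P * cos (ImC (g z0))).
  by rewrite gtr0_norm ?mulr_gt0// absC_cexp -ReC_cexp.
have q2 : `|2 * ReC E| = 2 * (absC E * cos (ImC z0)).
  by rewrite gtr0_norm ?mulr_gt0// absC_cexp -ReC_cexp.
rewrite q1 q2.
have aP : 0 < absC P by rewrite absC_gt0.
have aE : 0 < absC E by rewrite absC_gt0.
have c1 := strip_cos hgz0; have c2 := strip_cos hz0.
have -> : absC P / (2 * (absC P * cos (ImC (g z0)))) *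
  (absC (dg z0) * ((absC E)^-1 * (2 * (absC E * cos (ImC z0))))) =
  absC (dg z0) * cos (ImC z0) / cos (ImC (g z0)).
  by field; rewrite !gt_eqF.
by rewrite ler_pdivrMr// mul1r.
Qed.

Definition inv_on (D : set C) F w : C := get [set z | D z /\ F z = w].

Lemma inv_onK (D : set C) F : {in D &, injective F} ->
  forall z, D z -> inv_on D F (F z) = z.
Proof.
move=> injF z Dz.
have [Dw E] : [set u | D u /\ F u = F z] (inv_on D F (F z)).
  by apply: (@getPex _ [set u | D u /\ F u = F z]); exists z.
by apply: injF => //; exact: mem_set.
Qed.

(** Schwarz-Pick for the self-map of the strip that is the composite of G and
    the inverse of F. Used in both directions it shows that the density does not
    depend on the conformal map. *)
Lemma conformal_compare F G z w : conformal_on strip F -> conformal_on strip G ->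
  F @` strip = G @` strip -> strip z -> strip w -> F z = G w ->
  absC (derive1 G w) * cos (ImC w) <= absC (derive1 F z) * cos (ImC z).
Proof.
move=> cF cG FG hz hw E.
pose Fi := inv_on strip F.
have FiK u : strip u -> Fi (F u) = u by exact: inv_onK cF.2 u.
have inF u : strip u -> exists2 v, strip v & F v = G u.
  move=> hu; have : (F @` strip) (G u) by rewrite FG; exists u.
  by move=> [v hv e]; exists v.
have := @schwarz_pick_strip (fun u => Fi (G u))
   (fun u => (derive1 F (Fi (G u)))^-1 * derive1 G u) w _ hw.
rewrite -E FiK// => H.
have [F0 _] := inverse_cderiv strip_open cF FiK hz.
have aF : 0 < absC (derive1 F z) by rewrite absC_gt0.
have {H} : absC ((derive1 F z)^-1 * derive1 G w) * cos (ImC w) <= cos (ImC z).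
  apply: H => u hu; have [v hv e] := inF u hu; rewrite -e FiK//; split=> //.
  apply: (@cderiv_comp R Fi G u); last exact: derivable_cderiv (cG.1 u hu).
  by rewrite -e; exact: (inverse_cderiv strip_open cF FiK hv).2.
by rewrite absCM absCV -mulrA ler_pdivrMl.
Qed.

Lemma hyp_density_channel F z : conformal_on strip F -> strip z ->
  hyp_density (channel F) (F z) = (absC (derive1 F z) * cos (ImC z))^-1.
Proof.
move=> cF hz; rewrite /hyp_density; set S := [set _ | _].
have FiK := inv_onK cF.2.
have [F0 _] := inverse_cderiv strip_open cF FiK hz.
have aF : 0 < absC (derive1 F z) by rewrite absC_gt0.
have cz := strip_cos hz.
have : S (get S).
  apply: (@getPex _ S); exists (absC (derive1 F z) * cos (ImC z))^-1.
  exists F, z; split=> //; rewrite invfM mulrAC mulVf ?mul1r// gt_eqF//.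
move=> [G [w [cG GF hw Gw Er]]].
have [G0 _] := inverse_cderiv strip_open cG (inv_onK cG.2) hw.
have aG : 0 < absC (derive1 G w) by rewrite absC_gt0.
have cw := strip_cos hw.
have h1 := conformal_compare cF cG (esym GF) hz hw (esym Gw).
have h2 := conformal_compare cG cF GF hw hz Gw.
have e : absC (derive1 G w) * cos (ImC w) = absC (derive1 F z) * cos (ImC z).
  by apply/eqP; rewrite eq_le h1 h2.
apply: (mulIf (lt0r_neq0 aG)).
by rewrite Er -e invfM mulrAC mulVf ?mul1r// lt0r_neq0.
Qed.

End Hyperbolic.

(** * Hyperbolic length of curves crossing the flow *)

Section Length.
Context {R : realType}.
Local Notation C := (Cplx R).
Implicit Types (z w a : C) (x y b c d r s : R) (F G : C -> C).

(** The integral of 1 / cos from 0 to y, which is the hyperbolic distance in the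
    strip between the real axis and the line at height y. *)
Definition lam y : R := ln ((1 + sin y) / cos y).

Lemma lam0 : lam 0 = 0.
Proof. by rewrite /lam sin0 cos0 addr0 divr1 ln1. Qed.

Lemma sin_gtN1 y : `|y| < pi / 2 -> 0 < 1 + sin y.
Proof.
rewrite ltr_norml => /cos_gt0_pihalf c0.
have := cos2Dsin2 y; have := exprn_gt0 2 c0 => h1 h2.
have : sin y ^+ 2 < 1 by lra.
by move=> h; rewrite ltNge; apply/negP => h'; nra.
Qed.

Lemma is_derive_lam y : `|y| < pi / 2 -> is_derive y (1 : R) lam (cos y)^-1.
Proof.
move=> hy; have s0 := sin_gtN1 hy.
have c0 : 0 < cos y by apply: cos_gt0_pihalf; rewrite -ltr_norml.
have h1 := is_deriveD (is_derive_cst (1 : R) y (1 : R)) (is_derive_sin y).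
have h2 := is_deriveV (lt0r_neq0 c0) (is_derive_cos y).
pose q (t : R) := (1 + sin t) / cos t.
have h3 : is_derive y (1 : R) q _ := is_deriveM h1 h2.
have q0 : 0 < q y by rewrite divr_gt0.
have h := is_derive1_comp (is_derive1_ln q0) h3.
apply: (is_derive_eq h).
rewrite /GRing.scale /= add0r /q -[(cst 1 + sin) y]/(1 + sin y).
have := cos2Dsin2 y.
move: (cos y) (sin y) c0 s0 => u v u0 v0 E.
have -> : ((1 + v) / u)^-1 * ((1 + v) * (- u ^- 2 * - v) + u^-1 * u) =
  (v + (u ^+ 2 + v ^+ 2)) / (u * (1 + v)) by field; rewrite !gt_eqF.
by rewrite E; field; rewrite !gt_eqF.
Qed.

Lemma cont_ReIm (T : topologicalType) (f : T -> C) (t : T) :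
  {for t, continuous (@ReC R \o f)} -> {for t, continuous (@ImC R \o f)} ->
  {for t, continuous f}.
Proof.
move=> hr hi; apply/(cvgCP (nbhs_filter t)) => e e0.
have e20 : 0 < e / 2 by rewrite divr_gt0.
have Hr := (@cvgrPdist_lt _ R T (nbhs t) (nbhs_filter t) _ _).1 hr _ e20.
have Hi := (@cvgrPdist_lt _ R T (nbhs t) (nbhs_filter t) _ _).1 hi _ e20.
near=> s.
have H := absC_le_ReIm (f s - f t); apply: (le_lt_trans H).
rewrite [e]splitr ltrD//.
  by rewrite ReCD ReCN distrC; near: s; exact: Hr.
by rewrite ImCD ImCN distrC; near: s; exact: Hi.
Unshelve. all: by end_near. Qed.

Lemma nondecreasing01 (f df : R -> R) :
  (forall t : R, 0 <= t <= 1 -> is_derive t (1 : R) f (df t)) ->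
  (forall t : R, 0 <= t <= 1 -> 0 <= df t) -> f 0 <= f 1.
Proof.
move=> hf hdf.
have cf : {within `[0, 1], continuous f}.
  apply: derivable_within_continuous => t; rewrite in_itv /= => t01.
  exact: (@ex_derive _ _ _ _ _ _ _ (hf t t01)).
have [|c] := @MVT_segment R f df 0 1 ler01 _ cf.
  by move=> t; rewrite in_itv /= => /andP[a b]; apply: hf; rewrite !ltW.
rewrite in_itv /= subr0 mulr1 => c01 E.
by rewrite -subr_ge0 E; exact: hdf.
Qed.

Lemma variation_le_integral (q : R -> R) (L dL : R -> R) :
  (forall t : R, 0 <= t <= 1 -> {for t, continuous q}) ->
  (forall t : R, 0 <= t <= 1 -> is_derive t (1 : R) L (dL t)) ->
  (forall t : R, 0 <= t <= 1 -> `|dL t| <= q t) ->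
  (`|L 1 - L 0|%:E <= \int[@lebesgue_measure R]_(t in `[0%R, 1%R]) (q t)%:E)%E.
Proof.
move=> cq hL hdL.
pose q1 t := q (clamp 0 1 t).
have cl t : 0 <= clamp 0 1 t <= 1 :> bool by apply: clamp_bound.
have cq1 : continuous q1.
  move=> t; apply: (@continuous_comp _ _ _ (clamp 0 1) q); last exact: cq.
  apply/(@cvgrPdist_lt _ R R (nbhs t) (nbhs_filter t)) => e e0; near=> s.
  rewrite distrC; apply: le_lt_trans (clamp_lip _ _ _ _) _; near: s.
  exact: near_distR.
have [Q hQ] := @real_antiderivative R q1 (-1) cq1.
have hQ' (t : R) : 0 <= t <= 1 -> is_derive t (1 : R) Q (q t).
  move=> t01; have := hQ t; rewrite /q1 clamp_id//; apply.
  by case/andP: t01 => ? ?; lra.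
have cQ (t : R) : 0 <= t <= 1 -> {for t, continuous Q}.
  move=> /hQ' h; apply: differentiable_continuous; apply/derivable1_diffP.
  exact: (@ex_derive _ _ _ _ _ _ _ h).
have -> : (\int[@lebesgue_measure R]_(t in `[0%R, 1%R]) (q t)%:E =
   (Q 1)%:E - (Q 0)%:E)%E.
  have -> : (\int[@lebesgue_measure R]_(t in `[0%R, 1%R]) (q t)%:E =
     \int[@lebesgue_measure R]_(t in `[0%R, 1%R]) (q1 t)%:E)%E.
    by apply: eq_integral => t; rewrite inE /= in_itv /= => t01; rewrite /q1 clamp_id.
  apply: continuous_FTC2; [exact: ltr01| | |].
  - by apply: continuous_subspaceT => t; exact: cq1.
  - split.
    + move=> t; rewrite in_itv /= => /andP[t0 t1].
      by apply: (@ex_derive _ _ _ _ _ _ _ (hQ' t _)); rewrite !ltW.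
    + by apply: cvg_at_right_filter; apply: cQ; rewrite lexx ler01.
    + by apply: cvg_at_left_filter; apply: cQ; rewrite lexx ler01.
  - move=> t; rewrite in_itv /= => /andP[t0 t1].
    have t01 : 0 <= t <= 1 by rewrite !ltW.
    by rewrite derive1E (@derive_val _ _ _ _ _ _ _ (hQ' t t01)) /q1 clamp_id.
rewrite -EFinB lee_fin ler_norml.
have h1 : Q 0 - L 0 <= Q 1 - L 1.
  apply: (@nondecreasing01 (fun t => Q t - L t) (fun t => q t - dL t)) => t t01.
    exact: is_deriveB (hQ' t t01) (hL t t01).
  by have := hdL t t01; rewrite ler_norml => /andP[? ?]; lra.
have h2 : Q 0 + L 0 <= Q 1 + L 1.
  apply: (@nondecreasing01 (fun t => Q t + L t) (fun t => q t + dL t)) => t t01.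
    exact: is_deriveD (hQ' t t01) (hL t t01).
  by have := hdL t t01; rewrite ler_norml => /andP[? ?]; lra.
by apply/andP; split; lra.
Unshelve. all: by end_near. Qed.

Local Opaque derive1.

(** Pulled back by F, the curve moves with hyperbolic speed at least that of its
    height, and [lam] of the height has exactly this speed up to sign. *)
Lemma hyp_length_ge F g z w : conformal_on strip F -> strip z -> strip w ->
  C1_curve (channel F) (F z) (F w) g ->
  (`|lam (ImC w) - lam (ImC z)|%:E <= hyp_length (channel F) g)%E.
Proof.
move=> cF hz hw [[d1 c1] [d2 c2] g0 g1 gD].
pose dg t : C := mkC (derive1 (@ReC R \o g) t) (derive1 (@ImC R \o g) t).
have hg t : rderiv g t (dg t).
  apply/rderivP; split.
    by have := derivableP (d1 t); rewrite -derive1E.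
  by have := derivableP (d2 t); rewrite -derive1E.
have cdg : continuous dg.
  by move=> t; apply: cont_ReIm; [exact: c1|exact: c2].
have FiK := inv_onK cF.2; set Fi := inv_on strip F in FiK.
have inF t : 0 <= t <= 1 -> exists2 v, strip v & F v = g t.
  by move=> /gD[v hv e]; exists v.
pose q t := (absC (derive1 F (Fi (g t))) * cos (ImC (Fi (g t))))^-1 * absC (dg t).
pose L t := lam (ImC (Fi (g t))).
have L0 : L 0 = lam (ImC z) by rewrite /L g0 FiK.
have L1 : L 1 = lam (ImC w) by rewrite /L g1 FiK.
have Fig t : 0 <= t <= 1 ->
    rderiv (Fi \o g) t ((derive1 F (Fi (g t)))^-1 * dg t).
  move=> t01; have [v hv e] := inF t t01.
  apply: rderiv_comp; last exact: hg.
  by rewrite -e FiK//; exact: (inverse_cderiv strip_open cF FiK hv).2.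
have -> : hyp_length (channel F) g =
    (\int[@lebesgue_measure R]_(t in `[0%R, 1%R]) (q t)%:E)%E.
  apply: eq_integral => t; rewrite inE /= in_itv /= => t01.
  have [v hv e] := inF t t01.
  by rewrite /q -e FiK// (hyp_density_channel cF hv).
rewrite -L0 -L1.
apply: (@variation_le_integral q L (fun t => (cos (ImC (Fi (g t))))^-1 *
   ImC ((derive1 F (Fi (g t)))^-1 * dg t))) => t t01.
- have [v hv e] := inF t t01.
  have [F0 _] := inverse_cderiv strip_open cF FiK hv.
  have cFig := rderiv_cont (Fig t t01).
  have dF0 : derive1 F (Fi (g t)) != 0 by rewrite -e FiK.
  have hFi : strip (Fi (g t)) by rewrite -e FiK.
  apply: (@cvgM _ _ (nbhs t) (nbhs_filter t)); last first.
    by apply: (@continuous_comp _ _ _ dg (@absC R)); [exact: cdg|exact: continuous_absC].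
  apply: (@cvgV _ _ (nbhs t) (nbhs_filter t)).
    by rewrite mulf_neq0 ?lt0r_neq0 ?absC_gt0 ?strip_cos.
  apply: (@cvgM _ _ (nbhs t) (nbhs_filter t)).
    apply: (@continuous_comp _ _ _ (Fi \o g) (fun u => absC (derive1 F u))); first exact: cFig.
    apply: (@continuous_comp _ _ _ (derive1 F) (@absC R)); last exact: continuous_absC.
    have /nbhsCP[r r0 hr] := strip_open hFi.
    have [|C1F _] := @holo_derive1 R F (Fi (g t)) r r0.
      by move=> u hu; exists (derive1 F u); apply: derivable_cderiv; exact: cF.1 u (hr u hu).
    exact: (C1F _ (disc_center _ r0)).2.
  apply: (@continuous_comp _ _ _ (Fi \o g) (fun u => cos (ImC u))); first exact: cFig.
  apply: (@continuous_comp _ _ _ (@ImC R) (@cos R)); first exact: continuous_ImC.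
  exact: continuous_cos.
- have [v hv e] := inF t t01.
  have hFi : strip (Fi (g t)) by rewrite -e FiK.
  have [_ h] := (rderivP _ _ _).1 (Fig t t01).
  exact: is_derive1_comp (is_derive_lam hFi) h.
- have [v hv e] := inF t t01.
  have hFi : strip (Fi (g t)) by rewrite -e FiK.
  have [F0 _] := inverse_cderiv strip_open cF FiK hv.
  have dF0 : derive1 F (Fi (g t)) != 0 by rewrite -e FiK.
  have c0 := strip_cos hFi.
  rewrite normrM (gtr0_norm (_ : 0 < (cos _)^-1)) ?invr_gt0// /q invfM.
  rewrite [leRHS]mulrAC [leRHS]mulrC ler_wpM2l ?invr_ge0 ?(ltW c0)//.
  by apply: le_trans (Im_le_absC _) _; rewrite absCM absCV.
Qed.

End Length.

(** * Closed images of closed substrips *)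

Section Properness.
Context {R : realType}.
Local Notation C := (Cplx R).
Implicit Types (z w a p : C) (x y b c d r s : R) (F G : C -> C).

Local Opaque derive1.

Lemma cexp_2pi : cexp (mkC 0 (2 * pi) : C) = 1.
Proof.
by rewrite /cexp /= expR0 rC1 mul1r expi2pi /expi cos0 sin0.
Qed.

(** No branch of log(F - p) takes two values that differ by 2 pi i, because F is
    injective. Its image therefore contains no disc of radius more than 2 pi,
    and Bloch's theorem on a disc of radius r / 3 bounds its derivative; the
    constant is 2 * 3 * 128. *)
Lemma log_derivative_bound F p z r : conformal_on strip F -> ~ channel F p ->
  0 < r -> (forall w, disc z r w -> strip w) ->
  absC (derive1 F z / (F z - p)) <= 768 * pi / r.
Proof.
move=> cF pF r0 hr.
pose G w := F w - p.
have dF w : disc z r w -> cderiv F w (derive1 F w).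
  by move=> hw; apply: derivable_cderiv; exact: cF.1 w (hr w hw).
have dG w : disc z r w -> cderiv G w (derive1 F w).
  by move=> hw; have := cderivB (dF w hw) (cderiv_cst p w); rewrite subr0.
have G0 w : disc z r w -> G w != 0.
  by move=> hw; rewrite subr_eq0; apply/eqP => e; apply: pF; exists w => //; exact: hr.
have [|L hL] := @local_log R G z r r0 _ G0.
  by move=> w hw; exists (derive1 F w); exact: dG.
have r30 : 0 < r / 3 by rewrite divr_gt0.
have sub w : disc z (r / 3) w -> disc z r w by apply: disc_sub; lra.
have [|b hb] := @bloch R L z (r / 3) r30.
  by move=> w hw; eexists; exact: (hL w hw).1.
have zz := disc_center z r30.
rewrite (cderiv_derive1 (hL z zz).1) (cderiv_derive1 (dG z (sub z zz))) -/(G z) in hb.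
rewrite -/(G z); set D := absC _ in hb *.
rewrite leNgt; apply/negP => lt.
have big : 2 * pi < r / 3 * D / 128.
  by move: lt; rewrite ltr_pdivrMr// => h; lra.
have [|u1 hu1 e1] := hb b; first by rewrite subrr absC0; apply: lt_trans big; rewrite mulr_gt0// pi_gt0.
have [|u2 hu2 e2] := hb (b + mkC 0 (2 * pi)).
  have -> : b + mkC 0 (2 * pi) - b = iC * rC (2 * pi) by rewrite mkC_split rC0; ring.
  by rewrite absCM absC_iC absC_rC mul1r ger0_norm// ?mulr_ge0 ?pi_ge0.
have E : F u1 = F u2.
  have : G u1 = G u2.
    rewrite (hL u1 hu1).2 (hL u2 hu2).2 e1 e2; congr (_ * _).
    have -> : b + mkC 0 (2 * pi) - L z = (b - L z) + mkC 0 (2 * pi) by ring.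
    by rewrite (cexpD (b - L z)) cexp_2pi mulr1.
  by rewrite /G => /(congr1 (fun v => v + p)); rewrite !subrK.
have : u1 = u2 by apply: cF.2 E; apply/mem_set/hr/sub.
move=> eu; move: e2; rewrite -eu e1 => /(congr1 (@ImC R)).
rewrite ImCD /= => e; have : 0 < pi :> R by exact: pi_gt0.
by lra.
Qed.

(** Otherwise the inverse of F would be entire with values in the strip, whereas
    by Bloch's theorem on a large enough disc its image contains two points at
    vertical distance pi. *)
Lemma channel_omits F : conformal_on strip F -> exists p, ~ channel F p.
Proof.
move=> cF; apply: contrapT => no.
have all w : channel F w by apply: contrapT => h; apply: no; exists w.
have FiK := inv_onK cF.2; set Fi := inv_on strip F in FiK.
have z0 : strip (0 : C) by rewrite /strip /= normr0 divr_gt0// pi_gt0.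
have [F0 dFi0] := inverse_cderiv strip_open cF FiK z0.
have holoFi w : holo_at Fi w.
  have [v hv <-] := all w; eexists.
  exact: (inverse_cderiv strip_open cF FiK hv).2.
have imFi w : strip (Fi w) by have [v hv <-] := all w; rewrite FiK.
set d := (derive1 F 0)^-1 in dFi0.
have d0 : 0 < absC d by rewrite absC_gt0 invr_neq0.
(* The Bloch disc then has radius pi, the width of the strip. *)
pose r := 128 * pi / absC d.
have p0 : 0 < pi :> R by exact: pi_gt0.
have r0 : 0 < r by rewrite divr_gt0// mulr_gt0.
have [b hb] := @bloch R Fi (F 0) r r0 (fun w _ => holoFi w).
rewrite (cderiv_derive1 dFi0) in hb.
have rd : r * absC d / 128 = pi by rewrite /r; field; rewrite gt_eqF.
rewrite rd in hb.
have ai : absC (iC * rC (pi / 2) : C) < pi.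
  by rewrite absCM absC_iC absC_rC mul1r ger0_norm; lra.
have [|u1 _ e1] := hb (b + iC * rC (pi / 2)).
  by have -> : b + iC * rC (pi / 2) - b = iC * rC (pi / 2) by ring.
have [|u2 _ e2] := hb (b - iC * rC (pi / 2)).
  have -> : b - iC * rC (pi / 2) - b = - (iC * rC (pi / 2)) by ring.
  by rewrite absCN.
have := imFi u1; have := imFi u2; rewrite e1 e2 /strip /= !ReImE /= => /ltr_normlP[? ?] /ltr_normlP[? ?].
lra.
Qed.

(** Integrate [log_derivative_bound] along the vertical segment from the point to
    the real axis. The bound is uniform in x, which is the point. *)
Lemma vertical_compare F p x y y0 : conformal_on strip F -> ~ channel F p ->
  `|y| <= y0 -> y0 < pi / 2 ->
  absC (F (mkC x 0) - p) <=
    expR (768 * pi / (pi / 2 - y0) * y0) * absC (F (mkC x y) - p).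
Proof.
move=> cF pF hy hy0; pose r := pi / 2 - y0; have r0 : 0 < r by rewrite subr_gt0.
pose K := 768 * pi / r.
have K0 : 0 <= K := divr_ge0 (mulr_ge0 (ler0n _ 768) (pi_ge0 R)) (ltW r0).
pose ga t : C := mkC x (y * (1 - t)).
have gaS t : 0 <= t <= 1 -> `|ImC (ga t)| <= y0.
  move=> /andP[t0 t1]; rewrite /= normrM (ger0_norm (_ : 0 <= 1 - t)) ?subr_ge0//.
  by apply: le_trans hy; rewrite ler_piMr//; lra.
have dga (t : R) : rderiv ga t (iC * rC (- y)).
  have := rderiv_line (mkC x y) (iC * rC (- y)) t; apply: rderiv_near; near=> s.
  by apply: eq_ReIm; rewrite !ReImE /=; ring.
have hga t : 0 <= t <= 1 -> strip (ga t).
  by move=> /gaS h; rewrite /strip /=; exact: le_lt_trans h hy0.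
have discga t : 0 <= t <= 1 -> forall w, disc (ga t) r w -> strip w.
  move=> /gaS h w; rewrite /disc /strip /= => hw.
  have := Im_le_absC (w - ga t); rewrite ImCD ImCN => k.
  have := ler_normD (ImC w - ImC (ga t)) (ImC (ga t)); rewrite subrK /r in hw *; lra.
have n0 w : strip w -> F w - p != 0.
  by move=> hw; rewrite subr_eq0; apply/eqP => e; apply: pF; exists w.
pose L (t : R) := ln (absC (F (ga t) - p)).
pose dL t := ReC (derive1 F (ga t) * (iC * rC (- y)) / (F (ga t) - p)).
have hL (t : R) : 0 <= t <= 1 -> is_derive t (1 : R) L (dL t).
  move=> t01; apply: rderiv_ln_abs; first exact/n0/hga.
  have h := rderiv_comp (derivable_cderiv (cF.1 _ (hga t t01))) (dga t).
  by have := rderivB h (rderiv_cst p t); rewrite subr0.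
have dLK (t : R) : 0 <= t <= 1 -> 0 <= K * y0 - dL t.
  move=> t01; rewrite subr_ge0; apply: le_trans (ler_norm _) _.
  apply: le_trans (Re_le_absC _) _; rewrite mulrAC absCM.
  have := log_derivative_bound cF pF r0 (discga t t01); rewrite -/K => h.
  rewrite (absCM iC) absC_iC absC_rC mul1r normrN.
  by apply: ler_pM => //; exact: absC_ge0.
have := @nondecreasing01 R (fun t => K * y0 * t - L t) (fun t => K * y0 - dL t).
rewrite mulr0 mulr1 sub0r => H.
have {H} : - L 0 <= K * y0 - L 1.
  apply: H => t t01; last exact: dLK.
  apply: is_deriveB (hL t t01).
  by have := is_deriveZ (K * y0) (is_derive_id t (1 : R)); rewrite /GRing.scale /= mulr1.
have g1 : ga 1 = mkC x 0 by rewrite /ga subrr mulr0.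
have g0 : ga 0 = mkC x y by rewrite /ga subr0 mulr1.
rewrite /L g1 g0 => H.
have s0 : strip (mkC x 0 : C) by rewrite -g1; apply: hga; rewrite lexx ler01.
have sy : strip (mkC x y : C) by rewrite -g0; apply: hga; rewrite lexx ler01.
have a0 : 0 < absC (F (mkC x 0) - p) by rewrite absC_gt0 n0.
have ay : 0 < absC (F (mkC x y) - p) by rewrite absC_gt0 n0.
have gen (u v k : R) : 0 < u -> 0 < v -> - ln v <= k - ln u -> u <= expR k * v.
  move=> u0 v0 h; rewrite -ler_ln ?posrE ?mulr_gt0 ?expR_gt0//.
  by rewrite lnM ?posrE ?expR_gt0// expRK; lra.
exact: gen a0 ay H.
Unshelve. all: by end_near. Qed.

Definition substrip y0 : set C := [set z | `|ImC z| <= y0].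

(** F tends to infinity on the real axis, and by [vertical_compare] it does so
    uniformly over the substrip. Near w only a compact box of the substrip
    matters, and the image of that box is closed. *)
Lemma closed_substrip_image F y0 : channel_map F -> 0 <= y0 < pi / 2 ->
  forall w, ~ (F @` substrip y0) w -> \forall v \near w, ~ (F @` substrip y0) v.
Proof.
move=> [cF lim] /andP[y00 hy0] w nw.
have [p pF] := channel_omits cF.
pose A := expR (768 * pi / (pi / 2 - y0) * y0).
have A0 : 0 < A by exact: expR_gt0.
(* |F| > M at a point of the axis puts F at distance more than 1 from w on the
   whole vertical segment through it. *)
pose M := A * (absC (w - p) + 1) + absC p.
have z0 : `|0 : R| < pi / 2 by rewrite normr0 divr_gt0// pi_gt0.
have [limp limn] := lim 0 z0.
have [X1 [_ hX1]] := (cvgryPgt _).1 limp M.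
have [X2 [_ hX2]] := (cvgrNyPlt _).1 limn (- M).
pose X := Num.max (`|X1| + 1) (`|X2| + 1).
have far z : substrip y0 z -> X < `|ReC z| -> 1 < absC (F z - w).
  move=> hz; rewrite gt_max => /andP[x1 x2].
  have hM : M < `|ReC (F (mkC (ReC z) 0))|.
    have [zp|zn] := lerP 0 (ReC z).
      rewrite (ger0_norm zp) in x1 x2.
      apply: lt_le_trans (ler_norm _); apply: hX1.
      by have := ler_norm X1; lra.
    rewrite (ltr0_norm zn) in x1 x2.
    rewrite -normrN; apply: lt_le_trans (ler_norm _); rewrite ltrNr; apply: hX2.
    by have := ler_norm (- X2); rewrite normrN; lra.
  have h1 : M < absC (F (mkC (ReC z) 0)) by apply: lt_le_trans hM (Re_le_absC _).
  have := @vertical_compare F p (ReC z) (ImC z) y0 cF pF hz hy0; rewrite mkCE -/A => h2.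
  have h3 := absC_lb (F (mkC (ReC z) 0)) p.
  have : A * (absC (w - p) + 1) < A * absC (F z - p) by rewrite /M in h1; lra.
  rewrite ltr_pM2l// => h4.
  by have := absC_tri (F z) p w; rewrite ?(absC_dist p); lra.
have Kc : compact (F @` closed_box (- X) X (- y0) y0).
  apply: continuous_compact; last exact: compact_closed_box.
  apply: continuous_in_subspaceT => z /set_mem[_ hz].
  apply: cderiv_cont; apply: derivable_cderiv; apply: cF.1.
  by rewrite /strip /=; apply: le_lt_trans hy0; rewrite ler_norml.
have Kcl : closed (F @` closed_box (- X) X (- y0) y0).
  by apply: compact_closed Kc; exact: norm_hausdorff.
have sub : F @` closed_box (- X) X (- y0) y0 `<=` F @` substrip y0.
  by move=> _ [z [_ hz] <-]; exists z => //; rewrite /substrip /= ler_norml.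
have nK : (~` (F @` closed_box (- X) X (- y0) y0)) w by move=> /sub.
have := open_nbhs_nbhs (conj (closed_openC Kcl) nK).
move=> H; near=> v => -[z hz e].
have [far1|near1] := ltP X `|ReC z|.
  have := far z hz far1; rewrite e.
  have : absC (v - w) < 1 by near: v; exact: near_absC.
  by move=> ? ?; lra.
have : (~` (F @` closed_box (- X) X (- y0) y0)) v by near: v; exact: H.
by apply; exists z => //; split; rewrite -ler_norml.
Unshelve. all: by end_near. Qed.

End Properness.

(** * The vertical profile *)

Section Profile.
Context {R : realType}.
Implicit Types (x y a b c d r s e : R).

Definition pos x : R := Num.max x 0.

Lemma pos_lip x y : `|pos x - pos y| <= `|x - y|.
Proof.
rewrite /pos; have [n1 n2] := ler_normlP _ _ (lexx `|x - y|).
by case: (leP x 0) => ?; case: (leP y 0) => ?; rewrite ler_norml; apply/andP; split; lra.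
Qed.

Lemma pos_homo x y : x <= y -> pos x <= pos y.
Proof. by move=> xy; rewrite /pos; case: (leP x 0) => ?; case: (leP y 0) => ?; lra. Qed.

Lemma is_derive_pos2 x : is_derive x (1 : R) (fun y => pos y ^+ 2) (2 * pos x).
Proof.
apply/is_derive1P => e e0; near=> y.
have d : `|y - x| < e by near: y; exact: near_distR.
apply: (@le_trans _ _ (`|y - x| * `|y - x|)); last by rewrite ler_wpM2r// ltW.
rewrite -expr2 real_normK ?num_real// /GRing.scale /= /pos.
have q := sqr_ge0 (y - x); have qx := sqr_ge0 x; have qy := sqr_ge0 y.
by case: (leP y 0) => ?; case: (leP x 0) => ?; rewrite ler_norml; apply/andP; split; nra.
Unshelve. all: by end_near. Qed.

(** The positive part of s, smoothed on [-e, e] to be of class C^1, and its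
    derivative. *)
Definition ramp e s : R := (pos (s + e) ^+ 2 - pos (s - e) ^+ 2) / (4 * e).
Definition dramp e s : R := (pos (s + e) - pos (s - e)) / (2 * e).

Lemma is_derive_translate x c (f : R -> R) d :
  is_derive (x + c) (1 : R) f d -> is_derive x (1 : R) (fun y => f (y + c)) d.
Proof.
move=> h; have := is_deriveD (is_derive_id x (1 : R)) (is_derive_cst c x (1 : R)).
rewrite addr0 => h2; have := @is_derive1_comp R f (fun y => y + c) x _ _ h h2.
by rewrite mulr1.
Qed.

Lemma is_derive_ramp e s : 0 < e -> is_derive s (1 : R) (ramp e) (dramp e s).
Proof.
move=> e0; have h1 := @is_derive_translate s e _ _ (is_derive_pos2 (s + e)).
have h2 := @is_derive_translate s (- e) _ _ (is_derive_pos2 (s + - e)).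
have h : is_derive s (1 : R) (fun y => (4 * e)^-1 * (pos (y + e) ^+ 2 - pos (y - e) ^+ 2)) _ :=
  is_deriveZ (4 * e)^-1 (is_deriveB h1 h2).
have -> : ramp e = fun y => (4 * e)^-1 * (pos (y + e) ^+ 2 - pos (y - e) ^+ 2).
  by apply/funext => y; rewrite /ramp mulrC.
by apply: (is_derive_eq h); rewrite /dramp /GRing.scale /=; field; rewrite gt_eqF.
Qed.

Lemma dramp_homo e x y : 0 < e -> x <= y -> dramp e x <= dramp e y.
Proof.
move=> e0 xy; rewrite /dramp ler_pM2r ?invr_gt0 ?mulr_gt0// /pos.
by case: (leP (x + e) 0) => ?; case: (leP (x - e) 0) => ?;
  case: (leP (y + e) 0) => ?; case: (leP (y - e) 0) => ?; lra.
Qed.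

Lemma dramp01 e x : 0 < e -> 0 <= dramp e x <= 1.
Proof.
move=> e0; have e2 : 0 < 2 * e by rewrite mulr_gt0.
rewrite /dramp ler_pdivrMr// mul1r; apply/andP; split.
  by apply: divr_ge0 (ltW e2); rewrite subr_ge0; apply: pos_homo; lra.
by rewrite /pos; case: (leP (x + e) 0) => ?; case: (leP (x - e) 0) => ?; lra.
Qed.

Lemma dramp_lip e x y : 0 < e -> `|dramp e x - dramp e y| <= `|x - y| / e.
Proof.
move=> e0; have e2 : 0 < 2 * e by rewrite mulr_gt0.
rewrite /dramp -mulrBl normrM normfV (gtr0_norm e2).
rewrite ler_pdivrMr ?mulr_gt0//.
have -> : `|x - y| / e * (2 * e) = `|x - y| + `|x - y| by field; rewrite gt_eqF.
have h1 := pos_lip (x + e) (y + e); have h2 := pos_lip (y - e) (x - e).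
have e1 : x + e - (y + e) = x - y by ring.
have e3 : y - e - (x - e) = y - x by ring.
rewrite e1 in h1; rewrite e3 distrC -(distrC x y) in h2.
have -> : pos (x + e) - pos (x - e) - (pos (y + e) - pos (y - e)) =
  (pos (x + e) - pos (y + e)) + (pos (y - e) - pos (x - e)) by ring.
rewrite distrC in h2.
by apply: le_trans (ler_normD _ _) _; rewrite lerD.
Qed.

Lemma ramp_pos e s : 0 < e -> e <= s -> ramp e s = s.
Proof.
move=> e0 es; rewrite /ramp /pos !max_l; [|lra|lra].
by field; rewrite gt_eqF.
Qed.

Lemma ramp_neg e s : 0 < e -> s <= - e -> ramp e s = 0.
Proof.
by move=> e0 es; rewrite /ramp /pos !max_r; [rewrite subrr mul0r|lra|lra].
Qed.

Lemma ramp0 e : 0 < e -> ramp e 0 = e / 4.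
Proof.
move=> e0; rewrite /ramp /pos add0r sub0r max_l ?max_r; [|lra|lra].
by field; rewrite gt_eqF.
Qed.

(** A smoothed tent supported in [-(L + e), L + e], with slopes at most 1 in
    absolute value. *)
Definition tent e L y : R := ramp e (y + L) - 2 * ramp e y + ramp e (y - L).
Definition dtent e L y : R := dramp e (y + L) - 2 * dramp e y + dramp e (y - L).

Lemma is_derive_tent e L y : 0 < e -> is_derive y (1 : R) (tent e L) (dtent e L y).
Proof.
move=> e0; have h1 := @is_derive_translate y L _ _ (is_derive_ramp (y + L) e0).
have h2 := is_deriveZ 2 (is_derive_ramp y e0).
have h3 := @is_derive_translate y (- L) _ _ (is_derive_ramp (y + - L) e0).
exact: is_deriveD (is_deriveB h1 h2) h3.
Qed.

Lemma dtent_le1 e L y : 0 < e -> 0 <= L -> `|dtent e L y| <= 1.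
Proof.
move=> e0 L0; rewrite /dtent.
have /andP[a0 a1] := dramp01 (y + L) e0; have /andP[b0 b1] := dramp01 y e0.
have /andP[c0 c1] := dramp01 (y - L) e0.
have ab : dramp e y <= dramp e (y + L) by apply: dramp_homo => //; lra.
have bc : dramp e (y - L) <= dramp e y by apply: dramp_homo => //; lra.
by rewrite ler_norml; apply/andP; split; lra.
Qed.

Lemma tent0 e L : 0 < e -> e <= L -> tent e L 0 = L - e / 2.
Proof.
move=> e0 eL; rewrite /tent add0r sub0r ramp0// ramp_pos// ramp_neg//; last by lra.
by field.
Qed.

Lemma tent_out e L y : 0 < e -> 0 <= L -> L + e <= `|y| -> tent e L y = 0.
Proof.
move=> e0 L0; have [y0|y0] := ger0P y => hy.
  by rewrite /tent !ramp_pos//; [ring|lra|lra|lra].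
by rewrite /tent !ramp_neg//; [ring|lra|lra|lra].
Qed.

Lemma continuous_dtent e L : 0 < e -> continuous (dtent e L).
Proof.
move=> e0; have cd c : continuous (fun y => dramp e (y + c)).
  move=> y; apply/(@cvgrPdist_lt _ R R (nbhs y) (nbhs_filter y)) => d d0; near=> s.
  apply: le_lt_trans (dramp_lip _ _ e0) _.
  have -> : y + c - (s + c) = y - s by ring.
  rewrite ltr_pdivrMr// distrC; near: s; apply: near_distR.
  by rewrite mulr_gt0.
have cd0 : continuous (dramp e).
  by have := cd 0; under eq_fun do rewrite addr0.
move=> y; apply: (@cvgD _ _ _ (nbhs y) (nbhs_filter y)); last exact: (cd (- L)).
apply: (@cvgB _ _ _ (nbhs y) (nbhs_filter y)); first exact: (cd L).
apply: (@cvgM _ _ (nbhs y) (nbhs_filter y)); first exact: cvg_cst.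
exact: cd0.
Unshelve. all: by end_near. Qed.

(** The left side is the slope of the affine tent of height A over the interval
    from -pi / 2 to pi / 2; the right side is the largest decrease of slope that
    the dilatation (1 + sin A) / cos A permits. The difference is a concave function of A that
    vanishes at 0 and at pi / 2. *)
Lemma slope_slack (A : R) : 0 < A < pi / 2 -> 2 * A / pi < 1 - cos A / (1 + sin A).
Proof.
move=> /andP[A0 A1]; have p0 : 0 < pi :> R := pi_gt0 R.
pose f (t : R) := 1 - cos t / (1 + sin t) - 2 * t / pi.
pose df (t : R) := (1 + sin t)^-1 - 2 / pi.
have hs (t : R) : 0 <= t <= pi / 2 -> 0 < 1 + sin t.
  by move=> /andP[t0 t1]; rewrite ltr_wpDr//; apply: sin_ge0_pi; apply/andP; split; lra.
have hf (t : R) : 0 <= t <= pi / 2 -> is_derive t (1 : R) f (df t).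
  move=> ht; have s0 := hs t ht.
  have h1 := is_deriveD (is_derive_cst (1 : R) t (1 : R)) (is_derive_sin t).
  have h2 := @is_deriveV R (cst 1 + sin) t (0 + cos t) 1 (lt0r_neq0 s0) h1.
  have h3 := is_deriveM (is_derive_cos t) h2.
  have h4 := is_deriveZ (2 / pi) (is_derive_id t (1 : R)).
  have h : is_derive t (1 : R) (fun y => 1 - cos y * (1 + sin y)^-1 - (2 / pi) * y) _ :=
    is_deriveB (is_deriveB (is_derive_cst (1 : R) t (1 : R)) h3) h4.
  have -> : f = fun y => 1 - cos y * (1 + sin y)^-1 - (2 / pi) * y.
    by apply/funext => y; rewrite /f mulrAC.
  apply: (is_derive_eq h); rewrite /df /GRing.scale /= -[(cst 1 + sin) t]/(1 + sin t).
  have := cos2Dsin2 t; move: (cos t) (sin t) s0 => u v s0 E.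
  have -> : 0 - (u * (- (1 + v) ^- 2 * (0 + u)) + (1 + v)^-1 * - v) - 2 / pi * 1 =
     (u ^+ 2 + v ^+ 2 + v) / (1 + v) ^+ 2 - 2 / pi.
    rewrite mulr1; congr (_ - _); move: (lt0r_neq0 s0) => n0.
    by field.
  rewrite E; congr (_ - _); move: (lt0r_neq0 s0) => n0.
  by field.
have cf a b : 0 <= a -> b <= pi / 2 -> {within `[a, b], continuous f}.
  move=> a0 b1; apply: derivable_within_continuous => t; rewrite in_itv /= => /andP[t0 t1].
  by apply: (@ex_derive _ _ _ _ _ _ _ (hf t _)); apply/andP; split; lra.
have f0 : f 0 = 0 by rewrite /f cos0 sin0 addr0 divr1 mulr0 mul0r subrr subr0.
have f1 : f (pi / 2) = 0.
  rewrite /f cos_pihalf mul0r subr0; rewrite (mulrC 2) divfK// divff ?gt_eqF//.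
  by rewrite subrr.
have [|xi hxi Exi] := @MVT R f df 0 A A0 _ (cf 0 A (lexx _) (ltW A1)).
  by move=> t; rewrite in_itv /= => /andP[? ?]; apply: hf; apply/andP; split; lra.
have [|eta heta Eeta] := @MVT R f df A (pi / 2) A1 _ (cf A (pi / 2) (ltW A0) (lexx _)).
  by move=> t; rewrite in_itv /= => /andP[? ?]; apply: hf; apply/andP; split; lra.
move: hxi heta; rewrite !in_itv /= => /andP[x0 x1] /andP[e0 e1].
rewrite -subr_gt0 -/(f A) ltNge; apply/negP => neg.
have d1 : df xi <= 0.
  have : df xi * A <= 0 by rewrite f0 !subr0 in Exi; rewrite -Exi.
  by rewrite pmulr_lle0.
have d2 : 0 <= df eta.
  have : 0 <= df eta * (pi / 2 - A) by rewrite -Eeta f1 sub0r oppr_ge0.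
  by rewrite pmulr_lge0// subr_gt0.
have : (1 + sin xi)^-1 <= (1 + sin eta)^-1 by move: d1 d2; rewrite /df; lra.
rewrite lef_pV2 ?posrE; [|by apply: hs; apply/andP; split; lra|by apply: hs; apply/andP; split; lra].
rewrite lerD2l leNgt => /negP; apply.
by rewrite ltr_sin ?in_itv /=; [lra|apply/andP; split; lra|apply/andP; split; lra].
Qed.

(** The exponential of the hyperbolic distance, in the strip, between the real
    axis and the line at height a. *)
Definition dil a : R := (1 + sin `|a|) / cos `|a|.

Lemma dil_facts a : `|a| < pi / 2 -> [/\ 1 <= dil a, 0 < dil a & (dil a)^-1 = cos `|a| / (1 + sin `|a|)].
Proof.
move=> ha; have a0 := normr_ge0 a; have p0 := pi_gt0 R.
have c0 : 0 < cos `|a| by apply: cos_gt0_pihalf; apply/andP; split; lra.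
have s0 : 0 <= sin `|a| by apply: sin_ge0_pi; apply/andP; split; lra.
have c1 := cos_le1 `|a|.
split; last by rewrite /dil invfM invrK mulrC.
  by rewrite /dil ler_pdivlMr// mul1r; lra.
by rewrite divr_gt0//; lra.
Qed.

(** The identity plus a multiple of a tent of height a. By [slope_slack] the tent
    fits strictly inside the strip, which leaves room to round its corners and to
    keep the identity near the boundary. The lower bound on the slope implies the
    upper one, as 2 <= M + 1 / M. *)
Lemma profile_exists a : `|a| < pi / 2 -> exists (y0 : R) (u du : R -> R),
  [/\ 0 <= y0 < pi / 2, u 0 = a, (forall y, y0 <= `|y| -> u y = y),
      (forall y : R, is_derive y (1 : R) u (du y)) /\ continuous du &
      forall y, (dil a)^-1 <= du y <= dil a].
Proof.
move=> ha; have [M1 M0 Mi] := dil_facts ha; have p0 := pi_gt0 R.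
pose k := 1 - (dil a)^-1.
have k0 : 0 <= k by rewrite subr_ge0 invf_le1.
(* The half-width at which a tent of height |a| has slope k. *)
pose m := `|a| / k.
have [m0 m1 am] : [/\ 0 <= m, m < pi / 2 & `|a| = k * m].
  have [a0|an] := eqVneq a 0.
    by rewrite /m a0 normr0 mul0r mulr0; split; lra.
  have ap : 0 < `|a| by rewrite normr_gt0.
  have : 2 * `|a| / pi < k by rewrite /k Mi; apply: slope_slack; rewrite ap ha.
  rewrite ltr_pdivrMr// => h.
  have kp : 0 < k by rewrite -(pmulr_lgt0 _ p0); lra.
  split; first by rewrite divr_ge0.
    by rewrite /m ltr_pdivrMr//; lra.
  by rewrite /m mulrC divfK// gt_eqF.
(* The room g is shared out: the support of the tent ends g / 8 before pi / 2,
   and the rounding lowers the top only by e / 2. *)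
pose g := pi / 2 - m; have g0 : 0 < g by rewrite subr_gt0.
pose e := g / 8; have e0 : 0 < e by rewrite divr_gt0.
pose L := pi / 2 - g / 4.
have gp : g <= pi / 2 by rewrite /g; lra.
have eL : e <= L by rewrite /e /L; lra.
have L0 : 0 <= L by lra.
pose T := L - e / 2; have T0 : 0 < T by rewrite /T; lra.
have mT : m <= T by rewrite /T /L /e /g; rewrite /g in g0; lra.
pose q := a / T.
have qk : `|q| <= k.
  rewrite /q normrM normfV (gtr0_norm T0) ler_pdivrMr// am.
  by rewrite ler_wpM2l.
exists (L + e), (fun y => y + q * tent e L y), (fun y => 1 + q * dtent e L y).
split.
- by apply/andP; split; [lra|rewrite /L /e; lra].
- by rewrite add0r tent0// /q -/T divfK// gt_eqF.
- by move=> y hy; rewrite tent_out// mulr0 addr0.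
- split=> [y|y].
    exact: is_deriveD (is_derive_id y (1 : R)) (is_deriveZ q (is_derive_tent L y e0)).
  apply: (@cvgD _ _ _ (nbhs y) (nbhs_filter y)); first exact: cvg_cst.
  apply: (@cvgM _ _ (nbhs y) (nbhs_filter y)); first exact: cvg_cst.
  exact: continuous_dtent.
move=> y; have h : `|q * dtent e L y| <= k.
  by rewrite normrM -[leRHS]mulr1; apply: ler_pM => //; exact: dtent_le1.
have [h1 h2] := ler_normlP _ _ h.
have M2 : 2 <= dil a + (dil a)^-1.
  rewrite -(ler_pM2r M0) [leRHS]mulrDl mulVf ?gt_eqF//.
  by have := sqr_ge0 (dil a - 1); move: (dil a) => x; nra.
by apply/andP; split; rewrite /k in h1 h2; lra.
Qed.

Lemma profile_inverse (u du : R -> R) (k y0 : R) : 0 < k -> 0 <= y0 ->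
  (forall y : R, is_derive y (1 : R) u (du y)) -> (forall y, k <= du y) ->
  (forall y, y0 <= `|y| -> u y = y) ->
  exists v : R -> R, [/\ forall y, v (u y) = y, forall y, u (v y) = y,
    continuous v & forall y, y0 <= `|y| -> v y = y].
Proof.
move=> k0 y00 hu hk out.
have incr x y : x <= y -> k * (y - x) <= u y - u x.
  move=> xy.
  have cu : {within `[x, y], continuous u}.
    apply: derivable_within_continuous => t _.
    exact: (@ex_derive _ _ _ _ _ _ _ (hu t)).
  have [t _ ->] := @MVT_segment R u du x y xy (fun t _ => hu t) cu.
  by rewrite ler_wpM2r// subr_ge0.
have inju x y : k * `|x - y| <= `|u x - u y|.
  have [xy|/ltW yx] := leP x y.
    rewrite distrC ger0_norm ?subr_ge0// distrC.
    by apply: le_trans (incr x y xy) (ler_norm _).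
  by rewrite ger0_norm ?subr_ge0//; apply: le_trans (incr y x yx) (ler_norm _).
have surj w : exists y, u y = w.
  have [|hw] := leP y0 `|w|; first by move=> /out e; exists w.
  have [w1 w2] := ltr_normlP _ _ hw.
  have cu : {within `[- y0, y0], continuous u}.
    apply: derivable_within_continuous => t _.
    exact: (@ex_derive _ _ _ _ _ _ _ (hu t)).
  have yy : - y0 <= y0 by lra.
  have [|c _ E] := @IVT R u (- y0) y0 w yy cu.
    rewrite !out ?normrN ?(ger0_norm y00)// min_l// max_r//.
    by apply/andP; split; lra.
  by exists c.
(* The map u shrinks distances by at most the factor k, so v is Lipschitz. *)
pose v w := sval (cid (surj w)).
have uv w : u (v w) = w by rewrite /v; case: cid.
have vu y : v (u y) = y.
  have := inju (v (u y)) y; rewrite uv subrr normr0 => h.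
  apply/eqP; rewrite -subr_eq0 -normr_le0.
  by rewrite -(pmulr_rle0 _ k0).
exists v; split=> //; last by move=> y hy; rewrite -{1}(out y hy) vu.
move=> y; apply/(@cvgrPdist_lt _ R R (nbhs y) (nbhs_filter y)) => e e0; near=> s.
have := inju (v y) (v s); rewrite !uv => h.
rewrite -(ltr_pM2l k0); apply: le_lt_trans h _.
by rewrite distrC; near: s; apply: near_distR; rewrite mulr_gt0.
Unshelve. all: by end_near. Qed.

End Profile.

(** * Weak derivatives of C^1 functions *)

Section Weak.
Context {R : realType}.
Implicit Types (u w psi : R * R -> R) (p : R * R).

Lemma open_measurable2 (A : set (R * R)) : open A -> measurable A.
Proof.
move=> oA.
pose B (q : rat * rat * rat) : set (R * R) :=
  `]ratr q.1.1 - ratr q.2, ratr q.1.1 + ratr q.2[%classic `*`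
  `]ratr q.1.2 - ratr q.2, ratr q.1.2 + ratr q.2[%classic.
have -> : A = \bigcup_(q in [set q | B q `<=` A]) B q.
  apply/seteqP; split=> [[x y] Ap|p [q hq]]; last exact: hq.
  have /nbhs_ballP[e /= e0 he] := oA _ Ap.
  have [r] := @rat_in_itvoo R 0 (e / 2) (divr_gt0 e0 (ltr0Sn _ 1)).
  rewrite inE /= => /itvP hr.
  have r0 : 0 < ratr r :> R by rewrite hr.
  have re : ratr r < e / 2 by rewrite hr.
  have [a] := @rat_in_itvoo R (x - ratr r) (x + ratr r) ltac:(lra).
  rewrite inE /= => /itvP ha.
  have [b] := @rat_in_itvoo R (y - ratr r) (y + ratr r) ltac:(lra).
  rewrite inE /= => /itvP hb.
  have a1 : x - ratr r < ratr a by rewrite ha.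
  have a2 : ratr a < x + ratr r by rewrite ha.
  have b1 : y - ratr r < ratr b by rewrite hb.
  have b2 : ratr b < y + ratr r by rewrite hb.
  exists (a, b, r); last first.
    by split; rewrite /= in_itv /=; apply/andP; split; lra.
  move=> [x' y'] [/=]; rewrite !in_itv /= => /andP[x1 x2] /andP[y1 y2].
  by apply: he; split => /=; rewrite /ball /= ltr_norml; apply/andP; split; lra.
rewrite bigcup_mkcond; apply: countable_bigcupT_measurable => // q.
by case: ifPn => // _; apply: measurableX.
Qed.

Lemma continuous_measurable2 u : continuous u -> measurable_fun setT u.
Proof.
move=> /continuousP cu; apply: (measurability _ (measurable_realfun.RGenOpens.measurableE R)) => _ [_ [a [b ->] <-]].
rewrite setTI; apply: open_measurable2; exact/cu/interval_open.
Qed.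

Definition square (M : R) : set (R * R) := `[- M, M]%classic `*` `[- M, M]%classic.

(** Measurability is meant for the product of the Borel structures that carry
    Lebesgue measure, hence the explicit type. *)
Lemma compact_square (K : set (R * R)) : compact K ->
  exists M : R, [/\ 0 < M, K `<=` square M,
    @measurable _ (measurableTypeR R * measurableTypeR R)%type K & (mu2 K < +oo)%E].
Proof.
move=> cK; have mK : measurable K.
  have /closed_openC/open_measurable2/measurableC : closed K.
    by apply: compact_closed cK; exact: norm_hausdorff.
  by rewrite setCK.
have [M [_ hM]] := compact_bounded cK.
have sK : K `<=` square (`|M| + 1).
  move=> [x y] /(hM (`|M| + 1)) h.
  have : `|(x, y)| <= `|M| + 1 by apply: h; rewrite ltr_pwDr// ler_norm.
  rewrite prod_normE /= ge_max !ler_norml => /andP[/andP[? ?] /andP[? ?]].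
  by split; rewrite /= in_itv /=; apply/andP; split.
exists (`|M| + 1); split=> //.
apply: (@le_lt_trans _ _ (mu2 (square (`|M| + 1)))).
  by apply: le_measure => //; rewrite inE //; exact: measurableX.
set I := `[- (`|M| + 1), `|M| + 1]%classic.
have -> : mu2 (square (`|M| + 1)) = (@lebesgue_measure R I * @lebesgue_measure R I)%E.
  exact: product_measure1E.
rewrite lebesgue_measure_itv.
by case: ifP => _; rewrite ?mule0 ?ltry// -EFinB -EFinM ltry.
Qed.

Lemma compact_integrable u (K : set (R * R)) : continuous u -> compact K ->
  mu2.-integrable K (EFin \o u).
Proof.
move=> cu cK; have [M [_ _ mK fK]] := compact_square cK.
apply: measurable_bounded_integrable => //.
  exact: measurable_funTS (continuous_measurable2 cu).
have /compact_bounded[B [_ hB]] := continuous_compact (continuous_subspaceT cu) cK.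
by exists B; split; rewrite ?num_real // => ? ? ? ?; exact: hB.
Qed.

Lemma continuous_L2loc u : continuous u -> L2loc setT u.
Proof.
move=> cu; split; first exact: continuous_measurable2.
move=> K cK _.
have c2 : continuous (fun p => u p ^+ 2).
  by move=> p; apply: (@cvgM _ _ (nbhs p) (nbhs_filter p)); exact: cu.
have := compact_integrable c2 cK => /integrableP[_].
apply: le_lt_trans; apply: ge0_le_integral => //=.
- by have [M [? ? ? ?]] := compact_square cK.
- by move=> p _; rewrite lee_fin sqr_ge0.
- apply/measurable_realfun.measurable_EFinP; exact: measurable_funTS (continuous_measurable2 c2).
- apply/measurable_realfun.measurable_EFinP; apply: measurableT_comp => //.
  exact: measurable_funTS (continuous_measurable2 c2).
- by move=> p _; rewrite lee_fin ler_norm.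
Qed.

Lemma support_integral u (K : set (R * R)) : (forall p, ~ K p -> u p = 0) ->
  (EFin \o u) = (EFin \o u) \_ K.
Proof.
move=> h; apply/funext => p; rewrite patchE; case: ifPn => //= /negP pK.
by rewrite h// => Kp; apply: pK; rewrite inE.
Qed.

Lemma support_integrable u (K : set (R * R)) : continuous u -> compact K ->
  (forall p, ~ K p -> u p = 0) -> mu2.-integrable setT (EFin \o u).
Proof.
move=> cu cK hK; rewrite (support_integral hK).
have [M [_ _ mK _]] := compact_square cK.
apply: (@integrable_mkcond _ (measurableTypeR R * measurableTypeR R)%type R _ K (EFin \o u) mK).1.
exact: compact_integrable.
Qed.

Lemma derive_integral0 (W dW : R -> R) (M : R) : 0 < M ->
  (forall t : R, is_derive t (1 : R) W (dW t)) -> continuous dW ->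
  (forall t, M <= `|t| -> W t = 0) -> (forall t, M < `|t| -> dW t = 0) ->
  (\int[@lebesgue_measure R]_t (dW t)%:E = 0)%E.
Proof.
move=> M0 hW cW W0 dW0.
have -> : (fun t => (dW t)%:E) = (fun t => (dW t)%:E) \_ `[- M, M].
  apply/funext => t; rewrite patchE; case: ifPn => // /negP tM.
  rewrite dW0// ltNge; apply/negP => h; apply: tM; rewrite inE /= in_itv /=.
  by rewrite -ler_norml.
rewrite -integral_mkcond.
have dWt t : derivable W t 1 by exact: (@ex_derive _ _ _ _ _ _ _ (hW t)).
have cWt : continuous W.
  by move=> t; apply: differentiable_continuous; apply/derivable1_diffP.
rewrite (@continuous_FTC2 R dW W).
- by rewrite !W0 ?normrN ?gtr0_norm// sube0.
- by lra.
- exact: continuous_subspaceT.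
- split=> [t _||]; first exact: dWt.
    exact: cvg_at_right_filter (cWt _).
  exact: cvg_at_left_filter (cWt _).
- by move=> t _; rewrite derive1E; exact: (@derive_val _ _ _ _ _ _ _ (hW t)).
Qed.

Lemma slice0 u (x y d : R) :
  is_derive (x, y) (axis ord0) u d <-> is_derive x (1 : R) (fun t => u (t, y)) d.
Proof.
have E : (fun s : R => s^-1 *: (u (s *: axis ord0 + (x, y)) - u (x, y))) =
  (fun s : R => s^-1 *: (u (s *: 1 + x, y) - u (x, y))).
  apply/funext => s; congr (_ *: (u _ - _)).
  rewrite /axis eqxx [LHS]surjective_pairing; congr pair.
  by change (s * 0 + y = y); rewrite mulr0 add0r.
have D1 : derivable u (x, y) (axis ord0) = derivable (fun t => u (t, y)) x 1.
  by rewrite /derivable E.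
have D2 : 'D_(axis ord0) u (x, y) = 'D_1 (fun t => u (t, y)) x by rewrite /derive E.
split=> -[h1 h2]; split; [by rewrite -D1|by rewrite -D2|by rewrite D1|by rewrite D2].
Qed.

Lemma slice1 u (x y d : R) :
  is_derive (x, y) (axis ord_max) u d <-> is_derive y (1 : R) (fun t => u (x, t)) d.
Proof.
have E : (fun s : R => s^-1 *: (u (s *: axis ord_max + (x, y)) - u (x, y))) =
  (fun s : R => s^-1 *: (u (x, s *: 1 + y) - u (x, y))).
  apply/funext => s; congr (_ *: (u _ - _)).
  rewrite /axis /= [LHS]surjective_pairing; congr pair.
  by change (s * 0 + x = x); rewrite mulr0 add0r.
have D1 : derivable u (x, y) (axis ord_max) = derivable (fun t => u (x, t)) y 1.
  by rewrite /derivable E.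
have D2 : 'D_(axis ord_max) u (x, y) = 'D_1 (fun t => u (x, t)) y by rewrite /derive E.
split=> -[h1 h2]; split; [by rewrite -D1|by rewrite -D2|by rewrite D1|by rewrite D2].
Qed.

Lemma continuous_slice0 u (y : R) : continuous u -> continuous (fun t => u (t, y)).
Proof.
move=> cu t; apply: (@continuous_comp _ _ _ (fun t : R => (t, y)) u); last exact: cu.
exact: (@cvg_pair R R R (nbhs t) (nbhs t) (nbhs y) (nbhs_filter t) (nbhs_filter t)
  (nbhs_filter y) id (cst y) cvg_id (cvg_cst y)).
Qed.

Lemma continuous_slice1 u (x : R) : continuous u -> continuous (fun t => u (x, t)).
Proof.
move=> cu t; apply: (@continuous_comp _ _ _ (fun t : R => (x, t)) u); last exact: cu.
exact: (@cvg_pair R R R (nbhs t) (nbhs x) (nbhs t) (nbhs_filter t) (nbhs_filter x)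
  (nbhs_filter t) (cst x) id (cvg_cst x) cvg_id).
Qed.

Lemma ord2P (j : 'I_2) : j = ord0 \/ j = ord_max.
Proof. by case: j => [[|[|n]] h]; [left|right|by []]; apply/eqP. Qed.

(** Fubini's theorem in the order that integrates first along axis j, where the
    integral of the derivative of a compactly supported function vanishes. *)
Lemma partial_integral0 (j : 'I_2) u (K : set (R * R)) :
  (forall p, derivable u p (axis j)) -> continuous (partial j u) -> compact K ->
  (forall p, ~ K p -> u p = 0) -> (forall p, ~ K p -> partial j u p = 0) ->
  (\int[mu2]_p (partial j u p)%:E = 0)%E.
Proof.
move=> hu cu cK u0 du0; have iu := support_integrable cu cK du0.
have [M [M0 KM _ _]] := compact_square cK.
have out p : (M < `|p.1|) || (M < `|p.2|) -> ~ K p.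
  move=> + Kp; have [] := KM p Kp; rewrite /= !in_itv /= -!ler_norml => h1 h2.
  by rewrite !ltNge h1 h2.
have M1 : 0 < M + 1 by lra.
have [ej|ej] := ord2P j; subst j.
  rewrite -(integral21_prod_meas1 iu).
  rewrite (_ : fubini_G _ _ = cst 0%E) ?integral0//; apply/funext => y.
  apply: (@derive_integral0 (fun t => u (t, y)) (fun t => partial ord0 u (t, y)) (M + 1)) => //.
  - by move=> t; apply/slice0; exact: DeriveDef (hu _) erefl.
  - exact: continuous_slice0.
  - by move=> t ht; apply: u0; apply: out; apply/orP; left => /=; lra.
  - by move=> t ht; apply: du0; apply: out; apply/orP; left => /=; lra.
rewrite -(integral12_prod_meas1 iu).
rewrite (_ : fubini_F _ _ = cst 0%E) ?integral0//; apply/funext => x.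
apply: (@derive_integral0 (fun t => u (x, t)) (fun t => partial ord_max u (x, t)) (M + 1)) => //.
- by move=> t; apply/slice1; exact: DeriveDef (hu _) erefl.
- exact: continuous_slice1.
- by move=> t ht; apply: u0; apply: out; apply/orP; right => /=; lra.
- by move=> t ht; apply: du0; apply: out; apply/orP; right => /=; lra.
Qed.

Lemma continuousM2 u w : continuous u -> continuous w -> continuous (fun p => u p * w p).
Proof.
move=> cu cw p.
by apply: (@cvgM _ _ (nbhs p) (nbhs_filter p)); [exact: cu|exact: cw].
Qed.

(** The product of u and the test function is compactly supported, so its partial
    derivative integrates to zero. *)
Lemma C1_weak_partial (j : 'I_2) u : continuous u ->
  (forall p, derivable u p (axis j)) -> continuous (partial j u) ->
  weak_partial setT j u (partial j u).
Proof.
move=> cu hu cdu psi [hpsi [K [cK _ psi0]]].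
have cpsi : continuous psi := hpsi 0%N.
have [_ /(_ j)[hd cd]] := hpsi 1%N; rewrite /= in cd.
have oK : open (~` K).
  by apply: closed_openC; apply: compact_closed cK; exact: norm_hausdorff.
have dpsi0 p : ~ K p -> partial j psi p = 0.
  move=> Kp; rewrite /partial (@near_eq_derive _ _ _ psi (cst 0)) ?derive_cst//.
  by have := oK p Kp; apply: filterS => q; exact: psi0.
have hw p : derivable (fun q => u q * psi q) p (axis j).
  exact: derivableM (hu p) (hd p).
have Ew : partial j (fun q => u q * psi q) = fun p => u p * partial j psi p + partial j u p * psi p.
  apply/funext => p; rewrite /partial (deriveM (hu p) (hd p)) /GRing.scale /=.
  by rewrite (mulrC (psi p)).
have c1 := continuousM2 cu cd; have c2 := continuousM2 cdu cpsi.
have z1 p : ~ K p -> u p * partial j psi p = 0 by move=> /dpsi0 ->; rewrite mulr0.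
have z2 p : ~ K p -> partial j u p * psi p = 0 by move=> /psi0 ->; rewrite mulr0.
have i1 := support_integrable c1 cK z1; have i2 := support_integrable c2 cK z2.
have : (\int[mu2]_p (partial j (fun q => u q * psi q) p)%:E = 0)%E.
  apply: (@partial_integral0 j _ K hw _ cK).
  - rewrite Ew => p.
    by apply: (@cvgD _ _ _ (nbhs p) (nbhs_filter p)); [exact: c1|exact: c2].
  - by move=> p /psi0 ->; rewrite mulr0.
  - by move=> p Kp; rewrite Ew z1// z2// addr0.
rewrite Ew; under eq_integral do rewrite EFinD.
rewrite (integralD measurableT i1 i2).
have f1 := integrable_fin_num measurableT i1; have f2 := integrable_fin_num measurableT i2.
rewrite -(fineK f1) -(fineK f2) -EFinD -EFinN => -[] /eqP; rewrite addr_eq0 => /eqP ->.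
by [].
Qed.

End Weak.

(** * Conjugating the shear by a channel map *)

Section Straightening.
Context {R : realType}.
Local Notation C := (Cplx R).
Implicit Types (z w e : C) (F : C -> C) (p q dp : R -> R) (x y : R).
Local Opaque derive1.

Definition shear p z : C := mkC (ReC z) (p (ImC z)).

(** The vertical map of height profile p, carried to the channel by F and extended
    by the identity. *)
Definition transport F p w : C :=
  if `[< channel F w >] then F (shear p (inv_on (@strip R) F w)) else w.

Lemma transport_in F p z : conformal_on strip F -> strip z -> transport F p (F z) = F (shear p z).
Proof.
move=> [_ iF] hz; rewrite /transport; case: asboolP => [_|[]]; last by exists z.
by rewrite inv_onK.
Qed.

Lemma transport_out F p w : ~ channel F w -> transport F p w = w.
Proof. by move=> hw; rewrite /transport; case: asboolP. Qed.

Lemma shear_id p z : p (ImC z) = ImC z -> shear p z = z.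
Proof. by move=> h; apply: eq_ReIm. Qed.

(** If p sent a height y below y0 to one above it, then q would fix p y, so that
    y = q (p y) = p y. *)
Lemma shear_strip p q y0 z : y0 < pi / 2 -> (forall y, q (p y) = y) ->
  (forall y, y0 <= `|y| -> p y = y) -> (forall y, y0 <= `|y| -> q y = y) ->
  strip z -> strip (shear p z).
Proof.
move=> y01 qp p0 q0 hz; rewrite /strip /= /shear /ImC /= -/(ImC z).
have [hy|hy] := leP y0 `|ImC z|; first by rewrite p0.
rewrite ltNge; apply/negP => h.
have E : p (ImC z) = ImC z by rewrite -[LHS]q0 ?qp//; lra.
by move: h; rewrite E; lra.
Qed.

(** Off the channel the transported map is the identity in a whole neighbourhood,
    because the image of the substrip where it moves points is closed. This is
    what makes it smooth across the boundary, whose shape is arbitrary. *)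
Lemma transport_near_id F p y0 w : channel_map F -> 0 <= y0 < pi / 2 ->
  (forall y, y0 <= `|y| -> p y = y) -> ~ channel F w ->
  \forall v \near w, (exists2 z, strip z /\ y0 < `|ImC z| & F z = v) \/ ~ channel F v.
Proof.
move=> hF hy p0 hw.
have nZ : ~ (F @` substrip y0) w.
  by move=> [z hz e]; apply: hw; exists z => //; move: hz hy; rewrite /strip /substrip /=; lra.
have := closed_substrip_image hF hy nZ; apply: filterS => v nv.
have [[z hz e]|nc] := pselect (channel F v); last by right.
left; exists z => //; split=> //; rewrite ltNge; apply/negP => h.
by apply: nv; exists z.
Qed.

Lemma channel_open F z : conformal_on strip F -> strip z -> \forall w \near F z, channel F w.
Proof.
move=> cF hz; have [d d0 hd] := univalent_open strip_open cF hz ltr01.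
by apply/nbhsCP; exists d => // w /hd[u [hu _ e]]; exists u.
Qed.

Lemma derive1_cont F z : conformal_on strip F -> strip z -> {for z, continuous (derive1 F)}.
Proof.
move=> cF hz; have /nbhsCP[r r0 hr] := strip_open hz.
have [|C1F _] := @holo_derive1 R F z r r0.
  by move=> u hu; exists (derive1 F u); apply: derivable_cderiv; exact: cF.1 u (hr u hu).
exact: (C1F _ (disc_center _ r0)).2.
Qed.

Lemma continuous_near (g k : C -> C) w : (\forall v \near w, g v = k v) ->
  {for w, continuous g} -> {for w, continuous k}.
Proof.
move=> gk /contCP cg; apply/contCP => d d0; have := cg d d0.
have gw := nbhs_singleton gk.
by apply: filterS2 gk => v gv; rewrite -gv -gw.
Qed.

Lemma continuous_const w e : {for w, continuous (fun _ : C => e)}.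
Proof. exact: cderiv_cont (cderiv_cst e w). Qed.

Lemma continuous_shear p w : continuous p -> {for w, continuous (shear p)}.
Proof.
move=> cp; apply: cont_ReIm; first exact: continuous_ReC.
apply: (@continuous_comp _ _ _ (@ImC R) p); [exact: continuous_ImC|exact: cp].
Qed.

Lemma channel_inv F v : conformal_on strip F -> channel F v ->
  strip (inv_on strip F v) /\ F (inv_on strip F v) = v.
Proof. by move=> [_ iF] [z hz <-]; rewrite inv_onK. Qed.

Lemma continuous_transport F p q y0 : channel_map F -> 0 <= y0 < pi / 2 ->
  continuous p -> (forall y, q (p y) = y) ->
  (forall y, y0 <= `|y| -> p y = y) -> (forall y, y0 <= `|y| -> q y = y) ->
  continuous (transport F p).
Proof.
move=> hF hy cp qp p0 q0 w; have [cF _] := hF; have /andP[_ y01] := hy.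
have [[z hz <-]|nw] := pselect (channel F w); last first.
  apply: (@continuous_near id); last exact: cvg_id.
  have := transport_near_id hF hy p0 nw; apply: filterS => v [[z [hz h] <-]|nv].
    by rewrite transport_in// shear_id// p0// ltW.
  by rewrite transport_out.
have hgz := shear_strip y01 qp p0 q0 hz.
apply: (@continuous_near (fun v => F (shear p (inv_on strip F v)))).
  have := channel_open cF hz; apply: filterS => v hv.
  by have [h {2}<-] := channel_inv cF hv; rewrite transport_in.
have [_ dI] := inverse_cderiv strip_open cF (inv_onK cF.2) hz.
apply: (@continuous_comp _ _ _ (inv_on strip F) (F \o shear p)); first exact: cderiv_cont dI.
rewrite inv_onK//; last exact: cF.2.
apply: (@continuous_comp _ _ _ (shear p) F); first exact: continuous_shear.
exact: cderiv_cont (derivable_cderiv (cF.1 _ hgz)).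
Qed.

Lemma transportK F p q y0 : channel_map F -> y0 < pi / 2 ->
  (forall y, q (p y) = y) ->
  (forall y, y0 <= `|y| -> p y = y) -> (forall y, y0 <= `|y| -> q y = y) ->
  forall w, transport F q (transport F p w) = w.
Proof.
move=> [cF _] y01 qp p0 q0 w.
have [[z hz <-]|nw] := pselect (channel F w); last by rewrite !transport_out.
have hgz := shear_strip y01 qp p0 q0 hz.
by rewrite !transport_in//; congr F; apply: eq_ReIm => //; rewrite /shear /ImC /= qp.
Qed.

(** The derivative of [transport F p] in the direction e: the chain rule through
    the inverse of F, the shear and F. *)
Definition transportD F p dp e w : C :=
  if `[< channel F w >] then
    let z := inv_on (@strip R) F w in let s := (derive1 F z)^-1 * e in
    derive1 F (shear p z) * mkC (ReC s) (dp (ImC z) * ImC s)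
  else e.

Lemma transportD_in F p dp e z : conformal_on strip F -> strip z ->
  transportD F p dp e (F z) = derive1 F (shear p z) *
    mkC (ReC ((derive1 F z)^-1 * e)) (dp (ImC z) * ImC ((derive1 F z)^-1 * e)).
Proof.
move=> [_ iF] hz; rewrite /transportD; case: asboolP => [_|[]]; last by exists z.
by rewrite inv_onK.
Qed.

Lemma transportD_out F p dp e w : ~ channel F w -> transportD F p dp e w = e.
Proof. by move=> hw; rewrite /transportD; case: asboolP. Qed.

Lemma profile_slope1 p dp y0 y : (forall y, is_derive y (1 : R) p (dp y)) ->
  (forall y, y0 <= `|y| -> p y = y) -> y0 < `|y| -> dp y = 1.
Proof.
move=> hp p0 hy; have <- := @derive_val _ _ _ _ _ _ _ (hp y).
have -> : 'D_1 p y = 'D_1 id y.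
  apply: near_eq_derive; near=> t; apply: p0.
  have d : `|t - y| < `|y| - y0 by near: t; apply: near_distR; rewrite subr_gt0.
  have := ler_normD (y - t) t; rewrite subrK distrC; lra.
by rewrite derive_id.
Unshelve. all: by end_near. Qed.

Lemma transportD_near_id F p dp e y0 w : channel_map F -> 0 <= y0 < pi / 2 ->
  (forall y, is_derive y (1 : R) p (dp y)) ->
  (forall y, y0 <= `|y| -> p y = y) -> ~ channel F w ->
  \forall v \near w, transportD F p dp e v = e.
Proof.
move=> hF hy hp p0 nw; have [cF _] := hF.
have := transport_near_id hF hy p0 nw; apply: filterS => v [[z [hz h] <-]|nv]; last first.
  by rewrite transportD_out.
have [F0 _] := inverse_cderiv strip_open cF (inv_onK cF.2) hz.
rewrite transportD_in// shear_id; last by rewrite p0// ltW.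
by rewrite (profile_slope1 hp p0 h) mul1r mkCE mulrA divff// mul1r.
Qed.

Lemma continuous_transportD F p q dp e y0 : channel_map F -> 0 <= y0 < pi / 2 ->
  (forall y, is_derive y (1 : R) p (dp y)) -> continuous dp -> (forall y, q (p y) = y) ->
  (forall y, y0 <= `|y| -> p y = y) -> (forall y, y0 <= `|y| -> q y = y) ->
  continuous (transportD F p dp e).
Proof.
move=> hF hy hp cdp qp p0 q0 w; have [cF _] := hF; have /andP[_ y01] := hy.
have cp : continuous p.
  move=> y; apply: differentiable_continuous; apply/derivable1_diffP.
  exact: (@ex_derive _ _ _ _ _ _ _ (hp y)).
have [[z hz <-]|nw] := pselect (channel F w); last first.
  apply: (@continuous_near (fun=> e)); last exact: continuous_const.
  by have := transportD_near_id e hF hy hp p0 nw; apply: filterS => v.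
have hgz := shear_strip y01 qp p0 q0 hz.
have K := inv_onK cF.2.
have [F0 dI] := inverse_cderiv strip_open cF K hz.
have cI := cderiv_cont dI.
pose I := inv_on (@strip R) F.
have E : I (F z) = z by exact: K.
have cS : {for F z, continuous (fun v => (derive1 F (I v))^-1 * e)}.
  apply: (@cvgM _ _ (nbhs (F z)) (nbhs_filter (F z))); last exact: continuous_const.
  apply: (@cvgV _ _ (nbhs (F z)) (nbhs_filter (F z))); first by rewrite E.
  apply: (@continuous_comp _ _ _ I (derive1 F)); first exact: cI.
  by rewrite E; exact: derive1_cont.
apply: (@continuous_near (fun v => derive1 F (shear p (I v)) *
    mkC (ReC ((derive1 F (I v))^-1 * e)) (dp (ImC (I v)) * ImC ((derive1 F (I v))^-1 * e)))).
  have := channel_open cF hz; apply: filterS => v hv.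
  by have [h {5}<-] := channel_inv cF hv; rewrite transportD_in.
apply: (@cvgM _ _ (nbhs (F z)) (nbhs_filter (F z))).
  apply: (@continuous_comp _ _ _ I (derive1 F \o shear p)); first exact: cI.
  rewrite E; apply: (@continuous_comp _ _ _ (shear p) (derive1 F)).
    exact: continuous_shear.
  exact: derive1_cont.
apply: (@cont_ReIm R C (fun v => mkC (ReC ((derive1 F (I v))^-1 * e))
    (dp (ImC (I v)) * ImC ((derive1 F (I v))^-1 * e)))).
  exact: (@continuous_comp _ _ _ (fun v => (derive1 F (I v))^-1 * e) (@ReC R) _ cS (@continuous_ReC R _)).
apply: (@cvgM _ _ (nbhs (F z)) (nbhs_filter (F z))); last first.
  exact: (@continuous_comp _ _ _ (fun v => (derive1 F (I v))^-1 * e) (@ImC R) _ cS (@continuous_ImC R _)).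
apply: (@continuous_comp _ _ _ I (dp \o @ImC R)); first exact: cI.
apply: (@continuous_comp _ _ _ (@ImC R) dp); [exact: continuous_ImC|exact: cdp].
Qed.

Lemma near_line w e (P : C -> Prop) : (\forall v \near w, P v) ->
  \forall t \near (0 : R), P (w + rC t * e).
Proof.
have := rderiv_cont (rderiv_line w e 0) => h hP.
by apply: h; rewrite rC0 mul0r addr0.
Qed.

Lemma rderiv_transport F p q dp e y0 w : channel_map F -> 0 <= y0 < pi / 2 ->
  (forall y, is_derive y (1 : R) p (dp y)) -> (forall y, q (p y) = y) ->
  (forall y, y0 <= `|y| -> p y = y) -> (forall y, y0 <= `|y| -> q y = y) ->
  rderiv (fun t => transport F p (w + rC t * e)) 0 (transportD F p dp e w).
Proof.
move=> hF hy hp qp p0 q0; have [cF _] := hF; have /andP[_ y01] := hy.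
have [[z hz <-]|nw] := pselect (channel F w); last first.
  rewrite transportD_out//; apply: rderiv_near (rderiv_line w e 0).
  have := transport_near_id hF hy p0 nw => /(near_line e); apply: filterS => t.
  move=> [[z [hz h] <-]|nv]; last by rewrite transport_out.
  by rewrite transport_in// shear_id// p0// ltW.
have hgz := shear_strip y01 qp p0 q0 hz.
have K := inv_onK cF.2.
have [F0 dI] := inverse_cderiv strip_open cF K hz.
pose I := inv_on (@strip R) F.
have E0 : F z + rC 0 * e = F z by rewrite rC0 mul0r addr0.
have d1 : rderiv (fun t => I (F z + rC t * e)) 0 ((derive1 F z)^-1 * e).
  by apply: (@rderiv_comp _ I (fun t => F z + rC t * e)); [rewrite E0|exact: rderiv_line].
have I0 : I (F z + rC 0 * e) = z by rewrite E0 /I K.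
have d2 : rderiv (fun t => shear p (I (F z + rC t * e))) 0
   (mkC (ReC ((derive1 F z)^-1 * e)) (dp (ImC z) * ImC ((derive1 F z)^-1 * e))).
  move/rderivP: d1 => [r i]; apply/rderivP; split; first exact: r.
  have hpz : is_derive (ImC (I (F z + rC 0 * e))) (1 : R) p (dp (ImC z)) by rewrite I0.
  exact: (@is_derive1_comp R p (fun t => ImC (I (F z + rC t * e))) 0 _ _ hpz i).
rewrite transportD_in//.
apply: rderiv_near (@rderiv_comp _ F (fun t => shear p (I (F z + rC t * e))) 0 _ _ _ d2); last first.
  by rewrite I0; exact: derivable_cderiv (cF.1 _ hgz).
have := channel_open cF hz => /(near_line e); apply: filterS => t hv.
by have [h EE] := channel_inv cF hv; rewrite -[in RHS]EE transport_in.
Qed.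

(** Directional derivatives along 1 and i are the partial derivatives of the two
    components. *)
Lemma partial_of_rderiv (f : C -> C) (i : 'I_2) (x y : R) :
  (forall d, rderiv (fun t => f (mkC x y + rC t * 1)) 0 d ->
     is_derive (x, y) (axis ord0) (component f i) (if i == ord0 then ReC d else ImC d)) /\
  (forall d, rderiv (fun t => f (mkC x y + rC t * iC)) 0 d ->
     is_derive (x, y) (axis ord_max) (component f i) (if i == ord0 then ReC d else ImC d)).
Proof.
have tr (s : R) : is_derive s (1 : R) (fun t => t - s) (1 : R).
  have := is_deriveB (is_derive_id s (1 : R)) (is_derive_cst s s (1 : R)).
  by rewrite subr0.
split=> d hd.
  apply/slice0.
  have hd' : rderiv (fun t => f (mkC x y + rC t * 1)) (x - x) d by rewrite subrr.
  have := @rderiv_repar R _ (fun t => t - x) x _ _ hd' (tr x); rewrite rC1 mulr1.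
  have -> : (fun t => f (mkC x y + rC t * 1)) \o (fun t => t - x) = fun t => f (mkC t y).
    apply/funext => t /=; congr f; rewrite mulr1; apply: eq_ReIm; rewrite !ReImE /=.
      by rewrite /ReC /= addrC subrK.
    by rewrite /ImC /= addr0.
  by move/rderivP => [hr hi]; rewrite /component; case: (i == ord0).
apply/slice1.
have hd' : rderiv (fun t => f (mkC x y + rC t * iC)) (y - y) d by rewrite subrr.
have := @rderiv_repar R _ (fun t => t - y) y _ _ hd' (tr y); rewrite rC1 mulr1.
have -> : (fun t => f (mkC x y + rC t * iC)) \o (fun t => t - y) = fun t => f (mkC x t).
  apply/funext => t /=; congr f; apply: eq_ReIm; rewrite !ReImE /= /ReC /ImC /=.
    by rewrite mulr0 mul0r subr0 addr0.
  by rewrite mulr1 mul0r addr0 addrC subrK.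
by move/rderivP => [hr hi]; rewrite /component; case: (i == ord0).
Qed.

Lemma eucl_normE (v : 'cV[R]_2) : eucl_norm v ^+ 2 = v ord0 ord0 ^+ 2 + v ord_max ord0 ^+ 2.
Proof.
rewrite /eucl_norm sqr_sqrtr; last by apply: sumr_ge0 => i _; exact: sqr_ge0.
rewrite big_ord_recl big_ord_recl big_ord0 addr0.
by congr (_ + v _ _ ^+ 2); apply/eqP.
Qed.

Lemma op_norm_le (A : 'M[R]_2) (k : R) :
  (forall v, eucl_norm v = 1 -> eucl_norm (A *m v) ^+ 2 <= k) -> op_norm A ^+ 2 <= k.
Proof.
move=> h.
pose e1 : 'cV[R]_2 := \col_i (i == ord0)%:R.
have n1 : eucl_norm e1 = 1.
  apply/eqP; rewrite -(@eqrXn2 _ 2%N)// ?sqrtr_ge0// eucl_normE !mxE /= expr0n addr0.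
  by rewrite expr1n.
have S1 : [set eucl_norm (A *m v) | v in [set v | eucl_norm v = 1]] (eucl_norm (A *m e1)).
  by exists e1.
have k0 : 0 <= k by apply: le_trans (h _ n1); exact: sqr_ge0.
have ub : ubound [set eucl_norm (A *m v) | v in [set v | eucl_norm v = 1]] (Num.sqrt k).
  move=> _ [v hv <-]; rewrite -(@ler_pXn2r _ 2%N)// ?nnegrE ?sqrtr_ge0//.
  by rewrite (sqr_sqrtr k0); exact: h.
have l : op_norm A <= Num.sqrt k.
  by apply: ge_sup ub; exists (eucl_norm (A *m e1)).
have g : 0 <= op_norm A.
  apply: le_trans (sqrtr_ge0 _) (ub_le_sup _ S1); by exists (Num.sqrt k).
by rewrite -(sqr_sqrtr k0) ler_pXn2r ?nnegrE ?sqrtr_ge0.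
Qed.

Lemma det2 (A : 'M[R]_2) :
  \det A = A ord0 ord0 * A ord_max ord_max - A ord0 ord_max * A ord_max ord0.
Proof.
rewrite (expand_det_row _ ord0) big_ord_recl big_ord_recl big_ord0 addr0.
rewrite /cofactor !det_mx11 !mxE /= expr0 mul1r expr1 mulN1r mulrN.
by congr (_ * A _ _ - A _ _ * A _ _); apply/eqP.
Qed.

(** The matrix is multiplication by s, then the diagonal map (1, d), then
    multiplication by P: the outer factors are similarities, and the middle one
    has determinant d and squared norm max(1, d ^ 2) <= k d. *)
Lemma distortion (A : 'M[R]_2) (P s : C) (k d : R) : 0 < k -> k^-1 <= d <= k ->
  (forall i, A i ord0 = (if i == ord0 then @ReC R else @ImC R) (P * mkC (ReC s) (d * ImC s))) ->
  (forall i, A i ord_max = (if i == ord0 then @ReC R else @ImC R) (P * mkC (- ImC s) (d * ReC s))) ->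
  op_norm A ^+ 2 <= k * \det A.
Proof.
move=> k0 /andP[dk1 dk2] A0 A1.
have kd : 1 <= k * d by rewrite mulrC -ler_pdivrMr// mul1r.
have d0 : 0 < d by apply: lt_le_trans dk1; rewrite invr_gt0.
have dd : d ^+ 2 <= k * d by rewrite expr2 ler_pM2r.
apply: op_norm_le => v nv; have := eucl_normE v; rewrite nv expr1n => /esym n1.
rewrite eucl_normE det2 !mxE !big_ord_recl !big_ord0 !addr0.
have -> : lift ord0 ord0 = ord_max :> 'I_2 by apply/eqP.
rewrite !A0 !A1 /=; move: (v ord0 ord0) (v ord_max ord0) n1 => a b n1.
rewrite !ReImE.
have rm (x y : R) : ReC (mkC x y) = x by [].
have im (x y : R) : ImC (mkC x y) = y by [].
rewrite !rm !im; move: (ReC P) (ImC P) (ReC s) (ImC s) => p q x y.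
(* X + iY is s times the unit vector a + ib. *)
pose X := a * x - b * y; pose Y := a * y + b * x.
have XY : X ^+ 2 + Y ^+ 2 = x ^+ 2 + y ^+ 2.
  have -> : X ^+ 2 + Y ^+ 2 = (a ^+ 2 + b ^+ 2) * (x ^+ 2 + y ^+ 2) by rewrite /X /Y; ring.
  by rewrite n1 mul1r.
set L := (X in X <= _); set D := (X in _ <= k * X).
have -> : L = (p ^+ 2 + q ^+ 2) * (X ^+ 2 + d ^+ 2 * Y ^+ 2) by rewrite /L /X /Y; ring.
have -> : k * D = (p ^+ 2 + q ^+ 2) * (k * d * (X ^+ 2 + Y ^+ 2)) by rewrite XY /D; ring.
rewrite ler_wpM2l ?addr_ge0 ?sqr_ge0// mulrDr lerD//.
  by rewrite ler_peMl ?sqr_ge0.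
by rewrite ler_wpM2r ?sqr_ge0.
Qed.

Lemma lam_norm y : `|y| < pi / 2 -> `|lam y| = ln (dil y).
Proof.
move=> hy; have [_ d0 _] := dil_facts hy.
have [M1 _ _] := dil_facts hy.
have [y0|y0] := ger0P y.
  have -> : lam y = ln (dil y) by rewrite /lam /dil ger0_norm.
  by rewrite ger0_norm// ln_ge0.
have c0 : 0 < cos y by apply: cos_gt0_pihalf; have [] := ltr_normlP _ _ hy; lra.
have s1 := sin_gtN1 hy.
have s2 : 0 < 1 - sin y by rewrite -sinN; apply: sin_gtN1; rewrite normrN.
have dE : dil y = (1 - sin y) / cos y by rewrite /dil ltr0_norm// sinN cosN.
have -> : lam y = - ln (dil y).
  rewrite -lnV ?posrE// /lam; congr ln; rewrite dE invf_div.
  apply/eqP; rewrite eqr_div ?lt0r_neq0//; apply/eqP.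
  by have := cos2Dsin2 y; rewrite !expr2; lra.
by rewrite normrN ger0_norm// ln_ge0.
Qed.

End Straightening.

Theorem corollary3 (R : realType) (phi : Cplx R -> Cplx R) (h : Cplx R -> R)
    (c : R) (hphi : channel_map phi) (hh : stream_function phi h)
    (hc : -1 < c < 1) :
  exists (f : Cplx R -> Cplx R) (K : R),
    [/\ quasiconformal K setT setT f,
        f @` stream_line (channel phi) h 0 = stream_line (channel phi) h c,
        (forall w, ~ channel phi w -> f w = w) &
        (K%:E <= expeR (hyp_dist_sets (channel phi)
                          (stream_line (channel phi) h 0)
                          (stream_line (channel phi) h c)))%E].
Proof.
have p0 := pi_gt0 R; have [cF _] := hphi.
pose a := c * pi / 2.
have ha : `|a| < pi / 2.
  by case/andP: hc => c1 c2; rewrite ltr_norml; apply/andP; split; rewrite /a; nra.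
have [y0 [u [du [hy u0 uid [hu cdu] hb]]]] := profile_exists ha.
have [M1 M0 Mi] := dil_facts ha; have /andP[y00 y01] := hy.
have Mi0 : 0 < (dil a)^-1 by rewrite invr_gt0.
have [v [vu uv cv vid]] := profile_inverse Mi0 y00 hu (fun y => proj1 (andP (hb y))) uid.
have cu : continuous u.
  move=> y; apply: differentiable_continuous; apply/derivable1_diffP.
  exact: (@ex_derive _ _ _ _ _ _ _ (hu y)).
pose f := transport phi u.
have cf : continuous f by apply: (@continuous_transport R phi u v y0).
(* In the strip the stream lines are the horizontal lines. *)
have onch (d : R) : `|d| < pi / 2 -> forall z, strip z ->
    (stream_line (channel phi) h (2 * d / pi) (phi z) <-> ImC z = d).
  move=> hd z hz; have e := hh (ReC z) (ImC z) hz; rewrite mkCE in e.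
  split=> [[_]|ez]; last by split; [exists z|rewrite /= e ez].
  rewrite /= e => E.
  by apply: (@mulfI _ (2 / pi)); rewrite ?mulf_neq0 ?invr_eq0 ?gt_eqF// mulrAC E mulrAC.
have onch0 z : strip z -> (stream_line (channel phi) h 0 (phi z) <-> ImC z = 0).
  by have := onch 0; rewrite mulr0 mul0r; apply; rewrite normr0 divr_gt0.
have oncha z : strip z -> (stream_line (channel phi) h c (phi z) <-> ImC z = a).
  have E : 2 * a / pi = c by rewrite /a (mulrC 2) divfK// mulfK ?gt_eqF.
  by have := onch a ha; rewrite E; apply.
(* The partial derivatives of f exist everywhere and are continuous, so f is
   weakly differentiable with these derivatives. *)
pose D (e : Cplx R) (p : R * R) := transportD phi u du e (mkC p.1 p.2).
have cD e : continuous (D e).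
  move=> p; apply: (@continuous_comp _ _ _ (fun p : R * R => mkC p.1 p.2) (transportD phi u du e)).
    exact: continuous_mkC.
  exact: (@continuous_transportD R phi u v du e y0).
pose co (i : 'I_2) : Cplx R -> R := if i == ord0 then @ReC R else @ImC R.
have cco i : continuous (co i).
  by rewrite /co; case: (i == ord0); [exact: continuous_ReC|exact: continuous_ImC].
pose ax (j : 'I_2) : Cplx R := if j == ord0 then 1 else iC.
have dD i j p : is_derive p (axis j) (component f i) (co i (D (ax j) p)).
  have [e0 e1] := @partial_of_rderiv R f i p.1 p.2.
  have E d : (if i == ord0 then ReC d else ImC d) = co i d by rewrite /co; case: (i == ord0).
  have r e := @rderiv_transport R phi u v du e y0 (mkC p.1 p.2) hphi hy hu vu uid vid.
  have [ej|ej] := ord2P j; subst j.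
    by have := e0 _ (r 1); rewrite E -surjective_pairing.
  by have := e1 _ (r iC); rewrite E -surjective_pairing.
have pD i j : partial j (component f i) = fun p => co i (D (ax j) p).
  by apply/funext => p; exact: (@derive_val _ _ _ _ _ _ _ (dD i j p)).
have cpD i j : continuous (partial j (component f i)).
  rewrite pD => p; apply: (@continuous_comp _ _ _ (D (ax j)) (co i)); first exact: cD.
  exact: cco.
have ccf i : continuous (component f i).
  have -> : component f i = fun p => co i (f (mkC p.1 p.2)).
    by apply/funext => p; rewrite /component /co; case: (i == ord0).
  move=> p; apply: (@continuous_comp _ _ _ (fun p : R * R => mkC p.1 p.2) (co i \o f)).
    exact: continuous_mkC.
  by apply: (@continuous_comp _ _ _ f (co i)); [exact: cf|exact: cco].
exists f, (dil a); split.
- split=> //.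
    split; first exact: continuous_subspaceT.
    exists (transport phi v); split.
    + by apply: continuous_subspaceT; apply: (@continuous_transport R phi v u y0).
    + by move=> z _; split=> //; exact: (transportK hphi y01 vu uid vid).
    + by move=> z _; split=> //; exact: (transportK hphi y01 uv vid uid).
  pose A p : 'M[R]_2 := \matrix_(i, j) partial j (component f i) p.
  exists A.
    move=> i; split; first exact: continuous_L2loc.
    move=> j; have -> : (fun p => A p i j) = partial j (component f i).
      by apply/funext => p; rewrite mxE.
    split; first exact: continuous_L2loc.
    apply: C1_weak_partial; [exact: ccf| |exact: cpD].
    by move=> p; exact: (@ex_derive _ _ _ _ _ _ _ (dD i j p)).
  apply: aeW => p _.
  have A0 i : A p i ord0 = co i (D 1 p) by rewrite mxE pD.
  have A1 i : A p i ord_max = co i (D iC p) by rewrite mxE pD.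
  have [[z hz e]|nw] := pselect (channel phi (mkC p.1 p.2)).
    apply: (@distortion R (A p) (derive1 phi (shear u z)) (derive1 phi z)^-1 (dil a) (du (ImC z))) => //.
      by move=> i; rewrite A0 /D -e transportD_in// mulr1.
    move=> i; rewrite A1 /D -e transportD_in// !ReImE /= /ReC /ImC /=.
    by rewrite !mulr0 !mulr1 sub0r addr0.
  (* Off the channel the matrix is the identity. *)
  apply: (@distortion R (A p) 1 1 (dil a) 1) => //.
    by rewrite invf_le1// M1.
  + by move=> i; rewrite A0 /D transportD_out// !mul1r.
  + by move=> i; rewrite A1 /D transportD_out// !mul1r oppr0.
- apply/seteqP; split=> [_ [w h0 <-]|w h0]; have [[z hz ew] _] := h0.
    rewrite -ew in h0 *; have z0 := (onch0 z hz).1 h0.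
    rewrite /f transport_in//; apply/oncha; first exact: shear_strip y01 vu uid vid hz.
    by rewrite /shear /ImC /= -/(ImC z) z0 u0.
  rewrite -ew in h0 *; have za := (oncha z hz).1 h0.
  have h1 := shear_strip y01 uv vid uid hz.
  exists (phi (shear v z)).
    by apply/onch0 => //; rewrite /shear /ImC /= -/(ImC z) za -u0 vu.
  by rewrite /f transport_in//; congr phi; apply: eq_ReIm => //; rewrite /shear /ImC /= uv.
- by move=> w; exact: transport_out.
(* Every admissible curve has length at least |lam a| = ln (dil a). *)
have T : ((ln (dil a))%:E <= hyp_dist_sets (channel phi) (stream_line (channel phi) h 0)
    (stream_line (channel phi) h c))%E.
  apply: le_ereal_inf_tmp => _ [z sz [w sw <-]].
  have [[z1 hz1 ez] _] := sz; have [[w1 hw1 ew] _] := sw.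
  apply: le_ereal_inf_tmp => _ [g hg <-].
  rewrite -ez in sz hg; rewrite -ew in sw hg.
  have z0 := (onch0 _ hz1).1 sz; have wa := (oncha _ hw1).1 sw.
  have := hyp_length_ge cF hz1 hw1 hg.
  by rewrite z0 wa lam0 subr0 lam_norm.
rewrite -[X in (X%:E <= _)%E](lnK (M0 : dil a \is Num.pos)).
apply: le_trans (_ : (expeR (ln (dil a))%:E <= _)%E); first by [].
by rewrite lee_expeR.
Qed.
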